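(* Let $s>1/2$. If $u_0\in G^{1,s+3}$, then there exists a positive time $T=T(u_0,s)$ such that for every $\delta\in\,]0,1[$, the Cauchy problem $$u_t+uu_x+\partial_xB^{-1}\Big[2\mu(u)u+\tfrac12u_x^2-3u_xu_{xxx}-\tfrac72u_{xx}^2\Big]=0,\qquad u(0,x)=u_0(x),$$ has a unique solution which is a holomorphic function valued in $G^{\delta,s+3}$ in the disk $D(0,T(1-\delta))$. Furthermore, the analytic lifespan $T$ satisfies, for $u_0\ne0$, $$T=\frac{\mathrm{const.}}{\|u_0\|_{1,s+3}},$$ where $\mathrm{const.}$ is a positive constant which does not depend on $u_0$ (it may depend on $s$).
   Context: $S^1=\mathbb R/\mathbb Z$; $L^2(S^1)$ denotes real-valued square-integrable functions; $\hat\varphi(k)=\int_{S^1}\varphi(x)e^{-2k\pi ix}\,dx$; $\langle k\rangle=(1+k^2)^{1/2}$. For $\delta\ge0,s\ge0$, $G^{\delta,s}=\{\varphi\in L^2(S^1):\|\varphi\|_{\delta,s}<\infty\}$ with $\|\varphi\|_{\delta,s}^2=\sum_{k\in\mathbb Z}\langle k\rangle^{2s}e^{4\pi\delta|k|}|\hat\varphi(k)|^2$. $\mu(\varphi)=\int_{S^1}\varphi\,dx$ (integration in $x$), $B(\varphi)=\mu(\varphi)+(-\partial_x^2+\partial_x^4)\varphi$, whose inverse is $B^{-1}(\varphi)=\hat\varphi(0)+\sum_{k\ne0}\frac{\hat\varphi(k)}{(2\pi k)^2+(2\pi k)^4}e^{2k\pi ix}$. $D(0,r)=\{t\in\mathbb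 C:|t|<r\}$. For complex $t$ the values of a holomorphic function of $t$ are taken in the complexification of $G^{\delta,s+3}$ (complex-valued functions, same norm), with $\mu$, $B^{-1}$, $\partial_x$ and products extended by the same formulas. *)

(* Defs.v *)
From HB Require Import structures.
From mathcomp Require Import all_boot all_order all_algebra.
From mathcomp Require Import all_classical all_reals all_analysis.
From mathcomp Require Export complex.

Set Implicit Arguments.
Unset Strict Implicit.
Unset Printing Implicit Defensive.

Import Order.TTheory GRing.Theory Num.Theory.
Import numFieldNormedType.Exports.

Local Open Scope classical_set_scope.
Local Open Scope ring_scope.
Local Open Scope complex_scope.

(* A function on the circle R/Z is a 1-periodic function on R, [0, 1] serves as
   a fundamental domain, and elements of L^2 are functions up to [circ_eq].
   Real-valued functions are embedded in the complex-valued ones by [cplx]. *)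
Section Circle.
Variable R : realType.
Implicit Types (f g : R -> R[i]) (k : int) (x : R).
Local Notation I := (`[0%R, 1%R]%classic : set (measurableTypeR R)).

Definition cplx (f : R -> R) : R -> R[i] := fun x => (f x)%:C.

Definition circ_eq f g :=
  {ae (@lebesgue_measure R), forall x : R, I x -> f x = g x}.

Definition circ_L2 f := [/\ periodic f 1,
  measurable_fun I (fun x : R => complex.Re (f x)),
  measurable_fun I (fun x : R => complex.Im (f x)) &
  (\int[lebesgue_measure]_(x in I) (ComplexField.Normc.normc (f x) ^+ 2)%:E
     < +oo)%E].

(* the mean value mu(f) *)
Definition mean f : R[i] :=
  (\int[lebesgue_measure]_(x in I) complex.Re (f x)) +i*
  (\int[lebesgue_measure]_(x in I) complex.Im (f x)).

(* x |-> exp(2 k pi i x) *)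
Definition fexp k x : R[i] :=
  let a := 2 * k%:~R * pi * x in cos a +i* sin a.

Definition fourier f k : R[i] := mean (fun x => f x * fexp (- k) x).

(* d/dx is the weak derivative on the circle.  It is unique up to [circ_eq];
   [Dx f] is a chosen representative, with the value 0 if f has no weak
   derivative in L^2. *)
Definition test_function (phi : R -> R) :=
  periodic phi 1 /\ forall n x, derivable (derive1n n phi) x 1.

Definition is_Dx f g := circ_L2 g /\
  forall phi, test_function phi ->
    mean (fun x => f x * (derive1 phi x)%:C) = - mean (fun x => g x * (phi x)%:C).

Definition Dx f : R -> R[i] := xget (fun=> 0) [set g | is_Dx f g].

Definition limC (z : nat -> R[i]) : R[i] :=
  limn (fun n => complex.Re (z n)) +i* limn (fun n => complex.Im (z n)).

(* the Fourier multiplier of -d^2/dx^2 + d^4/dx^4 *)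
Definition Bsymb k : R[i] :=
  ((2 * pi * k%:~R) ^+ 2 + (2 * pi * k%:~R) ^+ 4)%:C.

(* The inverse of B f = mean f + (- d^2/dx^2 + d^4/dx^4) f; the terms of
   indices k and - k of the series over nonzero integers are grouped. *)
Definition Binv f : R -> R[i] := fun x =>
  fourier f 0 + limC (fun N => \sum_(1 <= k < N.+1)
    (fourier f k%:Z / Bsymb k%:Z * fexp k%:Z x +
     fourier f (- k%:Z) / Bsymb (- k%:Z) * fexp (- k%:Z) x)).

Definition japanese k : R := Num.sqrt (1 + k%:~R ^+ 2).

Definition Gnorm (delta s : R) f : \bar R :=
  ((\esum_(k in [set: int])
     (japanese k `^ (2 * s) * expR (4 * pi * delta * `|k%:~R|) *
      ComplexField.Normc.normc (fourier f k) ^+ 2)%:E) `^ (2^-1))%E.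

(* the complexification of G^{delta,s} *)
Definition Gspace (delta s : R) f := circ_L2 f /\ (Gnorm delta s f < +oo)%E.

Section Evolution.
Variables (delta s : R).
Implicit Types (u : R[i] -> R -> R[i]) (t : R[i]).
Local Notation C := (R[i] : numFieldType).

(* w is the complex derivative of u at t, for the norm of G^{delta,s}; like
   [Dx], [Dt] chooses a representative of it. *)
Definition is_Dt u t (w : R -> R[i]) := Gspace delta s w /\
  Gnorm delta s (fun x => (u (t + h) x - u t x) / h - w x)
    @[h --> (0 : C)^'] --> (0 : \bar R)%E.

Definition Dt u t : R -> R[i] := xget (fun=> 0) [set w | is_Dt u t w].

Definition disk (r : R) : set R[i] :=
  [set t | ComplexField.Normc.normc t < r].

Definition holomorphic_on (D : set R[i]) u := forall t, D t ->
  Gspace delta s (u t) /\ exists w, is_Dt u t w.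

Definition nonlin (v : R -> R[i]) : R -> R[i] := fun x =>
  2 * mean v * v x + 2^-1 * Dx v x ^+ 2
  - 3 * Dx v x * iter 3 Dx v x - 7 / 2 * iter 2 Dx v x ^+ 2.

Definition solves (D : set R[i]) (u0 : R -> R) u :=
  circ_eq (u 0) (cplx u0) /\
  forall t, D t ->
    circ_eq (fun x => Dt u t x + u t x * Dx (u t) x + Dx (Binv (nonlin (u t))) x)
            (fun=> 0).

Definition holomorphic_solution (D : set R[i]) (u0 : R -> R) u :=
  holomorphic_on D u /\ solves D u0 u.

End Evolution.
End Circle.

(* Main.v *)
Require Import Defs.
From mathcomp Require Import all_boot all_order all_algebra.
From mathcomp Require Import all_classical all_reals all_analysis.
From mathcomp Require Import measurable_realfun.
From mathcomp Require Import ring lra zify.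

Import Order.TTheory GRing.Theory Num.Theory.
Import numFieldNormedType.Exports.

(** Everything is read on Fourier coefficients.  For a family a = (a_k) of
    complex numbers and a radius rho, let
      [nrm rho a] = sum_k (1 + |k|)^3 e^(2 pi rho |k|) |a_k|.
    Since sum_k <k>^(-2s) is finite for 2s > 1, the Cauchy-Schwarz inequality
    bounds this norm of the coefficients of f, at rho = delta, by K times the
    norm of f in G^(delta,s+3), with K independent of delta ([nrm_bnd]).
    Conversely the norm of G^(delta,s+3) is at most C [nrm rho] as soon as
    delta < rho ([gnrm_bnd]); the constant C may blow up, but it only enters in
    qualitative statements.  Functions with equal coefficients are equal almost
    everywhere ([fourier_inj]), so that the chosen derivatives in space and in
    time are determined by their coefficients, and the equation becomes
      a' = Gam a a,   (Gam a b)_k = sum_j kern(j, k - j) a_j b_(k - j)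
    ([rep_equation]).

    The operator d/dx B^-1 gains three derivatives, and each factor of the
    nonlinear terms carries at most three of them; both are absorbed by the
    weight (1 + |k|)^3, which is submultiplicative ([kern_bnd]).  Only u u_x
    costs a derivative, and only on one factor; that derivative is paid by a
    factor 1 / (rho' - rho) when the radius rho' shrinks to rho ([weight_gap]).

    Existence.  The Taylor coefficients at t = 0 satisfy
      (n + 1) a_(n+1) = sum_(i <= n) Gam a_i a_(n-i).
    If [nrm 1 a_0] <= M, an induction gives, for all rho in [0, 1[,
      nrm rho a_n <= M Q^n / ((n + 1)^2 (1 - rho)^n),   Q = 16 e K0 M
    ([tcoef_bnd]).  The power series thus converges in [nrm rho] for
    Q |t| < 1 - rho, and solves the equation ([dUsolE], [Usol_deriv]).  A radius
    rho > delta is available whenever Q |t| < 1 - delta, so T = 1 / Q works.  As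
    M = K times the norm of the initial value can be taken, T is a constant
    divided by that norm.

    Uniqueness.  Along a segment r |-> r t, the difference z of two families of
    coefficients satisfies a linear equation that loses one derivative.  It is
    estimated with the weight [om], which decreases in time like
    e^(- m (1 + |k|) (r - s0)): the integration in time gains
    1 / (m (1 + |k|)), which repays the derivative, and for large m the
    difference is bounded by half of its own bound ([local_unique]).  A
    connectedness argument extends the equality to the whole segment
    ([global_unique]). *)

Set Implicit Arguments.
Unset Strict Implicit.
Unset Printing Implicit Defensive.

Local Open Scope classical_set_scope.
Local Open Scope ring_scope.
Local Open Scope complex_scope.

(** * Sums of nonnegative families *)

Notation nc := ComplexField.Normc.normc.

Section NonnegSums.
Variable R : realType.
Implicit Types (T U : choiceType) (c : R).
Local Open Scope ereal_scope.

(** Summation over all of T, with values in the extended reals: for nonnegative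
    terms it needs no convergence hypothesis, so estimates can precede
    summability. *)
Definition es T (f : T -> \bar R) : \bar R := \esum_(k in [set: T]) f k.

Lemma es_ge0 T (f : T -> \bar R) : (forall k, 0 <= f k) -> 0 <= es f.
Proof. by move=> f0; apply: esum_ge0. Qed.

Lemma le_es T (f g : T -> \bar R) : (forall k, f k <= g k) -> es f <= es g.
Proof. by move=> fg; apply: le_esum. Qed.

Lemma eq_es T (f g : T -> \bar R) : (forall k, f k = g k) -> es f = es g.
Proof. by move=> fg; apply: eq_esum. Qed.

Lemma es0 T : es (fun _ : T => 0) = 0.
Proof. by apply: esum1. Qed.

Lemma esD T (f g : T -> \bar R) : (forall k, 0 <= f k) -> (forall k, 0 <= g k) ->
  es (fun k => f k + g k) = es f + es g.
Proof. by move=> f0 g0; apply: esumD. Qed.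

Lemma term_le_es T (f : T -> \bar R) k : (forall k, 0 <= f k) -> f k <= es f.
Proof.
move=> f0; apply: esum_ge; exists [set k]; last by rewrite fsbig_set1.
by split => //; apply: finite_set1.
Qed.

Lemma es_fubini T U (F : T -> U -> \bar R) : (forall i j, 0 <= F i j) ->
  es (fun i => es (F i)) = es (fun j => es (fun i => F i j)).
Proof.
move=> F0; rewrite /es !esum_esum//.
rewrite (_ : [set: T] `*`` (fun=> [set: U]) = [set: T * U]); last first.
  by apply/seteqP; split => // -[].
rewrite (_ : [set: U] `*`` (fun=> [set: T]) = [set: U * T]); last first.
  by apply/seteqP; split => // -[].
rewrite (reindex_esum [set: U * T] [set: T * U] (fun p => (p.2, p.1)))//.
split => //; first by move=> [a b] [c d] _ _ [-> ->].
by move=> [a b] _; exists (b, a).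
Qed.

Lemma es_bij T U (e : T -> U) (f : U -> \bar R) : bijective e -> es (f \o e) = es f.
Proof.
move=> be; apply/esym; rewrite /es.
apply: reindex_esum; split => //; first by move=> x y _ _; apply: bij_inj.
by case: be => e' K1 K2 x _; exists (e' x).
Qed.

Lemma esZ T c (f : T -> \bar R) : (0 <= c)%R -> (forall k, 0 <= f k) ->
  es (fun k => c%:E * f k) = c%:E * es f.
Proof.
have key d (g : T -> \bar R) : (0 <= d)%R -> (forall k, 0 <= g k) ->
    es (fun k => d%:E * g k) <= d%:E * es g.
  move=> d0 g0; apply: ub_ereal_sup => _ [A [finA _] <-].
  rewrite -ge0_mule_fsumr//.
  by apply: lee_wpmul2l => //; apply: esum_ge; exists A.
move=> c0 f0; apply/eqP; rewrite eq_le key//=.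
have [->|cn0] := eqVneq c 0%R.
  by rewrite mul0e; apply: es_ge0 => k; rewrite mul0e.
have cp : (0 < c)%R by rewrite lt_neqAle eq_sym cn0.
have := key c^-1%R (fun k => c%:E * f k).
rewrite invr_ge0 => /(_ c0 (fun k => mule_ge0 (x := c%:E) c0 (f0 k))).
rewrite (eq_es (g := f)); last first.
  by move=> k; rewrite muleA -EFinM mulVf// mul1e.
move=> h; apply: le_trans (_ : c%:E * (c^-1%:E * es (fun k => c%:E * f k)) <= _).
  by rewrite lee_pmul2l.
by rewrite muleA -EFinM mulfV// mul1e.
Qed.

Lemma es_set1 T k0 (x : \bar R) : 0 <= x ->
  es (fun k : T => if k == k0 then x else 0) = x.
Proof.
move=> x0; rewrite /es (eq_esum (b := fun k => if k \in [set k0] then x else 0)).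
  by rewrite -esum_mkcond esum_set1.
move=> k _; case: ifP => [/eqP ->|/eqP kk]; first by rewrite mem_set.
by rewrite memNset//.
Qed.

Lemma es_fin_term T (f : T -> \bar R) k : (forall k, 0 <= f k) -> es f < +oo ->
  f k = (fine (f k))%:E.
Proof.
move=> f0 fo; rewrite fineK// ge0_fin_numE//.
exact: le_lt_trans (term_le_es k f0) fo.
Qed.

Lemma es_fineK T (f : T -> \bar R) : (forall k, 0 <= f k) -> es f < +oo ->
  es f = (fine (es f))%:E.
Proof.
by move=> f0 fo; rewrite fineK// ge0_fin_numE//; exact: es_ge0.
Qed.

(** Each row of the double sum is shifted, so that the antidiagonals m + p = n
    become columns. *)
Lemma es_diag (F : nat -> nat -> \bar R) : (forall i j, 0 <= F i j) ->
  es (fun m => es (F m)) = es (fun n => \sum_(m < n.+1) F m (n - m)%N).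
Proof.
move=> F0.
pose G m n := if (m <= n)%N then F m (n - m)%N else 0.
have G0 m n : 0 <= G m n by rewrite /G; case: ifP.
transitivity (es (fun m => es (G m))).
  apply: eq_es => m; rewrite /es.
  rewrite (reindex_esum [set n | (m <= n)%N] [set: nat] (fun n => (n - m)%N)).
    rewrite esum_mkcond; apply: eq_esum => n _; rewrite /G.
    by rewrite (_ : (n \in [set n0 | (m <= n0)%N]) = (m <= n)%N)//; apply/idP/idP; rewrite inE.
  split => //.
    move=> x y; rewrite !inE/= => mx my h.
    by rewrite -(subnK mx) -(subnK my) h.
  by move=> p _; exists (p + m)%N => /=; rewrite ?leq_addl// addnK.
rewrite es_fubini//; apply: eq_es => n.
rewrite /es -(nneseries_esumT)// (nneseries_split 0 n.+1)//.
rewrite add0n -[X in _ + X]/(_) eseries0 ?adde0.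
  rewrite big_mkord; apply: eq_bigr => i _; rewrite /G.
  by have := ltn_ord i; rewrite ltnS => ->.
by move=> i ni _; rewrite /G leqNgt ni.
Qed.

End NonnegSums.

(** * Absolutely summable complex families *)

Section Csum.
Variable R : realType.
Implicit Types (T U : choiceType) (c : R[i]).
Local Notation C := R[i].

Lemma nc_ge0 (z : C) : 0 <= nc z.
Proof. by case: z => a b; apply: sqrtr_ge0. Qed.

Lemma ncJ (z : C) : nc (conjc z) = nc z.
Proof. by case: z => a b /=; rewrite sqrrN. Qed.

Lemma normr_nc (z : C) : `|z| = (nc z)%:C.
Proof. by case: z. Qed.

Lemma nc_real (x : R) : nc (x%:C) = `|x|.
Proof. by rewrite /= expr0n/= addr0 sqrtr_sqr. Qed.

Lemma Re_le_nc (z : C) : `|complex.Re z| <= nc z.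
Proof. by rewrite -lecR -normr_nc; exact: normc_ge_Re. Qed.

Lemma Im_le_nc (z : C) : `|complex.Im z| <= nc z.
Proof.
case: z => a b /=; rewrite -sqrtr_sqr ler_wsqrtr// lerDr sqr_ge0//.
Qed.

Lemma nc_le (z : C) : nc z <= `|complex.Re z| + `|complex.Im z|.
Proof.
rewrite [z in nc z]complexE; apply: le_trans (le_normcD _ _) _.
rewrite Normc.normcM !nc_real.
by rewrite [nc 'i]/= expr0n expr1n add0r sqrtr1 mul1r.
Qed.

Lemma ncX (z : C) n : nc (z ^+ n) = nc z ^+ n.
Proof.
elim: n => [|n IH]; first by rewrite !expr0 Normc.normc1.
by rewrite !exprS Normc.normcM IH.
Qed.

Lemma nc_nat n : nc (n%:R : C) = n%:R.
Proof.
rewrite -[n%:R : C](rmorph_nat (@real_complex_def R (Phant R))).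
by rewrite nc_real normr_nat.
Qed.

Lemma nc_eq0 (z : C) : nc z = 0 -> z = 0.
Proof. exact: Normc.eq0_normc. Qed.

(** Reduces bounds on moduli of complex numbers to bounds on real parts, by
    multiplying with a number of modulus 1. *)
Lemma nc_rotate (z : C) : exists2 c, nc c = 1 & c * z = (nc z)%:C.
Proof.
have [->|z0] := eqVneq z 0.
  by exists 1; rewrite ?Normc.normc1// mulr0 Normc.normc0.
have nz : nc z != 0 by apply: contra_neq z0; exact: nc_eq0.
exists (conjc z / (nc z)%:C).
  rewrite Normc.normcM Normc.normcV nc_real ncJ.
  by rewrite ger0_norm ?nc_ge0// divff.
rewrite mulrAC mulrC [conjc z * z]mulrC -sqr_normc normr_nc expr2 mulrA mulVf ?mul1r//.
by rewrite (inj_eq (@complexI _)).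
Qed.

Lemma cReD (z w : C) : complex.Re (z + w) = complex.Re z + complex.Re w.
Proof. by case: z => a b; case: w. Qed.
Lemma cImD (z w : C) : complex.Im (z + w) = complex.Im z + complex.Im w.
Proof. by case: z => a b; case: w. Qed.
Lemma cReM (z w : C) : complex.Re (z * w) =
  complex.Re z * complex.Re w - complex.Im z * complex.Im w.
Proof. by case: z => a b; case: w. Qed.
Lemma cImM (z w : C) : complex.Im (z * w) =
  complex.Re z * complex.Im w + complex.Im z * complex.Re w.
Proof. by case: z => a b; case: w. Qed.
Lemma cReN (z : C) : complex.Re (- z) = - complex.Re z.
Proof. by case: z => a b. Qed.
Lemma cImN (z : C) : complex.Im (- z) = - complex.Im z.
Proof. by case: z => a b. Qed.
Lemma complex_eq (z w : C) : complex.Re z = complex.Re w ->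
  complex.Im z = complex.Im w -> z = w.
Proof. by case: z => a b; case: w => c d /= -> ->. Qed.

Definition pos (f : R) : R := Num.max f 0.
Definition neg (f : R) : R := Num.max (- f) 0.

Lemma pos_ge0 f : 0 <= pos f. Proof. by rewrite /pos le_max lexx orbT. Qed.
Lemma neg_ge0 f : 0 <= neg f. Proof. by rewrite /neg le_max lexx orbT. Qed.
Lemma posBneg f : pos f - neg f = f.
Proof. by rewrite /pos /neg; case: (leP f 0); case: (leP (-f) 0) => ? ?; lra. Qed.
Lemma posDneg f : pos f + neg f = `|f|.
Proof.
rewrite /pos /neg; case: (leP 0 f) => f0; rewrite ?(ger0_norm f0) ?(ltr0_norm f0)//;
by case: (leP f 0) => ?; case: (leP (-f) 0) => ?; lra.
Qed.
Lemma pos_le f : pos f <= `|f|.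
Proof. by rewrite -posDneg lerDl neg_ge0. Qed.
Lemma neg_le f : neg f <= `|f|.
Proof. by rewrite -posDneg lerDr pos_ge0. Qed.

Definition rsummable T (f : T -> R) := (es (fun k => `|f k|%:E) < +oo)%E.

(** Defined for every family; it is the sum when the family is absolutely
    summable. *)
Definition rsum T (f : T -> R) : R :=
  fine (es (fun k => (pos (f k))%:E)) - fine (es (fun k => (neg (f k))%:E)).

Lemma rsummable_le T (f g : T -> R) : (forall k, `|f k| <= g k) ->
  rsummable g -> rsummable f.
Proof.
move=> fg; apply: le_lt_trans; apply: le_es => k; rewrite lee_fin.
by apply: le_trans (fg k) _; exact: ler_norm.
Qed.

Lemma rsummable_ge0 T (f : T -> R) : (forall k, 0 <= f k) ->
  rsummable f -> es (fun k => (f k)%:E) = (fine (es (fun k => (f k)%:E)))%:E.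
Proof.
move=> f0 sf; apply: es_fineK => [k|]; first by rewrite lee_fin.
by move: sf; rewrite /rsummable (eq_es (g := fun k => (f k)%:E)) // => i; rewrite ger0_norm.
Qed.

Lemma eq_rsum T (f g : T -> R) : (forall k, f k = g k) -> rsum f = rsum g.
Proof. by move=> /funext ->. Qed.

(** The value does not depend on the decomposition into nonnegative parts, which
    makes [rsum] additive. *)
Lemma rsumB T (f g h : T -> R) : (forall k, f k = g k - h k) ->
  (forall k, 0 <= g k) -> (forall k, 0 <= h k) -> rsummable g -> rsummable h ->
  rsum f = fine (es (fun k => (g k)%:E)) - fine (es (fun k => (h k)%:E)).
Proof.
move=> fE g0 h0 sg sh.
have sp : rsummable (fun k => pos (f k)).
  apply: rsummable_le sg => k; rewrite ger0_norm ?pos_ge0// /pos ge_max g0 andbT.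
  by rewrite fE lerBlDr lerDl h0.
have sn : rsummable (fun k => neg (f k)).
  apply: rsummable_le sh => k; rewrite ger0_norm ?neg_ge0// /neg ge_max h0 andbT.
  by rewrite fE opprB lerBlDr lerDl g0.
have e : (es (fun k => (pos (f k))%:E) + es (fun k => (h k)%:E) =
          es (fun k => (g k)%:E) + es (fun k => (neg (f k))%:E))%E.
  rewrite -!esD//; try by move=> k; rewrite lee_fin ?pos_ge0 ?neg_ge0.
  apply: eq_es => k; rewrite -!EFinD; congr EFin.
  by have := posBneg (f k); rewrite {3}fE; lra.
move: e; rewrite (rsummable_ge0 g0 sg) (rsummable_ge0 h0 sh).
rewrite (rsummable_ge0 (fun k => pos_ge0 _) sp) (rsummable_ge0 (fun k => neg_ge0 _) sn).
rewrite -!EFinD => -[e]; rewrite /rsum/=; lra.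
Qed.

Lemma rsummableD T (f g : T -> R) : rsummable f -> rsummable g ->
  rsummable (fun k => f k + g k).
Proof.
move=> sf sg; apply: le_lt_trans (lte_add_pinfty sf sg).
rewrite -esD => [|k|k]; rewrite ?lee_fin//; apply: le_es => k.
by rewrite -EFinD lee_fin ler_normD.
Qed.

Lemma rsummable_pos T (f : T -> R) : rsummable f -> rsummable (fun k => pos (f k)).
Proof.
apply: le_lt_trans; apply: le_es => k; rewrite lee_fin ger0_norm ?pos_ge0//.
exact: pos_le.
Qed.

Lemma rsummable_neg T (f : T -> R) : rsummable f -> rsummable (fun k => neg (f k)).
Proof.
apply: le_lt_trans; apply: le_es => k; rewrite lee_fin ger0_norm ?neg_ge0//.
exact: neg_le.
Qed.

Lemma fine_esD T (f g : T -> R) : (forall k, 0 <= f k) -> (forall k, 0 <= g k) ->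
  rsummable f -> rsummable g ->
  fine (es (fun k => (f k + g k)%:E)) =
  fine (es (fun k => (f k)%:E)) + fine (es (fun k => (g k)%:E)).
Proof.
move=> f0 g0 sf sg; rewrite (eq_es (g := fun k => (f k)%:E + (g k)%:E)%E)//.
rewrite esD; [|by move=> k; rewrite lee_fin..].
by rewrite (rsummable_ge0 f0 sf) (rsummable_ge0 g0 sg).
Qed.

Lemma rsumD T (f g : T -> R) : rsummable f -> rsummable g ->
  rsum (fun k => f k + g k) = rsum f + rsum g.
Proof.
move=> sf sg.
rewrite (rsumB (g := fun k => pos (f k) + pos (g k)) (h := fun k => neg (f k) + neg (g k))).
- rewrite (fine_esD (fun k => pos_ge0 _) (fun k => pos_ge0 _) (rsummable_pos sf) (rsummable_pos sg)).
  rewrite (fine_esD (fun k => neg_ge0 _) (fun k => neg_ge0 _) (rsummable_neg sf) (rsummable_neg sg)).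
  by rewrite /rsum opprD addrACA.
- by move=> k; have := posBneg (f k); have := posBneg (g k); lra.
- by move=> k; rewrite addr_ge0 ?pos_ge0.
- by move=> k; rewrite addr_ge0 ?neg_ge0.
- by apply: rsummableD; exact: rsummable_pos.
- by apply: rsummableD; exact: rsummable_neg.
Qed.

Lemma rsumN T (f : T -> R) : rsum (fun k => - f k) = - rsum f.
Proof.
rewrite /rsum opprB; congr (fine _ - fine _); apply: eq_es => k.
by rewrite /pos /neg opprK.
Qed.

Lemma rsumZ T (c : R) (f : T -> R) : rsummable f ->
  rsum (fun k => c * f k) = c * rsum f.
Proof.
have key d : 0 <= d -> rsummable f -> rsum (fun k => d * f k) = d * rsum f.
  move=> d0 sf; rewrite /rsum.
  have posE k : pos (d * f k) = d * pos (f k).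
    by rewrite /pos maxr_pMr// mulr0.
  have negE k : neg (d * f k) = d * neg (f k).
    by rewrite /neg maxr_pMr// mulr0 mulrN.
  rewrite (eq_es (g := fun k => d%:E * (pos (f k))%:E)%E); last by move=> k; rewrite posE.
  rewrite (eq_es (f := fun k => (neg _)%:E) (g := fun k => d%:E * (neg (f k))%:E)%E); last by move=> k; rewrite negE.
  rewrite !esZ//; try by move=> k; rewrite lee_fin ?pos_ge0 ?neg_ge0.
  rewrite (rsummable_ge0 (fun k => pos_ge0 _) (rsummable_pos sf)).
  rewrite (rsummable_ge0 (fun k => neg_ge0 _) (rsummable_neg sf)) /=.
  by rewrite mulrBr.
move=> sf; have [c0|c0] := leP 0 c; first exact: key.
rewrite -[c]opprK -[LHS]opprK -rsumN.
rewrite (eq_rsum (g := fun k => - c * f k)); last by move=> k; rewrite mulNr opprK mulNr.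
by rewrite key ?mulNr// oppr_ge0 ltW.
Qed.

Lemma rsummable_fin T (f : T -> R) : rsummable f ->
  es (fun k => `|f k|%:E) = (fine (es (fun k => `|f k|%:E)))%:E.
Proof. by move=> sf; apply: es_fineK => // k; rewrite lee_fin. Qed.

Lemma rsum_le T (f : T -> R) : rsummable f -> rsum f <= fine (es (fun k => `|f k|%:E)).
Proof.
move=> sf; apply: (@le_trans _ _ (fine (es (fun k => (pos (f k))%:E)))).
  by rewrite /rsum gerBl// fine_ge0// es_ge0// => k; rewrite lee_fin neg_ge0.
rewrite -lee_fin -(rsummable_fin sf).
rewrite -(rsummable_ge0 (fun k => pos_ge0 _) (rsummable_pos sf)).
by apply: le_es => k; rewrite lee_fin pos_le.
Qed.

Lemma rsum_bij T U (e : T -> U) (f : U -> R) : bijective e ->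
  rsum (fun k => f (e k)) = rsum f.
Proof.
move=> be; rewrite /rsum; congr (fine _ - fine _).
  by rewrite -(es_bij _ be).
by rewrite -(es_bij (fun k => (neg (f k))%:E) be).
Qed.

Lemma rsum_set1 T k0 (x : R) : rsum (fun k : T => if k == k0 then x else 0) = x.
Proof.
rewrite /rsum (eq_es (g := fun k => if k == k0 then (pos x)%:E else 0%E)); last first.
  by move=> k; case: ifP => //; rewrite /pos maxxx.
rewrite (eq_es (f := fun k => (neg _)%:E) (g := fun k => if k == k0 then (neg x)%:E else 0%E)); last first.
  by move=> k; case: ifP => //; rewrite /neg oppr0 maxxx.
by rewrite !es_set1 ?lee_fin ?pos_ge0 ?neg_ge0//= posBneg.
Qed.

Lemma rsum2E T U (F : T -> U -> R) :
  (es (fun i => es (fun j => `|F i j|%:E)) < +oo)%E ->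
  rsum (fun i => rsum (F i)) =
  fine (es (fun i => es (fun j => (pos (F i j))%:E))) -
  fine (es (fun i => es (fun j => (neg (F i j))%:E))).
Proof.
move=> sF.
have e0 (f : U -> R) : (forall j, 0 <= f j) -> (0 <= es (fun j => (f j)%:E))%E.
  by move=> f0; apply: es_ge0 => j; rewrite lee_fin.
have key (g : R -> R) : (forall x, 0 <= g x) -> (forall x, g x <= `|x|) ->
    (es (fun i => es (fun j => (g (F i j))%:E)) =
     es (fun i => (fine (es (fun j => (g (F i j))%:E)))%:E))%E /\
    rsummable (fun i => fine (es (fun j => (g (F i j))%:E))).
  move=> g0 gle.
  have lt : (es (fun i => es (fun j => (g (F i j))%:E)) < +oo)%E.
    by apply: le_lt_trans sF; apply: le_es => i; apply: le_es => j; rewrite lee_fin.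
  have e : (es (fun i => es (fun j => (g (F i j))%:E)) =
     es (fun i => (fine (es (fun j => (g (F i j))%:E)))%:E))%E.
    by apply: eq_es => i; apply: (es_fin_term (f := fun i => es (fun j => (g (F i j))%:E))) => // i'; apply: e0 => j.
  split => //; rewrite /rsummable; move: lt; rewrite e; apply: le_lt_trans; apply: le_es => i.
  by rewrite lee_fin ger0_norm// fine_ge0// e0.
have [e1 s1] := key pos pos_ge0 pos_le.
have [e2 s2] := key neg neg_ge0 neg_le.
rewrite e1 e2; apply: rsumB => // i; last 2 first.
- by rewrite fine_ge0// e0// => j; rewrite pos_ge0.
- by rewrite fine_ge0// e0// => j; rewrite neg_ge0.
Qed.

Lemma rsum_fubini T U (F : T -> U -> R) :
  (es (fun i => es (fun j => `|F i j|%:E)) < +oo)%E ->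
  rsum (fun i => rsum (F i)) = rsum (fun j => rsum (fun i => F i j)).
Proof.
move=> sF; rewrite rsum2E// rsum2E; last by rewrite es_fubini// => i j; rewrite lee_fin.
by congr (fine _ - fine _); rewrite es_fubini// => i j; rewrite lee_fin ?pos_ge0 ?neg_ge0.
Qed.

Lemma rsum_diag (F : nat -> nat -> R) :
  (es (fun i => es (fun j => `|F i j|%:E)) < +oo)%E ->
  rsum (fun i => rsum (F i)) = rsum (fun n => \sum_(m < n.+1) F m (n - m)%N).
Proof.
move=> sF; rewrite rsum2E//.
have key (g : R -> R) : (forall x, 0 <= g x) -> (forall x, g x <= `|x|) ->
    (es (fun i => es (fun j => (g (F i j))%:E)) =
     es (fun n => (\sum_(m < n.+1) g (F m (n - m)%N))%:E))%E /\
    rsummable (fun n => \sum_(m < n.+1) g (F m (n - m)%N)).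
  move=> g0 gle.
  have e : (es (fun i => es (fun j => (g (F i j))%:E)) =
     es (fun n => (\sum_(m < n.+1) g (F m (n - m)%N))%:E))%E.
    rewrite es_diag; last by move=> i j; rewrite lee_fin.
    by apply: eq_es => n; rewrite sumEFin.
  split => //; rewrite /rsummable.
  rewrite (eq_es (g := fun n => (\sum_(m < n.+1) g (F m (n - m)%N))%:E)); last first.
    by move=> n; rewrite ger0_norm// sumr_ge0.
  rewrite -e; apply: le_lt_trans sF; apply: le_es => i; apply: le_es => j.
  by rewrite lee_fin.
have [e1 s1] := key pos pos_ge0 pos_le.
have [e2 s2] := key neg neg_ge0 neg_le.
rewrite e1 e2; apply/esym/rsumB => // n; try by rewrite sumr_ge0// => i _; rewrite ?pos_ge0 ?neg_ge0.
by rewrite -sumrB; apply: eq_bigr => i _; rewrite posBneg.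
Qed.

Definition csummable T (f : T -> C) := (es (fun k => (nc (f k))%:E) < +oo)%E.

Definition csum T (f : T -> C) : C :=
  rsum (fun k => complex.Re (f k)) +i* rsum (fun k => complex.Im (f k)).

Lemma eq_csum T (f g : T -> C) : (forall k, f k = g k) -> csum f = csum g.
Proof. by move=> /funext ->. Qed.

Lemma csummable_le T (f : T -> C) (g : T -> R) :
  (forall k, nc (f k) <= g k) -> (es (fun k => (g k)%:E) < +oo)%E -> csummable f.
Proof. by move=> fg; apply: le_lt_trans; apply: le_es => k; rewrite lee_fin. Qed.

Lemma csummable_Re T (f : T -> C) : csummable f -> rsummable (fun k => complex.Re (f k)).
Proof. by apply: le_lt_trans; apply: le_es => k; rewrite lee_fin Re_le_nc. Qed.

Lemma csummable_Im T (f : T -> C) : csummable f -> rsummable (fun k => complex.Im (f k)).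
Proof. by apply: le_lt_trans; apply: le_es => k; rewrite lee_fin Im_le_nc. Qed.

Lemma csummableD T (f g : T -> C) : csummable f -> csummable g ->
  csummable (fun k => f k + g k).
Proof.
move=> sf sg; apply: le_lt_trans (lte_add_pinfty sf sg).
rewrite -esD => [|k|k]; rewrite ?lee_fin ?nc_ge0//; apply: le_es => k.
by rewrite -EFinD lee_fin le_normcD.
Qed.

Lemma es_ncZ T c (f : T -> C) :
  (es (fun k => (nc (c * f k))%:E) = (nc c)%:E * es (fun k => (nc (f k))%:E))%E.
Proof.
rewrite -esZ ?nc_ge0// => [|k]; last by rewrite lee_fin nc_ge0.
by apply: eq_es => k; rewrite -EFinM Normc.normcM.
Qed.

Lemma csummableZ T c (f : T -> C) : csummable f -> csummable (fun k => c * f k).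
Proof.
move=> sf; rewrite /csummable es_ncZ.
rewrite (es_fineK _ sf); last by move=> k; rewrite lee_fin nc_ge0.
by rewrite -EFinM ltry.
Qed.

Lemma csummableN T (f : T -> C) : csummable f -> csummable (fun k => - f k).
Proof. by apply: le_lt_trans; apply: le_es => k; rewrite normcN. Qed.

Lemma csumD T (f g : T -> C) : csummable f -> csummable g ->
  csum (fun k => f k + g k) = csum f + csum g.
Proof.
move=> sf sg; apply: complex_eq; rewrite ?cReD ?cImD /=.
  by rewrite -rsumD; [apply: eq_rsum => k; rewrite cReD|exact: csummable_Re..].
by rewrite -rsumD; [apply: eq_rsum => k; rewrite cImD|exact: csummable_Im..].
Qed.

Lemma csumN T (f : T -> C) : csum (fun k => - f k) = - csum f.
Proof.
apply: complex_eq; rewrite ?cReN ?cImN /= -rsumN; apply: eq_rsum => k.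
  by rewrite cReN.
by rewrite cImN.
Qed.

Lemma csumB T (f g : T -> C) : csummable f -> csummable g ->
  csum (fun k => f k - g k) = csum f - csum g.
Proof. by move=> sf sg; rewrite csumD ?csumN//; exact: csummableN. Qed.

Lemma rsummableZ T (c : R) (f : T -> R) : rsummable f -> rsummable (fun k => c * f k).
Proof.
move=> sf; rewrite /rsummable (eq_es (g := fun k => `|c|%:E * `|f k|%:E)%E).
  by rewrite esZ// (rsummable_fin sf) -EFinM ltry.
by move=> k; rewrite normrM EFinM.
Qed.

Lemma csumZ T c (f : T -> C) : csummable f -> csum (fun k => c * f k) = c * csum f.
Proof.
move=> sf; have sr := csummable_Re sf; have si := csummable_Im sf.
apply: complex_eq; rewrite ?cReM ?cImM /=.
  rewrite -!rsumZ// -rsumN -rsumD; [|exact: rsummableZ|]; last first.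
    have := rsummableZ (- complex.Im c) si; congr rsummable.
    by apply/funext => k; rewrite mulNr.
  by apply: eq_rsum => k; rewrite cReM.
rewrite -!rsumZ// -rsumD; [|exact: rsummableZ..].
by apply: eq_rsum => k; rewrite cImM.
Qed.

Lemma csumZr T c (f : T -> C) : csummable f -> csum (fun k => f k * c) = csum f * c.
Proof.
by move=> sf; rewrite mulrC -csumZ//; apply: eq_csum => k; rewrite mulrC.
Qed.

Lemma nc_csum T (f : T -> C) : ((nc (csum f))%:E <= es (fun k => (nc (f k))%:E))%E.
Proof.
have [sf|] := boolP (es (fun k => (nc (f k))%:E) < +oo)%E; last first.
  by rewrite -leNgt leye_eq => /eqP ->; rewrite leey.
have [c nc1 cz] := nc_rotate (csum f).
have -> : nc (csum f) = complex.Re (csum (fun k => c * f k)).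
  by rewrite csumZ// cz.
have sc : csummable (fun k => c * f k) by exact: csummableZ.
rewrite [complex.Re _]/=.
have h := rsum_le (csummable_Re sc).
rewrite -lee_fin -(rsummable_fin (csummable_Re sc)) in h.
apply: le_trans h _; apply: le_es => k; rewrite lee_fin.
by apply: le_trans (Re_le_nc _) _; rewrite Normc.normcM nc1 mul1r.
Qed.

Lemma csum0 T : csum (fun _ : T => 0 : C) = 0.
Proof.
apply: nc_eq0; apply/eqP; rewrite eq_le nc_ge0 andbT -lee_fin.
by apply: le_trans (nc_csum _) _; rewrite Normc.normc0 es0.
Qed.

Lemma csum_fubini T U (F : T -> U -> C) :
  (es (fun i => es (fun j => (nc (F i j))%:E)) < +oo)%E ->
  csum (fun i => csum (F i)) = csum (fun j => csum (fun i => F i j)).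
Proof.
move=> sF; apply: complex_eq => /=; apply: rsum_fubini; apply: le_lt_trans sF;
apply: le_es => i; apply: le_es => j; rewrite lee_fin.
  exact: Re_le_nc.
exact: Im_le_nc.
Qed.

Lemma Re_sum I (r : seq I) (P : pred I) (F : I -> C) :
  complex.Re (\sum_(i <- r | P i) F i) = \sum_(i <- r | P i) complex.Re (F i).
Proof. by apply: (big_morph (@complex.Re R)) => // x y; rewrite cReD. Qed.

Lemma Im_sum I (r : seq I) (P : pred I) (F : I -> C) :
  complex.Im (\sum_(i <- r | P i) F i) = \sum_(i <- r | P i) complex.Im (F i).
Proof. by apply: (big_morph (@complex.Im R)) => // x y; rewrite cImD. Qed.

Lemma csum_diag (F : nat -> nat -> C) :
  (es (fun i => es (fun j => (nc (F i j))%:E)) < +oo)%E ->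
  csum (fun i => csum (F i)) = csum (fun n => \sum_(m < n.+1) F m (n - m)%N).
Proof.
move=> sF; apply: complex_eq => /=.
  rewrite rsum_diag; last first.
    apply: le_lt_trans sF; apply: le_es => i; apply: le_es => j; rewrite lee_fin.
    exact: Re_le_nc.
  by apply: eq_rsum => k; rewrite Re_sum.
rewrite rsum_diag; last first.
  apply: le_lt_trans sF; apply: le_es => i; apply: le_es => j; rewrite lee_fin.
  exact: Im_le_nc.
by apply: eq_rsum => k; rewrite Im_sum.
Qed.

Lemma csum_bij T U (e : T -> U) (f : U -> C) : bijective e ->
  csum (fun k => f (e k)) = csum f.
Proof.
move=> be; rewrite /csum; congr (_ +i* _).
  exact: (rsum_bij (fun k => complex.Re (f k)) be).
exact: (rsum_bij (fun k => complex.Im (f k)) be).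
Qed.

Lemma csum_set1 T k0 c : csum (fun k : T => if k == k0 then c else 0) = c.
Proof.
rewrite /csum (eq_rsum (g := fun k => if k == k0 then complex.Re c else 0)); last first.
  by move=> k; case: ifP.
rewrite (eq_rsum (f := fun k => complex.Im _) (g := fun k => if k == k0 then complex.Im c else 0)); last first.
  by move=> k; case: ifP.
by rewrite !rsum_set1; case: c.
Qed.

Lemma csummable_set1 T (k0 : T) c : csummable (fun k : T => if k == k0 then c else 0).
Proof.
rewrite /csummable (eq_es (g := fun k => if k == k0 then (nc c)%:E else 0%E)).
  by rewrite es_set1 ?ltry// lee_fin nc_ge0.
by move=> k; case: ifP => // _; rewrite Normc.normc0.
Qed.

(** Symmetric partial sums over the integers link [csum] with the limit that
    defines [Binv]. *)
Definition box (N : nat) (k : int) := (`|k| <= N)%N.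

Definition sym_sum (f : int -> C) N :=
  f 0 + \sum_(1 <= k < N.+1) (f k%:Z + f (- k%:Z)).

Lemma csum_box (f : int -> C) N :
  csum (fun k => if box N k then f k else 0) = sym_sum f N /\
  csummable (fun k => if box N k then f k else 0).
Proof.
elim: N => [|N [IH1 IH2]].
  have E k : (if box 0 k then f k else 0) = (if k == 0 then f 0 else 0).
    by rewrite /box leqn0 absz_eq0; case: eqP => [->|].
  split; first by rewrite (eq_csum E) csum_set1 /sym_sum big_geq ?addr0.
  by rewrite (funext E); exact: csummable_set1.
pose g k := if k == N.+1%:Z then f N.+1%:Z else 0.
pose h k := if k == - N.+1%:Z then f (- N.+1%:Z) else 0.
have E k : (if box N.+1 k then f k else 0) =
    (if box N k then f k else 0) + (g k + h k).
  rewrite /box /g /h leq_eqVlt ltnS; have [kN|kN] := leqP `|k|%N N.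
    rewrite orbT; case: eqP => [kE|_]; first by rewrite kE absz_nat ltnn in kN.
    case: eqP => [kE|_]; first by rewrite kE abszN absz_nat ltnn in kN.
    by rewrite !addr0.
  rewrite orbF add0r.
  have -> : (`|k|%N == N.+1) = (k == N.+1%:Z) || (k == - N.+1%:Z) by lia.
  case: (k =P N.+1%:Z) => [->|_] /=; last first.
    by case: (k =P - N.+1%:Z) => [->|]; rewrite ?add0r.
  by rewrite addr0.
have sg : csummable g by exact: csummable_set1.
have sh : csummable h by exact: csummable_set1.
split; last by rewrite (funext E); exact: csummableD IH2 (csummableD sg sh).
rewrite (eq_csum E) csumD//; last exact: csummableD.
rewrite csumD// IH1 !csum_set1 /sym_sum [in RHS]big_nat_recr//=.
by rewrite !addrA.
Qed.

(** The supremum that defines the sum is almost attained on a finite set of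
    indices, hence on a symmetric interval. *)
Lemma es_tail (a : int -> \bar R) (e : R) : (forall k, 0 <= a k)%E ->
  (es a < +oo)%E -> 0 < e ->
  exists N0, forall N, (N0 <= N)%N ->
    (es (fun k => if box N k then 0 else a k) <= e%:E)%E.
Proof.
move=> a0 sa e0.
have efin : (es a \is a fin_num)%E by rewrite ge0_fin_numE// es_ge0.
have [_ [A [finA _] <-] hA] := ub_ereal_sup_adherent e0 efin.
have [N0 AN0] : exists N0, forall k, A k -> box N0 k.
  move/finite_seqP : finA => [X ->].
  exists (\max_(k <- X) `|k|)%N => k kX; rewrite /box.
  exact: (@leq_bigmax_seq _ X xpredT (fun k : int => `|k|%N)).
exists N0 => N N0N.
have : (es a = es (fun k => if box N k then a k else 0) + es (fun k => if box N k then 0 else a k))%E.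
  rewrite -esD => [|k|k]; try by case: ifP.
  by apply: eq_es => k; case: ifP; rewrite ?adde0 ?add0e.
rewrite -/(es a) in hA; set x := es a in hA efin *; set y := es _; set z := es _ => xyz.
have Ay : (\sum_(k \in A) a k <= y)%E.
  rewrite (eq_fsbigr (fun k => if box N k then a k else 0%E)).
    by apply: esum_ge; exists A.
  by move=> k; rewrite inE => Ak; rewrite /box (leq_trans (AN0 _ Ak) N0N).
have z0 : (0 <= z)%E by apply: es_ge0 => k; case: ifP.
have y0 : (0 <= y)%E by apply: es_ge0 => k; case: ifP.
have := lt_le_trans hA Ay; rewrite -[ereal_sup _]/x.
have yfin : y \is a fin_num.
  by rewrite ge0_fin_numE//; apply: le_lt_trans sa; rewrite -/x xyz leeDl.
have zfin : z \is a fin_num.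
  by rewrite ge0_fin_numE//; apply: le_lt_trans sa; rewrite -/x xyz leeDr.
rewrite lteBlDr// xyz -(fineK yfin) -(fineK zfin) -!EFinD lte_fin lee_fin.
lra.
Qed.

Lemma sym_sum_tail (f : int -> C) N : csummable f ->
  ((nc (csum f - sym_sum f N))%:E <=
     es (fun k => if box N k then 0 else (nc (f k))%:E))%E.
Proof.
move=> sf; have [<- sb] := csum_box f N.
rewrite -csumB//; apply: le_trans (nc_csum _) _; apply: le_es => k.
by case: ifP => _; rewrite ?subrr ?subr0 ?Normc.normc0.
Qed.

Lemma sym_sum_cvg (f : int -> C) : csummable f -> forall e, 0 < e ->
  exists N0, forall N, (N0 <= N)%N -> nc (csum f - sym_sum f N) <= e.
Proof.
move=> sf e e0.
have [|N0 hN0] := @es_tail (fun k => (nc (f k))%:E) e _ sf e0.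
  by move=> k; rewrite lee_fin nc_ge0.
exists N0 => N /hN0; rewrite -lee_fin; apply: le_trans; exact: sym_sum_tail.
Qed.

Lemma sym_sum_cvgRe (f : int -> C) : csummable f ->
  complex.Re (sym_sum f n) @[n --> \oo] --> complex.Re (csum f).
Proof.
move=> sf; apply/cvgrPdist_le => e e0.
have [N0 hN0] := sym_sum_cvg sf e0.
exists N0 => // N hN; have := hN0 _ hN; apply: le_trans; rewrite -cReN -cReD; exact: Re_le_nc.
Qed.

Lemma sym_sum_cvgIm (f : int -> C) : csummable f ->
  complex.Im (sym_sum f n) @[n --> \oo] --> complex.Im (csum f).
Proof.
move=> sf; apply/cvgrPdist_le => e e0.
have [N0 hN0] := sym_sum_cvg sf e0.
exists N0 => // N hN; have := hN0 _ hN; apply: le_trans; rewrite -cImN -cImD; exact: Im_le_nc.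
Qed.

Lemma limC_sym_sum (f : int -> C) : csummable f ->
  f 0 + limC (fun N => \sum_(1 <= k < N.+1) (f k%:Z + f (- k%:Z))) = csum f.
Proof.
move=> sf.
have := sym_sum_cvgIm sf; have := sym_sum_cvgRe sf.
move: (csum f) => S hr hi.
apply: complex_eq; rewrite ?cReD ?cImD /limC /=.
  rewrite (@cvg_lim _ _ _ _ _ _ (complex.Re S - complex.Re (f 0)))//; first lra.
  rewrite (_ : (fun n => _) = (fun n => complex.Re (sym_sum f n) - complex.Re (f 0))).
    by apply: cvgB => //; exact: cvg_cst.
  by apply/funext => n; rewrite /sym_sum cReD; lra.
rewrite (@cvg_lim _ _ _ _ _ _ (complex.Im S - complex.Im (f 0)))//; first lra.
rewrite (_ : (fun n => _) = (fun n => complex.Im (sym_sum f n) - complex.Im (f 0))).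
  by apply: cvgB => //; exact: cvg_cst.
by apply/funext => n; rewrite /sym_sum cImD; lra.
Qed.

End Csum.

(** * Mean value on the circle *)

Section MeanValue.
Variable R : realType.
Implicit Types (f g h : R -> R[i]) (k : int) (x : R).
Local Notation C := R[i].
Local Notation I := (`[0%R, 1%R]%classic : set (measurableTypeR R)).
Local Notation mu := (@lebesgue_measure R).

Definition cmeas f := measurable_fun I (fun x : R => complex.Re (f x)) /\
  measurable_fun I (fun x : R => complex.Im (f x)).

Definition cint f := mu.-integrable I (EFin \o (fun x : R => complex.Re (f x))) /\
  mu.-integrable I (EFin \o (fun x : R => complex.Im (f x))).

Lemma measurable_circle : measurable I. Proof. exact: measurable_itv. Qed.

Lemma lebesgue_circle : (mu I = 1)%E.
Proof. by rewrite lebesgue_measure_itv/= lte_fin ltr01 oppr0 adde0. Qed.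

Lemma cmeasD f g : cmeas f -> cmeas g -> cmeas (fun x => f x + g x).
Proof.
move=> [f1 f2] [g1 g2]; split.
  rewrite (_ : (fun x => _) = (fun x => complex.Re (f x)) \+ (fun x => complex.Re (g x))).
    exact: measurable_funD.
  by apply/funext => x; rewrite cReD.
rewrite (_ : (fun x => _) = (fun x => complex.Im (f x)) \+ (fun x => complex.Im (g x))).
  exact: measurable_funD.
by apply/funext => x; rewrite cImD.
Qed.

Lemma cmeasN f : cmeas f -> cmeas (fun x => - f x).
Proof.
move=> [f1 f2]; split.
  rewrite (_ : (fun x => _) = \- (fun x => complex.Re (f x))).
    exact: measurableT_comp.
  by apply/funext => x; rewrite cReN.
rewrite (_ : (fun x => _) = \- (fun x => complex.Im (f x))).
  exact: measurableT_comp.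
by apply/funext => x; rewrite cImN.
Qed.

Lemma cmeasM f g : cmeas f -> cmeas g -> cmeas (fun x => f x * g x).
Proof.
move=> [f1 f2] [g1 g2]; split.
  rewrite (_ : (fun x => _) = ((fun x => complex.Re (f x)) \* (fun x => complex.Re (g x)))
     \- ((fun x => complex.Im (f x)) \* (fun x => complex.Im (g x)))).
    by apply: measurable_funB; exact: measurable_funM.
  by apply/funext => x; rewrite cReM.
rewrite (_ : (fun x => _) = ((fun x => complex.Re (f x)) \* (fun x => complex.Im (g x)))
     \+ ((fun x => complex.Im (f x)) \* (fun x => complex.Re (g x)))).
  by apply: measurable_funD; exact: measurable_funM.
by apply/funext => x; rewrite cImM.
Qed.

Lemma cmeas_cst c : cmeas (fun=> c).
Proof. by split; exact: measurable_cst. Qed.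

Lemma cmeasZ c f : cmeas f -> cmeas (fun x => c * f x).
Proof. by move=> mf; apply: cmeasM => //; exact: cmeas_cst. Qed.

Lemma cmeas_real (phi : R -> R) : measurable_fun I phi -> cmeas (fun x => (phi x)%:C).
Proof. by move=> mp; split => //; exact: measurable_cst. Qed.

Lemma cint_cmeas f : cint f -> cmeas f.
Proof.
move=> [/integrableP[f1 _] /integrableP[f2 _]]; split.
  by move/measurable_EFinP: f1.
by move/measurable_EFinP: f2.
Qed.

Lemma cmeas_sqr f : cmeas f -> measurable_fun I (fun x => nc (f x) ^+ 2).
Proof.
move=> [f1 f2].
rewrite (_ : (fun x => _) = ((fun x => complex.Re (f x)) \* (fun x => complex.Re (f x)))
     \+ ((fun x => complex.Im (f x)) \* (fun x => complex.Im (f x)))).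
  by apply: measurable_funD; exact: measurable_funM.
apply/funext => x /=; case: (f x) => a b /=.
by rewrite sqr_sqrtr ?addr_ge0 ?sqr_ge0// !expr2.
Qed.

Lemma integrable_dom (phi psi : R -> R) : measurable_fun I phi ->
  (forall x, I x -> `|phi x| <= psi x) -> mu.-integrable I (EFin \o psi) ->
  mu.-integrable I (EFin \o phi).
Proof.
move=> mp h; apply: (le_integrable measurable_circle); first exact/measurable_EFinP.
by move=> x Ix /=; rewrite lee_fin (le_trans (h x Ix))// ler_norm.
Qed.

Lemma cint_dom f (psi : R -> R) : cmeas f -> (forall x, I x -> nc (f x) <= psi x) ->
  mu.-integrable I (EFin \o psi) -> cint f.
Proof.
move=> [f1 f2] h ip; split.
  by apply: (integrable_dom f1 _ ip) => x /h; apply: le_trans; exact: Re_le_nc.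
by apply: (integrable_dom f2 _ ip) => x /h; apply: le_trans; exact: Im_le_nc.
Qed.

Lemma integrable_cst (c : R) : mu.-integrable I (EFin \o (fun=> c)).
Proof.
apply: (measurable_bounded_integrable measurable_circle).
- by rewrite [X in (X < _)%E]lebesgue_circle ltry.
- exact: measurable_cst.
- exists `|c|; split; first exact: num_real.
  by move=> M cM x _ /=; exact: ltW.
Qed.

Lemma cint_bnd f (c : R) : cmeas f -> (forall x, I x -> nc (f x) <= c) -> cint f.
Proof. by move=> mf h; apply: (cint_dom mf h); exact: integrable_cst. Qed.

Lemma cintD f g : cint f -> cint g -> cint (fun x => f x + g x).
Proof.
move=> [f1 f2] [g1 g2]; split.
  have := integrableD measurable_circle f1 g1; apply: eq_integrable => [|x _]; first exact: measurable_circle.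
  by rewrite /= cReD EFinD.
have := integrableD measurable_circle f2 g2; apply: eq_integrable => [|x _]; first exact: measurable_circle.
by rewrite /= cImD EFinD.
Qed.

Lemma cintZ c f : cint f -> cint (fun x => c * f x).
Proof.
move=> [f1 f2]; case: c => a b; split.
  have := integrableB measurable_circle (integrableZl measurable_circle a f1) (integrableZl measurable_circle b f2).
  by apply: eq_integrable => [|x _]; [exact: measurable_circle|rewrite /= cReM EFinB !EFinM].
have := integrableD measurable_circle (integrableZl measurable_circle a f2) (integrableZl measurable_circle b f1).
by apply: eq_integrable => [|x _]; [exact: measurable_circle|rewrite /= cImM EFinD !EFinM].
Qed.

Lemma meanD f g : cint f -> cint g -> mean (fun x => f x + g x) = mean f + mean g.
Proof.
move=> [f1 f2] [g1 g2]; apply: complex_eq; rewrite ?cReD ?cImD /=.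
  by rewrite -(RintegralD measurable_circle f1 g1); apply: eq_Rintegral => x _; rewrite cReD.
by rewrite -(RintegralD measurable_circle f2 g2); apply: eq_Rintegral => x _; rewrite cImD.
Qed.

Lemma meanZ c f : cint f -> mean (fun x => c * f x) = c * mean f.
Proof.
move=> [f1 f2]; case: c => a b.
have Z r := integrableZl measurable_circle r.
apply: complex_eq; rewrite ?cReM ?cImM /= -!RintegralZl//; try exact: measurable_circle.
  rewrite -RintegralB; [|exact: measurable_circle|exact: Z _ _ f1|exact: Z _ _ f2].
  by apply: eq_Rintegral => x _; rewrite cReM.
rewrite -RintegralD; [|exact: measurable_circle|exact: Z _ _ f2|exact: Z _ _ f1].
by apply: eq_Rintegral => x _; rewrite cImM.
Qed.

Lemma meanN f : cint f -> mean (fun x => - f x) = - mean f.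
Proof.
move=> cf; rewrite -mulN1r -meanZ//; congr mean; apply/funext => x.
by rewrite mulN1r.
Qed.

Lemma cintN f : cint f -> cint (fun x => - f x).
Proof.
move=> /(cintZ (-1)); congr cint; apply/funext => x; by rewrite mulN1r.
Qed.

Lemma meanB f g : cint f -> cint g -> mean (fun x => f x - g x) = mean f - mean g.
Proof. by move=> cf cg; rewrite meanD ?meanN//; exact: cintN. Qed.

Local Instance ae_lebesgue : Filter (almost_everywhere mu) := ae_filter_ringOfSetsType mu.

Lemma mean_ext f g : (forall x, I x -> f x = g x) -> mean f = mean g.
Proof.
by move=> h; rewrite /mean; congr (_ +i* _); apply: eq_Rintegral => x; rewrite inE => /h ->.
Qed.

Lemma mean_ae f g : cmeas f -> cmeas g -> circ_eq f g -> mean f = mean g.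
Proof.
move=> [f1 f2] [g1 g2] fg; rewrite /mean /Rintegral; congr (fine _ +i* fine _).
  apply: ae_eq_integral; [exact: measurable_circle|exact/measurable_EFinP..|].
  by apply: filterS fg => x h /h ->.
apply: ae_eq_integral; [exact: measurable_circle|exact/measurable_EFinP..|].
by apply: filterS fg => x h /h ->.
Qed.

(** The factor 2 comes from bounding the real and the imaginary part separately.
    *)
Lemma mean_bnd f (c : R) : cmeas f -> (forall x, I x -> nc (f x) <= c) ->
  nc (mean f) <= 2 * c.
Proof.
move=> mf h; have [f1 f2] := cint_bnd mf h.
have key (phi : R -> R) : mu.-integrable I (EFin \o phi) ->
    (forall x, I x -> `|phi x| <= c) -> `|\int[mu]_(x in I) phi x| <= c.
  move=> ip hp; apply: le_trans (le_normr_Rintegral measurable_circle ip) _.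
  have : \int[mu]_(x in I) `|phi x| <= \int[mu]_(x in I) c.
    apply: (le_Rintegral measurable_circle _ (integrable_cst c)) => //.
    exact: integrable_norm ip.
  rewrite (Rintegral_cst _ measurable_circle) (_ : fine _ = 1) ?mulr1//.
  by rewrite [X in fine X]lebesgue_circle.
apply: le_trans (nc_le _) _; rewrite mulr_natl mulr2n; apply: lerD; apply: key => // x Ix.
  by apply: le_trans (h _ Ix); exact: Re_le_nc.
by apply: le_trans (h _ Ix); exact: Im_le_nc.
Qed.

Lemma circ_L2_meas f : circ_L2 f -> cmeas f.
Proof. by case. Qed.

(** On a space of finite measure, |f| <= 1 + |f|^2 is integrable. *)
Lemma circ_L2_int f : circ_L2 f -> cint f.
Proof.
move=> [_ f1 f2 f3]; have mf : cmeas f by [].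
have i1 : mu.-integrable I (EFin \o (fun x => 1 + nc (f x) ^+ 2)).
  have : mu.-integrable I (EFin \o (fun x => nc (f x) ^+ 2)); last first.
    move=> /(integrableD measurable_circle (integrable_cst 1)).
    by apply: eq_integrable => [|x _]; [exact: measurable_circle|rewrite /= EFinD].
  apply/integrableP; split.
    by apply/measurable_EFinP; exact: cmeas_sqr.
  apply: le_lt_trans f3; apply: ge0_le_integral => //=; try exact: measurable_circle.
  - by apply/measurable_EFinP; apply: measurableT_comp => //; exact: cmeas_sqr.
  - by apply/measurable_EFinP; exact: cmeas_sqr.
  - by move=> x _; rewrite lee_fin ger0_norm// sqr_ge0.
apply: (cint_dom mf _ i1) => x _; have := sqr_ge0 (nc (f x) - 2^-1); nra.
Qed.

Lemma circ_L2_bnd f (c : R) : periodic f 1 -> cmeas f ->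
  (forall x, nc (f x) <= c) -> circ_L2 f.
Proof.
move=> pf [f1 f2] h; split => //.
apply: (@le_lt_trans _ _ (\int[mu]_(x in I) (c ^+ 2)%:E)%E).
  apply: ge0_le_integral => //=; try exact: measurable_circle.
  - by move=> x _; rewrite lee_fin sqr_ge0.
  - by apply/measurable_EFinP; exact: cmeas_sqr.
  - by move=> x _; rewrite lee_fin ler_sqr ?nnegrE ?nc_ge0// (le_trans _ (h x))// nc_ge0.
rewrite integral_cst// [X in (_ * X)%E](_ : _ = 1%E) ?mule1 ?ltry//.
exact: lebesgue_circle.
Qed.

Lemma circ_L2B f g : circ_L2 f -> circ_L2 g -> circ_L2 (fun x => f x - g x).
Proof.
move=> Lf Lg; have mf := circ_L2_meas Lf; have mg := circ_L2_meas Lg.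
have [h1 h2] := cmeasD mf (cmeasN mg).
case: Lf Lg => pf _ _ if2 [pg _ _ ig2]; split => //.
  by move=> x; rewrite pf pg.
have sf := cmeas_sqr mf; have sg := cmeas_sqr mg.
have e (x : R) : nc (f x - g x) ^+ 2 <= 2 * nc (f x) ^+ 2 + 2 * nc (g x) ^+ 2.
  have := le_normcD (f x) (- g x); rewrite normcN => h.
  have := nc_ge0 (f x - g x); have := nc_ge0 (f x); have := nc_ge0 (g x).
  have := sqr_ge0 (nc (f x) - nc (g x)); nra.
apply: (@le_lt_trans _ _ (\int[mu]_(x in I) (2%:E * (nc (f x) ^+ 2)%:E + 2%:E * (nc (g x) ^+ 2)%:E))%E).
  apply: ge0_le_integral => //=; try exact: measurable_circle.
  - by move=> x _; rewrite lee_fin sqr_ge0.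
  - by apply/measurable_EFinP; exact: cmeas_sqr (conj h1 h2).
  - apply: emeasurable_funD; apply: emeasurable_funM => //; exact/measurable_EFinP.
  - by move=> x _; rewrite -!EFinM -EFinD lee_fin.
rewrite ge0_integralD//=; try exact: measurable_circle.
- rewrite !ge0_integralZl_EFin//; try exact: measurable_circle.
  + by apply: lte_add_pinfty; apply: lte_mul_pinfty.
  + by move=> x _; rewrite lee_fin sqr_ge0.
  + exact/measurable_EFinP.
  + by move=> x _; rewrite lee_fin sqr_ge0.
  + exact/measurable_EFinP.
- by move=> x _; rewrite mule_ge0// lee_fin sqr_ge0.
- by apply: emeasurable_funM => //; exact/measurable_EFinP.
- by move=> x _; rewrite mule_ge0// lee_fin sqr_ge0.
- by apply: emeasurable_funM => //; exact/measurable_EFinP.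
Qed.

Lemma circ_eqP f g : (forall x, I x -> f x = g x) -> circ_eq f g.
Proof. by move=> h; apply: aeW. Qed.

Lemma circ_eq_sym f g : circ_eq f g -> circ_eq g f.
Proof. by apply: filterS => x h /h. Qed.

Lemma circ_eq_trans f g h : circ_eq f g -> circ_eq g h -> circ_eq f h.
Proof. by apply: filterS2 => x a b Ix; rewrite a ?b. Qed.

Lemma circ_eqD f g f' g' : circ_eq f g -> circ_eq f' g' ->
  circ_eq (fun x => f x + f' x) (fun x => g x + g' x).
Proof. by apply: filterS2 => x a b Ix; rewrite a ?b. Qed.

Lemma circ_eqM f g f' g' : circ_eq f g -> circ_eq f' g' ->
  circ_eq (fun x => f x * f' x) (fun x => g x * g' x).
Proof. by apply: filterS2 => x a b Ix; rewrite a ?b. Qed.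

End MeanValue.

(** * Absolutely convergent Fourier series *)

Section FourierSeries.
Variable R : realType.
Implicit Types (f g h : R -> R[i]) (k : int) (x : R).
Local Notation C := R[i].
Local Notation I := (`[0%R, 1%R]%classic : set (measurableTypeR R)).
Local Notation mu := (@lebesgue_measure R).

Definition freq k : R := 2 * k%:~R * pi.

Lemma fexpE k x : fexp k x = cos (freq k * x) +i* sin (freq k * x).
Proof. by []. Qed.

Lemma freqD j k : freq (j + k) = freq j + freq k.
Proof. by rewrite /freq intrD; ring. Qed.

Lemma cos_sin_mul (a b : R) : (cos a +i* sin a) * (cos b +i* sin b) =
  cos (a + b) +i* sin (a + b) :> C.
Proof. by apply: complex_eq; rewrite ?cReM ?cImM /= ?cosD ?sinD//; ring. Qed.

Lemma fexpD j k x : fexp (j + k) x = fexp j x * fexp k x.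
Proof. by rewrite !fexpE cos_sin_mul freqD mulrDl. Qed.

Lemma fexp_arg k x y : fexp k (x + y) = fexp k x * fexp k y.
Proof. by rewrite !fexpE cos_sin_mul mulrDr. Qed.

Lemma fexp0 x : fexp 0 x = 1.
Proof. by rewrite fexpE /freq mulr0 !mul0r cos0 sin0. Qed.

Lemma nc_fexp k x : nc (fexp k x) = 1.
Proof. by rewrite fexpE /= cos2Dsin2 sqrtr1. Qed.

Lemma fexp_at1 k : fexp k (1 : R) = 1.
Proof.
have e1 : fexp 1 (1 : R) = 1.
  by rewrite fexpE /freq !mulr1 mulr_natl cos2pi sin2pi.
elim: k => [|n IH|n IH]; first by rewrite fexp0.
  by rewrite -addn1 PoszD fexpD IH e1 mulr1.
rewrite -[LHS]mulr1 -[X in _ * X]e1 -fexpD (_ : - n.+1%:Z + 1 = - n%:Z)//; lia.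
Qed.

Lemma fexp_periodic k : periodic (@fexp R k) 1.
Proof. by move=> x; rewrite fexp_arg fexp_at1 mulr1. Qed.

Lemma is_derive_lin (c x : R) : is_derive x 1 ( *%R c) c.
Proof.
have := @is_deriveZ R _ _ id c x 1 1 (is_derive_id _ _).
by rewrite /GRing.scale/= mulr1.
Qed.

Lemma is_derive_cosl (c x : R) :
  is_derive x 1 (fun y => cos (c * y)) (- (c * sin (c * x))).
Proof.
have h1 := is_derive_lin c x; have h2 := is_derive_cos (c * x).
have := @is_derive1_comp R cos ( *%R c) x _ _ h2 h1.
by rewrite mulNr mulrC.
Qed.

Lemma is_derive_sinl (c x : R) :
  is_derive x 1 (fun y => sin (c * y)) (c * cos (c * x)).
Proof.
have h1 := is_derive_lin c x; have h2 := is_derive_sin (c * x).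
have := @is_derive1_comp R sin ( *%R c) x _ _ h2 h1.
by rewrite mulrC.
Qed.

Lemma continuous_cosl (c : R) : continuous (fun y : R => cos (c * y)).
Proof.
move=> x; apply: differentiable_continuous; apply/derivable1_diffP.
by have := is_derive_cosl c x; case.
Qed.

Lemma continuous_sinl (c : R) : continuous (fun y : R => sin (c * y)).
Proof.
move=> x; apply: differentiable_continuous; apply/derivable1_diffP.
by have := is_derive_sinl c x; case.
Qed.

Lemma cmeas_fexp k : cmeas (@fexp R k).
Proof.
split; apply: measurable_funTS; apply: continuous_measurable_fun.
  exact: continuous_cosl.
exact: continuous_sinl.
Qed.

Lemma Rintegral_derive (F f : R -> R) : (forall x, is_derive x 1 F (f x)) ->
  continuous f -> \int[mu]_(x in I) f x = F 1 - F 0.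
Proof.
move=> dF cf.
have cF : continuous F.
  move=> x; apply: differentiable_continuous; apply/derivable1_diffP.
  by have := dF x; case.
rewrite /Rintegral (@continuous_FTC2 R f F 0 1)//.
- exact: continuous_subspaceT.
- split; first by move=> x _; have := dF x; case.
  + by apply: cvg_at_right_filter; exact: cF.
  + by apply: cvg_at_left_filter; exact: cF.
- by move=> x _; rewrite derive1E; have := dF x => dFx; rewrite derive_val.
Qed.

Lemma integrable_continuous (f : R -> R) : continuous f -> mu.-integrable I (EFin \o f).
Proof.
move=> cf; apply: continuous_compact_integrable; first exact: segment_compact.
exact: continuous_subspaceT.
Qed.

Lemma freq_eq0 k : (freq k == 0) = (k == 0).
Proof.
rewrite /freq !mulf_eq0 pnatr_eq0 /= intr_eq0.
by rewrite (gt_eqF (pi_gt0 R)) orbF.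
Qed.

Lemma mean_fexp k : mean (@fexp R k) = if k == 0 then 1 else 0.
Proof.
case: ifPn => [/eqP ->|k0].
  rewrite (@mean_ext _ _ (fun=> 1)); last by move=> x _; rewrite fexp0.
  apply: complex_eq => /=; last by rewrite (Rintegral_cst _ (@measurable_circle R)) mul0r.
  rewrite (Rintegral_cst _ (@measurable_circle R)) mul1r [X in fine X](_ : _ = 1%E)//.
  exact: lebesgue_circle.
have c0 : freq k != 0 by rewrite freq_eq0.
have [E1 E2] : cos (freq k) = 1 /\ sin (freq k) = 0.
  by have := fexp_at1 k; rewrite fexpE mulr1 => -[-> ->].
have ic := integrable_continuous (@continuous_cosl (freq k)).
have is_ := integrable_continuous (@continuous_sinl (freq k)).
apply: complex_eq => /=.
  have := @Rintegral_derive _ _ (is_derive_sinl (freq k)).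
  rewrite mulr1 mulr0 sin0 E2 subrr (RintegralZl (freq k) (@measurable_circle R) ic) => h.
  have : freq k * \int[mu]_(x in I) cos (freq k * x) = 0.
    apply: h => x; apply: cvgM; [exact: cvg_cst|exact: continuous_cosl].
  by move/eqP; rewrite mulf_eq0 (negbTE c0) => /eqP.
have := @Rintegral_derive _ _ (is_derive_cosl (freq k)).
rewrite mulr1 mulr0 cos0 E1 subrr => h.
have : \int[mu]_(x in I) (- freq k * sin (freq k * x)) = 0.
  rewrite -[RHS]h; last first.
    move=> x; apply: (@cvgN _ _ _ _ _ (fun y => freq k * sin (freq k * y))).
    by apply: cvgM; [exact: cvg_cst|exact: continuous_sinl].
  by apply: eq_Rintegral => x _; rewrite mulNr.
rewrite (RintegralZl (- freq k) (@measurable_circle R) is_) => /eqP.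
by rewrite mulf_eq0 oppr_eq0 (negbTE c0) => /eqP.
Qed.

Definition Fser (a : int -> C) x : C := csum (fun k => a k * fexp k x).

Definition l1 (a : int -> C) : R := fine (es (fun k => (nc (a k))%:E)).

Lemma es_l1 (a : int -> C) : csummable a -> es (fun k => (nc (a k))%:E) = (l1 a)%:E.
Proof. by move=> sa; rewrite (es_fineK _ sa)// => k; rewrite lee_fin nc_ge0. Qed.

Lemma csummable_bmul (T : choiceType) (a b : T -> C) (c : R) : csummable a -> 0 <= c ->
  (forall i, nc (b i) <= c) -> csummable (fun i => a i * b i).
Proof.
move=> sa c0 h; apply: (csummable_le (g := fun i : T => nc (c%:C * a i))); last first.
  exact: (csummableZ c%:C sa).
move=> k; rewrite !Normc.normcM mulrC nc_real ger0_norm//.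
by rewrite ler_wpM2r ?nc_ge0.
Qed.

Lemma Fser_summable a x : csummable a -> csummable (fun k => a k * fexp k x).
Proof.
by move=> sa; apply: (csummable_bmul (c := 1)) => // k; rewrite nc_fexp.
Qed.

Lemma Fser_bnd a x : csummable a -> nc (Fser a x) <= l1 a.
Proof.
move=> sa; rewrite -lee_fin -es_l1//; apply: le_trans (nc_csum _) _.
by apply: le_es => k; rewrite Normc.normcM nc_fexp mulr1.
Qed.

Lemma Fser_periodic a : periodic (Fser a) 1.
Proof. by move=> x; apply: eq_csum => k; rewrite fexp_periodic. Qed.

Lemma cmeas_sum n (F : nat -> R -> C) : (forall i, cmeas (F i)) ->
  cmeas (fun x => \sum_(1 <= i < n) F i x).
Proof.
move=> mF; elim: n => [|n IH].
  have := @cmeas_cst R 0; congr cmeas; apply/funext => x; by rewrite big_geq.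
have [n0|n0] := leqP 1 n; last first.
  have := @cmeas_cst R 0; congr cmeas; apply/funext => x; rewrite big_geq//.
have := cmeasD IH (mF n); congr cmeas; apply/funext => x.
by rewrite big_nat_recr.
Qed.

Lemma cmeas_sym_sum (F : int -> R -> C) N : (forall k, cmeas (F k)) ->
  cmeas (fun x => sym_sum (F^~ x) N).
Proof.
move=> mF; rewrite /sym_sum; apply: cmeasD => //.
by apply: cmeas_sum => i; apply: cmeasD.
Qed.

Lemma cmeas_Fser a : csummable a -> cmeas (Fser a).
Proof.
move=> sa.
have ms N : cmeas (fun x => sym_sum (fun k => a k * fexp k x) N).
  by apply: cmeas_sym_sum => k; apply: cmeasZ; exact: cmeas_fexp.
split.
  apply: (@measurable_fun_cvg _ _ _ _ (fun N x => complex.Re (sym_sum (fun k => a k * fexp k x) N))).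
    by move=> N; case: (ms N).
  by move=> x _; apply: sym_sum_cvgRe; exact: Fser_summable.
apply: (@measurable_fun_cvg _ _ _ _ (fun N x => complex.Im (sym_sum (fun k => a k * fexp k x) N))).
  by move=> N; case: (ms N).
by move=> x _; apply: sym_sum_cvgIm; exact: Fser_summable.
Qed.

Lemma Fser_L2 a : csummable a -> circ_L2 (Fser a).
Proof.
move=> sa; apply: (circ_L2_bnd (@Fser_periodic a) (cmeas_Fser sa)) => x.
exact: Fser_bnd.
Qed.

Lemma mean_sum n (F : nat -> R -> C) : (forall i, cint (F i)) ->
  mean (fun x => \sum_(1 <= i < n) F i x) = \sum_(1 <= i < n) mean (F i) /\
  cint (fun x => \sum_(1 <= i < n) F i x).
Proof.
move=> iF; have i0 : cint (fun=> 0 : C).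
  by apply: (cint_bnd (c := 0)) => [|x _]; [exact: cmeas_cst|rewrite Normc.normc0].
have m0 : mean (fun=> 0 : C) = 0.
  by rewrite -[LHS]subr0 -[RHS](subrr (mean (fun=> 0 : C))) -meanB//;
    rewrite subr0; congr mean; apply/funext => x; rewrite subr0.
elim: n => [|n [IH1 IH2]].
  rewrite big_geq// (_ : (fun x => _) = (fun=> 0))//.
  by apply/funext => x; rewrite big_geq.
have [n0|n0] := leqP 1 n; last first.
  rewrite big_geq// (_ : (fun x => _) = (fun=> 0))//.
  by apply/funext => x; rewrite big_geq.
rewrite (_ : (fun x => _) = (fun x => \sum_(1 <= i < n) F i x + F n x)).
  by rewrite meanD// IH1 [in RHS]big_nat_recr//; split => //; exact: cintD.
by apply/funext => x; rewrite big_nat_recr.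
Qed.

Lemma mean_sym_sum (F : int -> R -> C) N : (forall k, cint (F k)) ->
  mean (fun x => sym_sum (F^~ x) N) = sym_sum (fun k => mean (F k)) N.
Proof.
move=> iF; rewrite /sym_sum.
have iF2 i : cint (fun x => F i%:Z x + F (- i%:Z) x) by exact: cintD.
have [h1 h2] := @mean_sum N.+1 (fun i x => F i%:Z x + F (- i%:Z) x) iF2.
rewrite meanD// h1; congr (_ + _); apply: eq_bigr => i _.
by rewrite meanD.
Qed.

Lemma sym_sumMr (F : int -> C) c N :
  sym_sum F N * c = sym_sum (fun k => F k * c) N.
Proof.
rewrite /sym_sum mulrDl mulr_suml; congr (_ + _); apply: eq_bigr => i _.
by rewrite mulrDl.
Qed.

(** The symmetric partial sums converge uniformly, by the tail of sum_k |a_k|,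
    so the integral can be taken term by term. *)
Lemma mean_Fser_mul a (phi : R -> C) (c : R) : csummable a -> cmeas phi -> 0 <= c ->
  (forall x, I x -> nc (phi x) <= c) ->
  mean (fun x => Fser a x * phi x) = csum (fun k => a k * mean (fun x => fexp k x * phi x)).
Proof.
move=> sa mphi c0 h.
set L := mean _; set M := csum _.
have ifphi k : cint (fun x => fexp k x * phi x).
  apply: (cint_bnd (c := c)); first by apply: cmeasM => //; exact: cmeas_fexp.
  by move=> x Ix; rewrite Normc.normcM nc_fexp mul1r h.
have iSphi : cint (fun x => Fser a x * phi x).
  apply: (cint_bnd (c := l1 a * c)); first by apply: cmeasM => //; exact: cmeas_Fser.
  move=> x Ix; rewrite Normc.normcM ler_pM ?nc_ge0 ?h//.
  exact: Fser_bnd.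
have bm k : nc (mean (fun x => fexp k x * phi x)) <= 2 * c.
  apply: mean_bnd; first by case: (ifphi k) => ? ?; apply: cmeasM => //; exact: cmeas_fexp.
  by move=> x Ix; rewrite Normc.normcM nc_fexp mul1r h.
have sM : csummable (fun k => a k * mean (fun x => fexp k x * phi x)).
  by apply: (csummable_bmul (c := 2 * c)) => //; rewrite mulr_ge0.
apply/eqP; rewrite -subr_eq0; apply/eqP/nc_eq0/eqP; rewrite eq_le nc_ge0 andbT.
apply/ler_addgt0Pr => e e0; rewrite add0r.
pose e1 := e / 2 / (2 * c + 1).
have c1 : 0 < 2 * c + 1 by lra.
have e10 : 0 < e1 by rewrite !divr_gt0.
have [N1 hN1] := sym_sum_cvg sM (divr_gt0 e0 (ltr0Sn R 1)).
have [|N2 hN2] := @es_tail _ (fun k => (nc (a k))%:E) e1 _ sa e10.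
  by move=> k; rewrite lee_fin nc_ge0.
pose N := maxn N1 N2.
have h1 := hN1 N (leq_maxl _ _); have h2 := hN2 N (leq_maxr _ _).
pose F := fun k x => a k * (fexp k x * phi x).
have iF k : cint (F k) by exact: cintZ.
have E : mean (fun x => sym_sum (F^~ x) N) =
         sym_sum (fun k => a k * mean (fun x => fexp k x * phi x)) N.
  rewrite mean_sym_sum//; congr (sym_sum _ N); apply/funext => k.
  by rewrite meanZ.
have mF : cmeas (fun x => sym_sum (F^~ x) N).
  by apply: cmeas_sym_sum => k; exact: cint_cmeas.
have E2 x : sym_sum (F^~ x) N = sym_sum (fun k => a k * fexp k x) N * phi x.
  by rewrite sym_sumMr; congr (sym_sum _ N); apply/funext => k; rewrite /F mulrA.
have bd x : I x -> nc (Fser a x * phi x - sym_sum (F^~ x) N) <= e1 * c.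
  move=> Ix; rewrite E2 -mulrBl Normc.normcM ler_pM ?nc_ge0 ?h//.
  rewrite -lee_fin; apply: le_trans (sym_sum_tail N (Fser_summable x sa)) _.
  apply: le_trans h2; apply: le_es => k; case: ifP => // _.
  by rewrite Normc.normcM nc_fexp mulr1.
have iFs : cint (fun x => sym_sum (F^~ x) N).
  apply: (cint_bnd (c := l1 a * c + e1 * c)) => // x Ix.
  rewrite -[sym_sum _ _](subKr (Fser a x * phi x)).
  apply: le_trans (le_normcD _ _) _; rewrite normcN lerD ?bd//.
  rewrite Normc.normcM ler_pM ?nc_ge0 ?h//; exact: Fser_bnd.
have : nc (L - mean (fun x => sym_sum (F^~ x) N)) <= 2 * (e1 * c).
  rewrite /L -meanB//; apply: mean_bnd => //.
  apply: cmeasD; first by apply: cmeasM => //; exact: cmeas_Fser.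
  exact: cmeasN.
rewrite E => h3.
have -> : L - M = (L - sym_sum (fun k => a k * mean (fun x => fexp k x * phi x)) N)
   - (M - sym_sum (fun k => a k * mean (fun x => fexp k x * phi x)) N) by ring.
apply: le_trans (le_normcD _ _) _; rewrite normcN.
have h4 : 2 * (e1 * c) <= e / 2.
  rewrite mulrA mulrAC /e1 mulrCA ler_piMr ?divr_ge0 ?ltW//.
  by rewrite ltr_pdivrMr// mul1r; lra.
by apply: le_trans (lerD h3 h1) _; lra.
Qed.

Lemma fourier_Fser a k : csummable a -> fourier (Fser a) k = a k.
Proof.
move=> sa; rewrite /fourier (@mean_Fser_mul _ _ 1)//.
- rewrite -[RHS](csum_set1 k (a k)); apply: eq_csum => j.
  rewrite (_ : (fun x => _) = fexp (j - k)); last first.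
    by apply/funext => x; rewrite fexpD.
  by rewrite mean_fexp subr_eq0; case: eqP => [->|]; rewrite ?mulr1 ?mulr0.
- exact: cmeas_fexp.
- by move=> x _; rewrite nc_fexp.
Qed.

Lemma fourier_ae f g k : cmeas f -> cmeas g -> circ_eq f g -> fourier f k = fourier g k.
Proof.
move=> mf mg fg; apply: mean_ae; try by apply: cmeasM => //; exact: cmeas_fexp.
by apply: circ_eqM => //; exact: circ_eqP.
Qed.

Lemma cint_fexp f k : cint f -> cint (fun x => f x * fexp k x).
Proof.
move=> cf; have mf := cint_cmeas cf.
have ipsi : mu.-integrable I (EFin \o (fun x => `|complex.Re (f x)| + `|complex.Im (f x)|)).
  case: cf => /integrable_norm f1 /integrable_norm f2.
  have := integrableD (@measurable_circle R) f1 f2.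
  by apply: eq_integrable => [|x _]; [exact: measurable_circle|rewrite /= EFinD].
apply: (cint_dom _ _ ipsi); first by apply: cmeasM => //; exact: cmeas_fexp.
by move=> x _; rewrite Normc.normcM nc_fexp mulr1 nc_le.
Qed.

Lemma fourierB f g k : cint f -> cint g ->
  fourier (fun x => f x - g x) k = fourier f k - fourier g k.
Proof.
move=> cf cg; rewrite /fourier -meanB; [|exact: cint_fexp..].
by congr mean; apply/funext => x; rewrite mulrBl.
Qed.

Lemma fourierZ c f k : cint f -> fourier (fun x => c * f x) k = c * fourier f k.
Proof.
move=> cf; rewrite /fourier -meanZ; last exact: cint_fexp.
by congr mean; apply/funext => x; rewrite mulrA.
Qed.

Lemma fourier0E f : fourier f 0 = mean f.
Proof. by congr mean; apply/funext => x; rewrite oppr0 fexp0 mulr1. Qed.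

Definition cconv (a b : int -> C) : int -> C :=
  fun k => csum (fun j => a j * b (k - j)).

Lemma bij_shift (j : int) : bijective (fun k : int => k - j).
Proof. by exists (fun k => k + j) => k; rewrite ?subrK ?addrK. Qed.

Lemma bij_refl (j : int) : bijective (fun k : int => j - k).
Proof. by exists (fun k => j - k) => k; rewrite subKr. Qed.

(** Young's inequality for l^1, as an equality since all the terms are
    nonnegative. *)
Lemma es_prod (p q : int -> \bar R) : (forall k, 0 <= p k)%E -> (forall k, 0 <= q k)%E ->
  (forall k, p k \is a fin_num) -> es q \is a fin_num ->
  es (fun k : int => es (fun j : int => p j * q (k - j)%R)%E) = (es p * es q)%E.
Proof.
move=> p0 q0 pf qf; rewrite es_fubini; last by move=> i j; rewrite mule_ge0.
rewrite (eq_es (g := fun j => es q * p j)%E).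
  have q0' : (0 <= es q)%E by exact: es_ge0.
  move: (es q) qf q0' => Q /fineK <-; rewrite lee_fin => Q0.
  by rewrite esZ// muleC.
move=> j; rewrite -(fineK (pf j)) esZ ?fine_ge0//.
by rewrite muleC; congr (_ * _)%E; exact: (es_bij q (bij_shift j)).
Qed.

Lemma csummable_cconv a b : csummable a -> csummable b -> csummable (cconv a b).
Proof.
move=> sa sb.
apply: (@le_lt_trans _ _ (es (fun k => es (fun j => (nc (a j))%:E * (nc (b (k - j)))%:E)))%E).
  apply: le_es => k; apply: le_trans (nc_csum _) _; apply: le_es => j.
  by rewrite Normc.normcM EFinM.
rewrite (es_prod (p := fun j => (nc (a j))%:E) (q := fun j => (nc (b j))%:E)) => [|k|k|k|].
- by rewrite !es_l1// -EFinM ltry.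
- by rewrite lee_fin nc_ge0.
- by rewrite lee_fin nc_ge0.
- by [].
- by rewrite es_l1.
Qed.

(** The products a_j b_l e_(j+l) are summed along j + l = k. *)
Lemma Fser_mul a b x : csummable a -> csummable b -> Fser a x * Fser b x = Fser (cconv a b) x.
Proof.
move=> sa sb; rewrite /Fser -csumZr; last exact: Fser_summable.
pose F j k := a j * b (k - j) * fexp k x.
rewrite (eq_csum (g := fun j => csum (F j))); last first.
  move=> j; rewrite -csumZ; last exact: Fser_summable.
  rewrite -(csum_bij (fun k => a j * fexp j x * (b k * fexp k x)) (bij_shift j)).
  apply: eq_csum => k; rewrite /F (_ : fexp k x = fexp (k - j) x * fexp j x).
    by ring.
  by rewrite -fexpD subrK.
rewrite csum_fubini; last first.
  rewrite es_fubini; last by move=> *; rewrite lee_fin nc_ge0.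
  rewrite (eq_es (g := fun k => es (fun j => (nc (a j))%:E * (nc (b (k - j)))%:E)))%E; last first.
    move=> k; apply: eq_es => j.
    by rewrite /F !Normc.normcM nc_fexp mulr1 EFinM.
  rewrite (es_prod (p := fun j => (nc (a j))%:E) (q := fun j => (nc (b j))%:E)) => [|k|k|k|].
  - by rewrite !es_l1// -EFinM ltry.
  - by rewrite lee_fin nc_ge0.
  - by rewrite lee_fin nc_ge0.
  - by [].
  - by rewrite es_l1.
apply: eq_csum => k; rewrite /cconv -csumZr//.
have sbk : csummable (fun j => b (k - j)).
  by move: sb; rewrite /csummable -(es_bij _ (bij_refl k)).
apply: (csummable_bmul (c := l1 b)) => //.
  by rewrite fine_ge0// es_ge0// => j; rewrite lee_fin nc_ge0.
move=> j; rewrite -lee_fin -es_l1//.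
by apply: (term_le_es (f := fun k => (nc (b k))%:E)) => i; rewrite lee_fin nc_ge0.
Qed.

Lemma Fser_add a b x : csummable a -> csummable b ->
  Fser (fun k => a k + b k) x = Fser a x + Fser b x.
Proof.
move=> sa sb; rewrite /Fser -csumD; [|exact: Fser_summable..].
by apply: eq_csum => k; rewrite mulrDl.
Qed.

Lemma Fser_scale c a x : csummable a -> Fser (fun k => c * a k) x = c * Fser a x.
Proof.
move=> sa; rewrite /Fser -csumZ; last exact: Fser_summable.
by apply: eq_csum => k; rewrite mulrA.
Qed.

End FourierSeries.

(** * Injectivity of the Fourier transform *)

Section FourierUniqueness.
Variable R : realType.
Implicit Types (f g h : R -> R[i]) (k : int) (x : R).
Local Notation C := R[i].
Local Notation I := (`[0%R, 1%R]%classic : set (measurableTypeR R)).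
Local Notation mu := (@lebesgue_measure R).

Local Instance ae_leb : Filter (almost_everywhere mu) := ae_filter_ringOfSetsType mu.

Lemma ae_conj (P Q : R -> Prop) : {ae mu, forall x : R, P x} -> {ae mu, forall x : R, Q x} ->
  {ae mu, forall x : R, P x /\ Q x}.
Proof. exact: filterI. Qed.

Lemma ae_weaken (P Q : R -> Prop) : (forall x, P x -> Q x) -> {ae mu, forall x : R, P x} ->
  {ae mu, forall x : R, Q x}.
Proof. by move=> PQ; apply: filterS. Qed.

Lemma cint_mulb f h (c : R) : cint f -> cmeas h -> (forall x, I x -> nc (h x) <= c) ->
  cint (fun x => f x * h x).
Proof.
move=> cf mh hc; have mf := cint_cmeas cf.
have ipsi : mu.-integrable I (EFin \o (fun x => c * (`|complex.Re (f x)| + `|complex.Im (f x)|))).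
  case: cf => /integrable_norm f1 /integrable_norm f2.
  have := integrableZl (@measurable_circle R) c (integrableD (@measurable_circle R) f1 f2).
  by apply: eq_integrable => [|x _]; [exact: measurable_circle|rewrite /= EFinM EFinD].
apply: (cint_dom _ _ ipsi); first exact: cmeasM.
move=> x Ix; rewrite Normc.normcM mulrC ler_pM ?nc_ge0 ?hc// nc_le//.
Qed.

(** The functions h for which the product f h has only vanishing coefficients.
    All trigonometric polynomials are of this kind when f has vanishing
    coefficients; working with the property avoids a formal algebra of
    trigonometric polynomials. *)
Definition kills f h := [/\ cmeas h, (exists c : R, forall x, nc (h x) <= c) &
  forall k, mean (fun x => f x * (h x * fexp k x)) = 0].

(** These functions form an algebra that contains the exponentials, which gives
    the powers used in [step]. *)
Definition multiplier f p := forall h, kills f h -> kills f (fun x => h x * p x).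

Lemma kills_int f h k : cint f -> kills f h -> cint (fun x => f x * (h x * fexp k x)).
Proof.
move=> cf [mh [c hc] _]; apply: (cint_mulb (c := c)) => //.
  by apply: cmeasM => //; exact: cmeas_fexp.
by move=> x _; rewrite Normc.normcM nc_fexp mulr1.
Qed.

Lemma multiplier_fexp f k : multiplier f (fexp k).
Proof.
move=> h [mh [c hc] fh]; split; first by apply: cmeasM => //; exact: cmeas_fexp.
  by exists c => x; rewrite Normc.normcM nc_fexp mulr1.
move=> j; rewrite -(fh (k + j)); congr mean; apply/funext => x.
by rewrite fexpD !mulrA.
Qed.

Lemma multiplierD f p q : cint f -> multiplier f p -> multiplier f q ->
  multiplier f (fun x => p x + q x).
Proof.
move=> cf mp mq h kh; have kp := mp _ kh; have kq := mq _ kh.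
have E : (fun x => h x * (p x + q x)) = (fun x => h x * p x + h x * q x).
  by apply/funext => x; rewrite mulrDr.
rewrite E; split.
- by apply: cmeasD; [case: kp|case: kq].
- case: kp kq => _ [c hc] _ [_ [d hd] _]; exists (c + d) => x.
  by apply: le_trans (le_normcD _ _) _; rewrite lerD.
move=> k; have ip := kills_int k cf kp; have iq := kills_int k cf kq.
rewrite (_ : (fun x => _) = (fun x => f x * (h x * p x * fexp k x) + f x * (h x * q x * fexp k x))).
  by rewrite meanD//; case: kp => _ _ ->; case: kq => _ _ ->; rewrite addr0.
by apply/funext => x; ring.
Qed.

Lemma multiplier_cst f c : cint f -> multiplier f (fun=> c).
Proof.
move=> cf h kh; case: (kh) => mh [d hd] fh; split.
- by apply: cmeasM => //; exact: cmeas_cst.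
- exists (d * nc c) => x; rewrite Normc.normcM ler_wpM2r ?nc_ge0//.
move=> k; rewrite (_ : (fun x => _) = (fun x => c * (f x * (h x * fexp k x)))).
  by rewrite meanZ ?fh ?mulr0//; exact: kills_int.
by apply/funext => x; ring.
Qed.

Lemma multiplierM f p q : multiplier f p -> multiplier f q ->
  multiplier f (fun x => p x * q x).
Proof.
move=> mp mq h kh; have := mq _ (mp _ kh); congr kills.
by apply/funext => x; rewrite mulrA.
Qed.

Lemma multiplierX f p n : cint f -> multiplier f p -> multiplier f (fun x => p x ^+ n).
Proof.
move=> cf mp; elim: n => [|n IH].
  have := multiplier_cst 1 cf; congr multiplier; apply/funext => x.
have := multiplierM mp IH; congr multiplier; apply/funext => x.
by rewrite exprS.
Qed.

(** A trigonometric polynomial of degree 1 which separates the arc ]0, b[ from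
    its complement: it is below 1/2 on the arc, above 1/2 outside its closure,
    and stays between 0 and 1. *)
Definition sep (b x : R) : R := 2^-1 - (cos (2 * pi * x - pi * b) - cos (pi * b)) / 4.

(** For q in [0, 1], (1 - q^n)^(2^n) tends to 1 if q < 1/2 and to 0 if q > 1/2,
    so these trigonometric polynomials approximate the indicator function of [0,
    b] boundedly. *)
Definition step (b : R) n x : R := (1 - sep b x ^+ n) ^+ (2 ^ n).

Lemma multiplier_sep f (b : R) : cint f -> multiplier f (fun x => (sep b x)%:C).
Proof.
move=> cf.
pose w : C := cos (pi * b) -i* sin (pi * b).
pose w' : C := cos (pi * b) +i* sin (pi * b).
have -> : (fun x => (sep b x)%:C) = (fun x => (2^-1 + cos (pi * b) / 4)%:C +
   ((- 8^-1)%:C * w * fexp 1 x + (- 8^-1)%:C * w' * fexp (- 1) x)).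
  apply/funext => x; rewrite /sep cosB; rewrite !fexpE /freq.
  rewrite (_ : 2 * 1%:~R * pi * x = 2 * pi * x); last by rewrite mulr1.
  rewrite (_ : 2 * (- 1)%:~R * pi * x = - (2 * pi * x)); last by rewrite mulrN1z mulrN1; ring.
  by rewrite cosN sinN; apply: complex_eq; rewrite /w /w' /=; field.
have m c := multiplier_cst c cf.
apply: (multiplierD (p := fun=> _%:C) cf (m _)).
by apply: multiplierD => //; apply: (multiplierM (p := fun=> _ * _) (m _)); exact: multiplier_fexp.
Qed.

Lemma mean_step f (b : R) n : cint f -> (forall k, fourier f k = 0) ->
  mean (fun x => f x * (step b n x)%:C) = 0.
Proof.
move=> cf f0.
have k1 : kills f (fun=> 1).
  split; first exact: cmeas_cst.
    by exists 1 => x; rewrite Normc.normc1.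
  move=> k; rewrite -(f0 (- k)) /fourier opprK; congr mean; apply/funext => x.
  by rewrite mul1r.
have mq : multiplier f (fun x => (1 + (-1) * (sep b x)%:C ^+ n) ^+ (2 ^ n)).
  apply: (multiplierX _ cf); apply: multiplierD => //; first exact: multiplier_cst.
  apply: multiplierM; first exact: multiplier_cst.
  by apply: multiplierX => //; exact: multiplier_sep.
case: (mq _ k1) => _ _ /(_ 0) <-; congr mean; apply/funext => x.
rewrite fexp0 mulr1 mul1r; congr (_ * _).
by rewrite /step rmorphXn rmorphB rmorphXn rmorph1 mulN1r.
Qed.

(** The sign of sin (pi x) sin (pi (b - x)) tells on which side of b the point
    lies. *)
Lemma sepE (b x : R) : sep b x = 2^-1 - sin (pi * x) * sin (pi * (b - x)) / 2.
Proof.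
rewrite /sep (_ : 2 * pi * x - pi * b = pi * x - pi * (b - x)); last by ring.
rewrite (_ : pi * b = pi * x + pi * (b - x)); last by ring.
by rewrite cosB cosD; field.
Qed.

Lemma sep01 (b x : R) : 0 <= sep b x <= 1.
Proof.
rewrite /sep.
have := cos_le1 (2 * pi * x - pi * b); have := cos_geN1 (2 * pi * x - pi * b).
have := cos_le1 (pi * b); have := cos_geN1 (pi * b); lra.
Qed.

Lemma step01 (b x : R) n : 0 <= step b n x <= 1.
Proof.
have /andP[h0 h1] := sep01 b x.
have h2 : 0 <= 1 - sep b x ^+ n <= 1.
  by rewrite subr_ge0 exprn_ile1//= lerBlDr lerDl exprn_ge0.
case/andP: h2 => h2 h3.
by rewrite /step exprn_ge0//= exprn_ile1.
Qed.

Lemma bernoulli_le (a : R) m : 0 <= a <= 1 -> 1 - m%:R * a <= (1 - a) ^+ m.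
Proof.
case/andP=> a0 a1; elim: m => [|m IH]; first by rewrite mul0r expr0 subr0.
rewrite exprS; apply: le_trans (ler_wpM2l _ IH); last by rewrite subr_ge0.
rewrite -natr1; have : 0 <= m%:R * a ^+ 2 by rewrite mulr_ge0 ?sqr_ge0.
by rewrite expr2; lra.
Qed.

Lemma bernoulli_ge (a : R) m : 0 <= a <= 1 -> (1 - a) ^+ m * (m%:R * a) <= 1.
Proof.
case/andP=> a0 a1.
have h : 1 + m%:R * a <= (1 + a) ^+ m.
  elim: m => [|m IH]; first by rewrite mul0r addr0 expr0.
  rewrite exprS; apply: le_trans (ler_wpM2l _ IH); last by lra.
  rewrite -natr1; have : 0 <= m%:R * a ^+ 2 by rewrite mulr_ge0 ?sqr_ge0.
  by rewrite expr2; lra.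
apply: (@le_trans _ _ ((1 - a) ^+ m * (1 + a) ^+ m)).
  by apply: ler_wpM2l; [rewrite exprn_ge0// subr_ge0|lra].
rewrite -exprMn exprn_ile1//; nra.
Qed.

(** Bernoulli's inequality bounds the value from below by 1 - (2 q)^n with q <
    1/2. *)
Lemma step_cvg1 (b x : R) : 0 < x < b -> b < 1 -> step b n x @[n --> \oo] --> (1 : R).
Proof.
move=> /andP[x0 xb] b1.
have s1 : 0 < sin (pi * x).
  by apply: sin_gt0_pi; have := pi_gt0 R; nra.
have s2 : 0 < sin (pi * (b - x)).
  by apply: sin_gt0_pi; have := pi_gt0 R; nra.
have /andP[h0 h1] := sep01 b x.
have h2 : sep b x < 2^-1 by rewrite sepE; have := mulr_gt0 s1 s2; lra.
apply: (@squeeze_cvgr _ _ _ _ (fun n => 1 - (2 * sep b x) ^+ n) (fun=> 1)).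
- near=> n; have /andP[_ ->] := step01 b x n; rewrite andbT.
  rewrite exprMn -natrX; apply: bernoulli_le.
  by rewrite exprn_ge0//= exprn_ile1.
- rewrite -[X in _ --> X]subr0; apply: cvgB; first exact: cvg_cst.
  by apply: cvg_expr; rewrite ger0_norm; lra.
- exact: cvg_cst.
Unshelve. all: by end_near. Qed.

(** Here (1 - y)^m <= 1 / (m y), with y = q^n and m = 2^n, is at most (2 q)^(-n)
    with q > 1/2. *)
Lemma step_cvg0 (b x : R) : 0 < b -> b < x < 1 -> step b n x @[n --> \oo] --> (0 : R).
Proof.
move=> b0 /andP[xb x1].
have s1 : 0 < sin (pi * x).
  by apply: sin_gt0_pi; have := pi_gt0 R; nra.
have s2 : 0 < sin (pi * (x - b)).
  by apply: sin_gt0_pi; have := pi_gt0 R; nra.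
have /andP[h0 h1] := sep01 b x.
have h2 : 2^-1 < sep b x.
  rewrite sepE (_ : pi * (b - x) = - (pi * (x - b))); last by ring.
  by rewrite sinN; have := mulr_gt0 s1 s2; lra.
have p0 : 0 < 2 * sep b x by lra.
apply: (@squeeze_cvgr _ _ _ _ (fun=> 0) (fun n => (2 * sep b x)^-1 ^+ n)).
- near=> n; have /andP[-> _] /= := step01 b x n.
  rewrite exprVn -[leRHS]mul1r ler_pdivlMr ?exprn_gt0// exprMn -natrX.
  by apply: bernoulli_ge; rewrite exprn_ge0//= exprn_ile1.
- exact: cvg_cst.
- apply: cvg_expr; rewrite ger0_norm ?invr_ge0 ?ltW// invf_lt1//; lra.
Unshelve. all: by end_near. Qed.

Lemma ae_neq (c : R) : {ae mu, forall x : R, x <> c}.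
Proof.
exists [set c]; split; first exact: measurable_set1.
  exact: lebesgue_measure_set1.
by move=> x /= /contrapT.
Qed.

Lemma measurable_step (b : R) n : measurable_fun I (step b n).
Proof.
have ms : measurable_fun I (sep b).
  apply: measurable_funTS; apply: continuous_measurable_fun => x.
  apply: cvgB; first exact: cvg_cst.
  apply: cvgM; last exact: cvg_cst.
  apply: cvgB; last exact: cvg_cst.
  apply: continuous_comp; last exact: continuous_cos.
  apply: cvgB; last exact: cvg_cst.
  by apply: cvgM; [exact: cvg_cst|exact: cvg_id].
apply: measurable_funX; apply: measurable_funB; first exact: measurable_cst.
exact: measurable_funX.
Qed.

(** Dominated convergence along the trigonometric polynomials [step]. *)
Lemma int0_itv (phi : R -> R) (b : R) : mu.-integrable I (EFin \o phi) ->
  0 < b < 1 -> (forall n, \int[mu]_(x in I) (phi x * step b n x) = 0) ->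
  \int[mu]_(x in `[0, b]) phi x = 0.
Proof.
move=> ip /andP[b0 b1] h.
have mphi : measurable_fun I phi by case/integrableP: ip => /measurable_EFinP.
have mb : measurable (`[0, b] : set (measurableTypeR R)) by exact: measurable_itv.
have sub : (`[0, b] : set R) `<=` I.
  by move=> x /=; rewrite !in_itv/= => /andP[-> xb]; rewrite (le_trans xb)// ltW.
have ms n : measurable_fun I (fun x => phi x * step b n x).
  by apply: measurable_funM => //; exact: measurable_step.
have mlim : measurable_fun I (phi \_ `[0, b]).
  apply: (measurable_restrict phi mb (@measurable_circle R)).1.
  exact: (measurable_funS (@measurable_circle R) (@subIsetl _ _ _) mphi).
have is_ n : mu.-integrable I (EFin \o (fun x => phi x * step b n x)).
  apply: (integrable_dom (ms n) _ (integrable_norm ip)) => x _.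
  rewrite normrM ler_piMr//; have /andP[h0 h1] := step01 b x n.
  by rewrite ger0_norm.
have [|||||ilim _ hcv] := @dominated_convergence _ _ _ mu I (@measurable_circle R)
  (fun n x => (phi x * step b n x)%:E) (fun x => ((phi \_ `[0, b]) x)%:E)
  (fun x => `|phi x|%:E).
- by move=> n; exact/measurable_EFinP.
- exact/measurable_EFinP.
- have := ae_conj (ae_neq 0) (ae_conj (ae_neq b) (ae_neq 1)).
  apply: ae_weaken => x [/eqP x0 [/eqP xb /eqP x1]]; rewrite /= in_itv/= => /andP[x0' x1'].
  have {}x0 : 0 < x by rewrite lt_neqAle eq_sym x0.
  have {}x1 : x < 1 by rewrite lt_neqAle x1.
  apply: cvg_EFin; first by near=> n.
  rewrite /patch; have [xb'|xb'] := ltP x b.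
    rewrite mem_set/= ?in_itv/= ?(ltW x0) ?(ltW xb')//.
    rewrite -[X in _ --> X]mulr1; apply: cvgM; first exact: cvg_cst.
    by apply: step_cvg1 => //; rewrite x0.
  rewrite memNset/= ?in_itv/=; last first.
    by move=> /andP[_ h']; move: xb; rewrite eq_le h' xb'.
  rewrite -[X in _ --> X](mulr0 (phi x)); apply: cvgM; first exact: cvg_cst.
  by apply: step_cvg0 => //; rewrite x1 andbT lt_neqAle eq_sym xb.
- exact: integrable_norm ip.
- apply: aeW => x n _; rewrite lee_fin normrM ler_piMr//.
  by have /andP[h0 h1] := step01 b x n; rewrite ger0_norm.
have hc : (0%E : \bar R) @[n --> \oo] --> (\int[mu]_(x in I) ((phi \_ `[0, b]) x)%:E)%E.
  move: hcv; rewrite (_ : (fun n => _) = (fun=> 0%E))//.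
  apply/funext => n; have := h n; rewrite /Rintegral => h0.
  by rewrite -(fineK (integrable_fin_num (@measurable_circle R) (is_ n))) h0.
have e : (\int[mu]_(x in I) ((phi \_ `[0, b]) x)%:E = 0)%E.
  by apply: cvg_unique hc _ => //; exact: cvg_cst.
rewrite -[X in \int[mu]_(x in X) _](setIidr sub) Rintegral_mkcondr /Rintegral.
by rewrite e.
Unshelve. all: by end_near. Qed.

(** The primitive of phi vanishes on ]0, 1[, and its derivative is phi at every
    Lebesgue point. *)
Lemma ae0_of_int0 (phi : R -> R) : mu.-integrable I (EFin \o phi) ->
  (forall b, 0 < b < 1 -> \int[mu]_(x in `[0, b]) phi x = 0) ->
  {ae mu, forall x : R, I x -> phi x = 0}.
Proof.
move=> ip h; have := lebesgue_differentiation (integrable_locally (@measurable_circle R) ip).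
move=> hl; have := ae_conj hl (ae_conj (ae_neq 0) (ae_neq 1)).
apply: ae_weaken => x [lx [/eqP x0 /eqP x1]] Ix.
have Ix' := Ix; move: Ix'; rewrite /= in_itv/= => /andP[x0' x1'].
have {}x0 : 0 < x by rewrite lt_neqAle eq_sym x0.
have {}x1 : x < 1 by rewrite lt_neqAle x1.
have irestr : mu.-integrable [set` Interval (BLeft 0) (BRight 1)] (EFin \o (phi \_ I)).
  apply: eq_integrable ip; first exact: measurable_circle.
  by move=> y yI; rewrite /= /patch yI.
have phE : (phi \_ I) x = phi x by rewrite /patch mem_set.
have [|_] := @FTC1_lebesgue_pt R (phi \_ I) (BLeft 0) x 1 x1 irestr _ lx.
  by rewrite lte_fin.
rewrite phE => <-; rewrite derive1E.
rewrite (@near_eq_derive _ _ _ _ (fun=> 0)) ?derive_cst//.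
have : \forall y \near x, y \in `]0, 1[.
  by apply: near_in_itvoo; rewrite in_itv/= x0.
apply: filterS => y; rewrite in_itv/= => /andP[y0 y1].
rewrite -[RHS](h y) ?y0//; apply: eq_Rintegral => t; rewrite inE/= in_itv/= => /andP[t0 t1].
by rewrite /patch mem_set//= in_itv/= t0 (le_trans t1)// ltW.
Qed.

(** The integral of f against each polynomial [step] vanishes, hence so does its
    integral over each interval [0, b], and f is zero at almost every point. *)
Theorem fourier_inj f : circ_L2 f -> (forall k, fourier f k = 0) -> circ_eq f (fun=> 0).
Proof.
move=> Lf f0; have cf := circ_L2_int Lf; have [rf jf] := cf.
have E b n : mean (fun x => f x * (step b n x)%:C) =
    (\int[mu]_(x in I) (complex.Re (f x) * step b n x)) +i*
    (\int[mu]_(x in I) (complex.Im (f x) * step b n x)).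
  by apply: complex_eq; apply: eq_Rintegral => x _; rewrite ?cReM ?cImM /= ?mulr0 ?subr0 ?add0r.
have hR b : 0 < b < 1 -> \int[mu]_(x in `[0, b]) complex.Re (f x) = 0.
  move=> b01; apply: int0_itv => // n.
  by have := mean_step b n cf f0; rewrite E => -[].
have hI b : 0 < b < 1 -> \int[mu]_(x in `[0, b]) complex.Im (f x) = 0.
  move=> b01; apply: int0_itv => // n.
  by have := mean_step b n cf f0; rewrite E => -[].
have := ae_conj (ae0_of_int0 rf hR) (ae0_of_int0 jf hI).
apply: ae_weaken => x [h1 h2] Ix; apply: complex_eq; [exact: h1|exact: h2].
Qed.

Lemma L2_eq_Fser f : circ_L2 f -> csummable (fourier f) -> circ_eq f (Fser (fourier f)).
Proof.
move=> Lf sf; have LS := Fser_L2 sf.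
have : circ_eq (fun x => f x - Fser (fourier f) x) (fun=> 0).
  apply: fourier_inj; first exact: circ_L2B.
  move=> k; rewrite fourierB; [|exact: circ_L2_int..].
  by rewrite fourier_Fser// subrr.
by apply: ae_weaken => x h /h /eqP; rewrite subr_eq0 => /eqP.
Qed.

End FourierUniqueness.

(** * Derivatives and B^-1 on Fourier coefficients *)

Section WeakDerivative.
Variable R : realType.
Implicit Types (f g h : R -> R[i]) (k : int) (x : R) (a b : int -> R[i]).
Local Notation C := R[i].
Local Notation I := (`[0%R, 1%R]%classic : set (measurableTypeR R)).
Local Notation mu := (@lebesgue_measure R).

Definition ifreq k : C := 0 +i* freq R k.

Lemma nc_ifreq k : nc (ifreq k) = `|freq R k|.
Proof. by rewrite /= expr0n add0r sqrtr_sqr. Qed.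

Definition Dc a : int -> C := fun k => ifreq k * a k.

(** The function f is represented by its absolutely convergent Fourier series.
    Only equality almost everywhere can be asked, because the weak derivatives
    are chosen up to a null set. *)
Definition rep f a := [/\ cmeas f, circ_eq f (Fser a) & csummable a].

Lemma test_derive (phi : R -> R) x : test_function phi -> is_derive x 1 phi (derive1 phi x).
Proof.
move=> [_ /(_ 0%N x) h]; rewrite derive1E; exact: derivableP.
Qed.

Lemma test_cont (phi : R -> R) : test_function phi -> continuous phi.
Proof.
move=> tp x; apply: differentiable_continuous; apply/derivable1_diffP.
by case: tp => _ /(_ 0%N x).
Qed.

Lemma test_cont1 (phi : R -> R) : test_function phi -> continuous (derive1 phi).
Proof.
move=> [_ h] x; apply: differentiable_continuous; apply/derivable1_diffP.
exact: (h 1%N x).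
Qed.

Lemma continuous_bound (phi : R -> R) : continuous phi ->
  exists2 c, 0 <= c & forall x, I x -> nc (phi x)%:C <= c.
Proof.
move=> cphi.
have [||c cI hc] := @EVT_max R (fun x => `|phi x|) 0 1.
- exact: ler01.
- apply: continuous_subspaceT => x; apply: cvg_norm; exact: cphi.
exists `|phi c| => // x Ix; rewrite nc_real; apply: hc.
by rewrite /= in_itv in Ix *.
Qed.

Lemma cmeas_continuous (phi : R -> R) : continuous phi -> cmeas (fun x => (phi x)%:C).
Proof.
move=> cphi; apply: cmeas_real; apply: measurable_funTS.
exact: continuous_measurable_fun.
Qed.

(** Integration by parts on the circle: the boundary terms cancel by
    periodicity. *)
Lemma fexp_by_parts k (phi : R -> R) : test_function phi ->
  mean (fun x => fexp k x * (derive1 phi x)%:C) =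
  - (ifreq k * mean (fun x => fexp k x * (phi x)%:C)).
Proof.
move=> tp; have dp x := test_derive x tp.
have cp := test_cont tp; have cp1 := test_cont1 tp.
set c := freq R k.
have phi1 : phi 1 = phi 0 by case: tp => /(_ 0); rewrite add0r.
have [E1 E2] : cos c = 1 /\ sin c = 0.
  by have := @fexp_at1 R k; rewrite fexpE mulr1 => -[-> ->].
have cc : continuous (fun x : R => cos (c * x)) by exact: continuous_cosl.
have cs : continuous (fun x : R => sin (c * x)) by exact: continuous_sinl.
have icp : mu.-integrable I (EFin \o (fun x => cos (c * x) * phi x)).
  by apply: integrable_continuous => x; apply: cvgM; [exact: cc|exact: cp].
have isp : mu.-integrable I (EFin \o (fun x => sin (c * x) * phi x)).
  by apply: integrable_continuous => x; apply: cvgM; [exact: cs|exact: cp].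
have icp1 : mu.-integrable I (EFin \o (fun x => cos (c * x) * derive1 phi x)).
  by apply: integrable_continuous => x; apply: cvgM; [exact: cc|exact: cp1].
have isp1 : mu.-integrable I (EFin \o (fun x => sin (c * x) * derive1 phi x)).
  by apply: integrable_continuous => x; apply: cvgM; [exact: cs|exact: cp1].
have d1 x : is_derive x 1 (fun x => cos (c * x) * phi x)
    (cos (c * x) * derive1 phi x - c * (sin (c * x) * phi x)).
  have dc := is_derive_cosl c x.
  by apply: is_derive_eq; rewrite /GRing.scale/=; ring.
have d2 x : is_derive x 1 (fun x => sin (c * x) * phi x)
    (sin (c * x) * derive1 phi x + c * (cos (c * x) * phi x)).
  have dc := is_derive_sinl c x.
  by apply: is_derive_eq; rewrite /GRing.scale/=; ring.
have h1 : \int[mu]_(x in I) (cos (c * x) * derive1 phi x - c * (sin (c * x) * phi x)) = 0.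
  rewrite (Rintegral_derive d1); first by rewrite mulr1 mulr0 cos0 E1 phi1 subrr.
  move=> x; apply: cvgB; first by apply: cvgM; [exact: cc|exact: cp1].
  by apply: cvgM; [exact: cvg_cst|apply: cvgM; [exact: cs|exact: cp]].
have h2 : \int[mu]_(x in I) (sin (c * x) * derive1 phi x + c * (cos (c * x) * phi x)) = 0.
  rewrite (Rintegral_derive d2); first by rewrite mulr1 mulr0 sin0 E2 !mul0r subrr.
  move=> x; apply: cvgD; first by apply: cvgM; [exact: cs|exact: cp1].
  by apply: cvgM; [exact: cvg_cst|apply: cvgM; [exact: cc|exact: cp]].
have M (psi : R -> R) : mean (fun x => fexp k x * (psi x)%:C) =
    (\int[mu]_(x in I) (cos (c * x) * psi x)) +i*
    (\int[mu]_(x in I) (sin (c * x) * psi x)).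
  apply: complex_eq; apply: eq_Rintegral => x _; rewrite ?cReM ?cImM /= mulr0 ?subr0 ?add0r//.
rewrite !M.
move: h1 h2; rewrite RintegralB; [|exact: measurable_circle|exact: icp1|]; last first.
  by have := integrableZl (@measurable_circle R) c isp; apply: eq_integrable => //; exact: measurable_circle.
rewrite RintegralD; [|exact: measurable_circle|exact: isp1|]; last first.
  by have := integrableZl (@measurable_circle R) c icp; apply: eq_integrable => //; exact: measurable_circle.
rewrite !RintegralZl//; try exact: measurable_circle.
move/eqP; rewrite subr_eq0 => /eqP h1 /eqP; rewrite addr_eq0 => /eqP h2.
by apply: complex_eq; rewrite ?cReN ?cImN ?cReM ?cImM /= -/c ?h1 ?h2; ring.
Qed.

Lemma is_Dx_Fser f a : rep f a -> csummable (Dc a) -> is_Dx f (Fser (Dc a)).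
Proof.
move=> [mf fa sa] sD; split; first exact: Fser_L2.
move=> phi tp.
have cp := test_cont tp; have cp1 := test_cont1 tp.
have mp := cmeas_continuous cp; have mp1 := cmeas_continuous cp1.
have [c c0 hc] := continuous_bound cp; have [d d0 hd] := continuous_bound cp1.
transitivity (mean (fun x => Fser a x * (derive1 phi x)%:C)).
  apply: mean_ae; [exact: cmeasM|by apply: cmeasM => //; exact: cmeas_Fser|].
  by apply: circ_eqM => //; exact: circ_eqP.
rewrite (mean_Fser_mul sa mp1 d0 hd) (mean_Fser_mul sD mp c0 hc) -csumN.
apply: eq_csum => k; rewrite fexp_by_parts// /Dc; ring.
Qed.

Lemma is_derive_trig (c A B x : R) :
  is_derive x 1 (fun y => A * cos (c * y) + B * sin (c * y))
    ((B * c) * cos (c * x) + (- (A * c)) * sin (c * x)).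
Proof.
have h1 := is_derive_cosl c x; have h2 := is_derive_sinl c x.
by apply: is_derive_eq; rewrite /GRing.scale/=; ring.
Qed.

Lemma derive1n_trig (c A B : R) n : exists A' B',
  derive1n n (fun y : R => A * cos (c * y) + B * sin (c * y)) =
  (fun y : R => A' * cos (c * y) + B' * sin (c * y)).
Proof.
elim: n A B => [|n IH] A B; first by exists A, B.
rewrite derive1Sn (_ : derive1 _ = (fun y => (B * c) * cos (c * y) + (- (A * c)) * sin (c * y))).
  exact: IH.
apply/funext => x; rewrite derive1E; have := is_derive_trig c A B x => h.
exact: derive_val.
Qed.

Lemma test_trig k (A B : R) :
  test_function (fun y : R => A * cos (freq R k * y) + B * sin (freq R k * y)).
Proof.
split.
  by move=> x; have := @fexp_periodic R k x; rewrite !fexpE => -[-> ->].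
move=> n x; have [A' [B' ->]] := derive1n_trig (freq R k) A B n.
by have := is_derive_trig (freq R k) A' B' x; case.
Qed.

Lemma cint_real_mul f (psi : R -> R) : cint f -> continuous psi ->
  cint (fun x => f x * (psi x)%:C).
Proof.
move=> cf cp; have [c c0 hc] := continuous_bound cp.
by apply: (cint_mulb (c := c)) => //; exact: cmeas_continuous.
Qed.

Lemma fourier_trig f k : cint f -> fourier f k =
  mean (fun x => f x * (cos (freq R k * x))%:C) -
  'i%C * mean (fun x => f x * (sin (freq R k * x))%:C).
Proof.
move=> cf.
have i1 := cint_real_mul cf (@continuous_cosl R (freq R k)).
have i2 := cint_real_mul cf (@continuous_sinl R (freq R k)).
rewrite -meanZ// -meanB//; last exact: cintZ.
congr mean; apply/funext => x; rewrite fexpE.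
have -> : freq R (- k) * x = - (freq R k * x) by rewrite /freq mulrNz; ring.
rewrite cosN sinN; apply: complex_eq; rewrite ?cReD ?cImD ?cReN ?cImN ?cReM ?cImM/= ?cReM ?cImM /=; ring.
Qed.

(** The trigonometric functions of the given frequency are test functions, so
    the coefficient of a weak derivative can be read from its definition. *)
Lemma fourier_is_Dx f g k : cint f -> is_Dx f g -> fourier g k = Dc (fourier f) k.
Proof.
move=> cf [Lg h]; have cg := circ_L2_int Lg; set c := freq R k.
have i1 := cint_real_mul cf (@continuous_cosl R c).
have i2 := cint_real_mul cf (@continuous_sinl R c).
have E1 : mean (fun x => g x * (cos (c * x))%:C) = c%:C * mean (fun x => f x * (sin (c * x))%:C).
  have := h _ (test_trig k 1 0).
  rewrite (_ : (fun x => f x * _) = (fun x => (- c%:C) * (f x * (sin (c * x))%:C))); last first.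
    apply/funext => x; rewrite derive1E; have := is_derive_trig c 1 0 x => hx.
    rewrite derive_val mul0r mul0r add0r mul1r mulNr rmorphN rmorphM/=; ring.
  rewrite meanZ// mulNr => /oppr_inj ->; congr mean; apply/funext => x.
  by rewrite mul1r mul0r addr0.
have E2 : mean (fun x => g x * (sin (c * x))%:C) = - c%:C * mean (fun x => f x * (cos (c * x))%:C).
  have := h _ (test_trig k 0 1).
  rewrite (_ : (fun x => f x * _) = (fun x => c%:C * (f x * (cos (c * x))%:C))); last first.
    apply/funext => x; rewrite derive1E; have := is_derive_trig c 0 1 x => hx.
    rewrite derive_val !mul0r oppr0 mul0r addr0 mul1r rmorphM/=; ring.
  rewrite meanZ// mulNr => ->; rewrite opprK; congr mean; apply/funext => x.
  by rewrite mul1r mul0r add0r.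
rewrite fourier_trig// E1 E2 /Dc fourier_trig// -/c.
have -> : ifreq k = 'i%C * c%:C by apply: complex_eq; rewrite ?cReM ?cImM /= /c; ring.
have i2' : 'i%C * 'i%C = -1 :> C by rewrite -expr2 sqr_i.
rewrite mulrBr.
have -> : 'i%C * c%:C * ('i%C * mean (fun x => f x * (sin (c * x))%:C)) =
  ('i%C * 'i%C) * (c%:C * mean (fun x => f x * (sin (c * x))%:C)) by ring.
rewrite i2'; ring.
Qed.

Lemma rep_Fser a : csummable a -> rep (Fser a) a.
Proof. by move=> sa; split => //; [exact: cmeas_Fser|exact: circ_eqP]. Qed.

Lemma rep_L2 f : circ_L2 f -> csummable (fourier f) -> rep f (fourier f).
Proof. by move=> Lf sf; split => //; [exact: circ_L2_meas|exact: L2_eq_Fser]. Qed.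

Lemma rep_fourier f a : rep f a -> fourier f = a.
Proof.
move=> [mf fa sa]; apply/funext => k; rewrite -[RHS](fourier_Fser k sa).
by apply: fourier_ae => //; exact: cmeas_Fser.
Qed.

(** A weak derivative exists, namely the differentiated series; the chosen one
    has the same coefficients, hence is equal to it. *)
Lemma Dx_rep f a : rep f a -> csummable (Dc a) -> rep (Dx f) (Dc a).
Proof.
move=> ra sD.
have [LD hD] : is_Dx f (Dx f).
  by apply: (@xgetPex _ (fun=> 0) [set g | is_Dx f g]); exists (Fser (Dc a)); exact: is_Dx_Fser.
case: (ra) => mf fa sa.
have DS : is_Dx (Fser a) (Dx f).
  split=> // phi tp; rewrite -hD//; apply: mean_ae.
  - by apply: cmeasM; [exact: cmeas_Fser|exact/cmeas_continuous/test_cont1].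
  - by apply: cmeasM => //; exact/cmeas_continuous/test_cont1.
  - by apply: circ_eqM; [exact: circ_eq_sym|exact: circ_eqP].
have E : fourier (Dx f) = Dc a.
  apply/funext => k; rewrite (fourier_is_Dx _ _ DS); last exact/circ_L2_int/Fser_L2.
  by rewrite /Dc fourier_Fser.
by rewrite -E; apply: rep_L2 => //; rewrite E.
Qed.

Lemma repD f g a b : rep f a -> rep g b -> rep (fun x => f x + g x) (fun k => a k + b k).
Proof.
move=> [mf fa sa] [mg gb sb]; split; [exact: cmeasD| |exact: csummableD].
apply: circ_eq_trans (circ_eqD fa gb) _; apply: circ_eqP => x _.
by rewrite Fser_add.
Qed.

Lemma repM f g a b : rep f a -> rep g b -> rep (fun x => f x * g x) (cconv a b).
Proof.
move=> [mf fa sa] [mg gb sb]; split; [exact: cmeasM| |exact: csummable_cconv].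
apply: circ_eq_trans (circ_eqM fa gb) _; apply: circ_eqP => x _.
by rewrite Fser_mul.
Qed.

Lemma repZ c f a : rep f a -> rep (fun x => c * f x) (fun k => c * a k).
Proof.
move=> [mf fa sa]; split; [exact: cmeasZ| |exact: csummableZ].
apply: circ_eq_trans (circ_eqM (circ_eqP (fun x _ => erefl c)) fa) _.
by apply: circ_eqP => x _; rewrite Fser_scale.
Qed.

Lemma rep_eq f g a b : rep f a -> (forall x, f x = g x) -> (forall k, a k = b k) -> rep g b.
Proof. by move=> ra /funext <- /funext <-. Qed.

(** The value at 0 is 1 because B is the identity on constants. *)
Definition Binv_symb k : C := if k == 0 then 1 else (Bsymb R k)^-1.

Lemma Binv_rep f a : rep f a -> csummable (fun k => Binv_symb k * a k) ->
  rep (Binv f) (fun k => Binv_symb k * a k).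
Proof.
move=> ra sB; have fE := rep_fourier ra.
apply: rep_eq (rep_Fser sB) _ _ => // x; rewrite /Fser -limC_sym_sum; last exact: Fser_summable.
rewrite /Binv fE /Binv_symb eqxx mul1r fexp0 mulr1; congr (_ + limC _).
apply/funext => N; rewrite big_nat_cond [RHS]big_nat_cond; apply: eq_bigr => k.
rewrite andbT => /andP[k1 _].
have -> : (k%:Z == 0) = false by lia.
have -> : (- k%:Z == 0) = false by lia.
by rewrite ![_^-1 * _]mulrC.
Qed.

End WeakDerivative.

(** * The equation on Fourier coefficients *)

Section Kernel.
Variable R : realType.
Implicit Types (f g v : R -> R[i]) (j k l : int) (x : R) (a b : int -> R[i]).
Local Notation C := R[i].

Definition ab k : R := `|k%:~R|.

Lemma ab_ge0 k : 0 <= ab k. Proof. exact: normr_ge0. Qed.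

Lemma abD j k : ab (j + k) <= ab j + ab k.
Proof. by rewrite /ab intrD ler_normD. Qed.

Lemma ab_ge1 k : k != 0 -> 1 <= ab k.
Proof.
move=> k0; rewrite /ab -intr_norm (ler1z R); lia.
Qed.

Lemma nc_ifreqE k : nc (ifreq R k) = 2 * pi * ab k.
Proof.
rewrite nc_ifreq /freq /ab !normrM (ger0_norm (pi_ge0 R)) (ger0_norm (ler0n R 2)).
by ring.
Qed.

(** The power 3 is the number of derivatives in the nonlinear terms, and also
    the gain of d/dx B^-1. *)
Definition weight (rho : R) k : R := (1 + ab k) ^+ 3 * expR (2 * pi * rho * ab k).

Lemma weight_gt0 rho k : 0 < weight rho k.
Proof. by rewrite mulr_gt0 ?expR_gt0// exprn_gt0// ltr_pwDl ?ab_ge0. Qed.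

Lemma weight_ge0 rho k : 0 <= weight rho k. Proof. exact/ltW/weight_gt0. Qed.

Lemma weight_ge rho k : 0 <= rho -> (1 + ab k) ^+ 3 <= weight rho k.
Proof.
move=> r0; rewrite /weight ler_peMr ?exprn_ge0 ?addr_ge0 ?ab_ge0//.
by rewrite -expR0 ler_expR !mulr_ge0 ?pi_ge0 ?ab_ge0.
Qed.

Lemma weight_ge1 rho k : 0 <= rho -> 1 <= weight rho k.
Proof.
by move=> r0; apply: le_trans (weight_ge k r0); rewrite exprn_ege1// lerDl ab_ge0.
Qed.

Lemma weight_mono rho rho' k : rho <= rho' -> weight rho k <= weight rho' k.
Proof.
move=> h; rewrite /weight ler_wpM2l ?exprn_ge0 ?addr_ge0 ?ab_ge0// ler_expR.
by rewrite ler_wpM2r ?ab_ge0// ler_wpM2l// mulr_ge0 ?pi_ge0.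
Qed.

Lemma weight_submul rho j l : 0 <= rho -> weight rho (j + l) <= weight rho j * weight rho l.
Proof.
move=> r0; rewrite /weight [leRHS]mulrACA -exprMn -expRD -mulrDr.
have aj := ab_ge0 j; have al := ab_ge0 l; have ajl := abD j l.
have h0 : 0 <= 1 + ab (j + l) by rewrite addr_ge0 ?ab_ge0.
apply: ler_pM; rewrite ?exprn_ge0 ?expR_ge0//.
  have := mulr_ge0 aj al => ajl0.
  by rewrite lerXn2r// ?nnegrE; nra.
by rewrite ler_expR ler_wpM2l// !mulr_ge0 ?pi_ge0.
Qed.

(** From 1 + x <= e^x: a derivative costs the inverse of the gap between two
    radii. *)
Lemma weight_gap rho rho' k : rho < rho' -> rho' <= rho + 1 ->
  (1 + ab k) * weight rho k <= (rho' - rho)^-1 * weight rho' k.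
Proof.
move=> h h1; have d0 : 0 < rho' - rho by rewrite subr_gt0.
rewrite ler_pdivlMl//.
rewrite (_ : (rho' - rho) * ((1 + ab k) * weight rho k) = (1 + ab k) ^+ 3 * ((rho' - rho) * (1 + ab k) * expR (2 * pi * rho * ab k))); last first.
  by rewrite /weight; ring.
rewrite ler_wpM2l ?exprn_ge0 ?addr_ge0 ?ab_ge0//.
rewrite -[X in _ <= expR X](subrK (2 * pi * rho * ab k)) expRD ler_wpM2r ?expR_ge0//.
apply: le_trans (expR_ge1Dx _).
have pi2 : 2 <= pi :> R by exact: pi_ge2.
have a0 := ab_ge0 k.
have -> : 2 * pi * rho' * ab k - 2 * pi * rho * ab k = 2 * pi * ((rho' - rho) * ab k) by ring.
have : 0 <= (rho' - rho) * ab k by rewrite mulr_ge0// ltW.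
rewrite mulrDr mulr1; nra.
Qed.

Definition nrm (rho : R) a : \bar R := es (fun k => (weight rho k * nc (a k))%:E).
Definition nrm1 (rho : R) a : \bar R := es (fun k => ((1 + ab k) * weight rho k * nc (a k))%:E).

Lemma nrm_ge0 rho a : (0 <= nrm rho a)%E.
Proof. by apply: es_ge0 => k; rewrite lee_fin mulr_ge0 ?weight_ge0 ?nc_ge0. Qed.

Lemma nrm_term rho a k : ((weight rho k * nc (a k))%:E <= nrm rho a)%E.
Proof.
apply: (term_le_es (f := fun k => (weight rho k * nc (a k))%:E)) => i.
by rewrite lee_fin mulr_ge0 ?weight_ge0 ?nc_ge0.
Qed.

Lemma nrm_mono rho rho' a : rho <= rho' -> (nrm rho a <= nrm rho' a)%E.
Proof.
move=> h; apply: le_es => k; rewrite lee_fin ler_wpM2r ?nc_ge0//; exact: weight_mono.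
Qed.

Lemma nrm1_gap rho rho' a (A : R) : rho < rho' -> rho' <= rho + 1 ->
  (nrm rho' a <= A%:E)%E -> (nrm1 rho a <= ((rho' - rho)^-1 * A)%:E)%E.
Proof.
move=> h h1 hA; have d0 : 0 <= (rho' - rho)^-1 by rewrite invr_ge0 subr_ge0 ltW.
apply: (@le_trans _ _ ((rho' - rho)^-1%:E * nrm rho' a)%E); last first.
  by rewrite EFinM lee_wpmul2l.
rewrite /nrm -esZ//; last by move=> k; rewrite lee_fin mulr_ge0 ?weight_ge0 ?nc_ge0.
apply: le_es => k; rewrite -EFinM lee_fin [leRHS]mulrA ler_wpM2r ?nc_ge0//.
exact: weight_gap.
Qed.

Lemma pow_le3 (x : R) i : 0 <= x -> (i <= 3)%N -> x ^+ i <= (1 + x) ^+ 3.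
Proof.
move=> x0 i3; apply: (@le_trans _ _ ((1 + x) ^+ i)).
  by rewrite lerXn2r ?nnegrE ?addr_ge0//; lra.
by apply: ler_weXn2l => //; rewrite lerDl.
Qed.

Definition Dc_iter n a : int -> C := iter n (@Dc R) a.

Lemma Dc_iterE n a k : Dc_iter n a k = ifreq R k ^+ n * a k.
Proof.
elim: n => [|n IH]; first by rewrite expr0 mul1r.
by rewrite /Dc_iter iterS /Dc -/(Dc_iter n a) IH exprS mulrA.
Qed.

Lemma csummable_Dc_iter n a rho : 0 <= rho -> (n <= 3)%N -> (nrm rho a < +oo)%E ->
  csummable (Dc_iter n a).
Proof.
move=> r0 n3 sa; pose c : R := (2 * pi) ^+ n.
have c0 : 0 <= c by rewrite exprn_ge0// mulr_ge0// pi_ge0.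
apply: (csummable_le (g := fun k => c * (weight rho k * nc (a k)))).
  move=> k; rewrite Dc_iterE Normc.normcM ncX nc_ifreqE exprMn -mulrA.
  rewrite ler_wpM2l// ler_wpM2r ?nc_ge0//.
  by apply: le_trans (pow_le3 (ab_ge0 k) n3) (weight_ge k r0).
rewrite (eq_es (g := fun k => (c%:E * (weight rho k * nc (a k))%:E)%E))//.
rewrite esZ//; last by move=> k; rewrite lee_fin mulr_ge0 ?weight_ge0 ?nc_ge0.
by apply: lte_mul_pinfty => //; rewrite lee_fin.
Qed.

Lemma nrm_csummable a rho : 0 <= rho -> (nrm rho a < +oo)%E -> csummable a.
Proof. by move=> r0; exact: (@csummable_Dc_iter 0 a rho). Qed.

(** The symbol of d/dx B^-1. *)
Definition DBinv_symb k : C := ifreq R k * Binv_symb R k.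

Lemma nc_Bsymb k : nc (Bsymb R k) = (2 * pi * ab k) ^+ 2 + (2 * pi * ab k) ^+ 4.
Proof.
have e : (2 * pi * k%:~R : R) ^+ 2 = (2 * pi * ab k) ^+ 2.
  by rewrite /ab !exprMn real_normK ?num_real.
rewrite /Bsymb nc_real ger0_norm; last by rewrite addr_ge0 ?exprn_even_ge0.
by rewrite -[4%N]/(2 * 2)%N !exprM e.
Qed.

Lemma twopi_ge1 : 1 <= 2 * pi :> R.
Proof. by have := pi_ge2 R; lra. Qed.

Lemma Binv_symb_le1 k : nc (Binv_symb R k) <= 1.
Proof.
rewrite /Binv_symb; case: eqP => [_|/eqP k0]; first by rewrite Normc.normc1.
rewrite Normc.normcV nc_Bsymb invf_le1.
  have h : 1 <= 2 * pi * ab k by rewrite mulr_ege1 ?twopi_ge1 ?ab_ge1.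
  by have := exprn_ege1 2 h; have := exprn_ege1 4 h; lra.
have h : 0 < 2 * pi * ab k by apply: lt_le_trans ltr01 _; rewrite mulr_ege1 ?twopi_ge1 ?ab_ge1.
by rewrite addr_gt0 ?exprn_gt0.
Qed.

(** For k <> 0 the symbol is a quotient of |2 pi k| by (2 pi k)^2 + (2 pi k)^4,
    so it is at most |2 pi k|^(-3). *)
Lemma DBinv_symb_bnd k : (1 + ab k) ^+ 3 * nc (DBinv_symb k) <= 8.
Proof.
rewrite /DBinv_symb Normc.normcM nc_ifreqE /Binv_symb; case: eqP => [->|/eqP k0].
  by rewrite /ab normr0 mulr0 mul0r mulr0.
rewrite Normc.normcV nc_Bsymb.
have k1 := ab_ge1 k0; set n := ab k in k1 *; set P := 2 * pi.
have P1 : 1 <= P := twopi_ge1.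
have q1 : 1 <= P * n by rewrite mulr_ege1.
have q0 : 0 < P * n by lra.
rewrite mulrA ler_pdivrMr; last by rewrite addr_gt0 ?exprn_gt0.
have e1 : (1 + n) ^+ 3 <= 8 * n ^+ 3.
  have -> : 8 * n ^+ 3 = (n + n) ^+ 3 by ring.
  by rewrite lerXn2r ?nnegrE; lra.
have e2 : n ^+ 3 <= (P * n) ^+ 3.
  by rewrite lerXn2r ?nnegrE ?(ltW q0)//; [lra|rewrite ler_peMl//; lra].
apply: (@le_trans _ _ (8 * (P * n) ^+ 4)).
  rewrite [(P * n) ^+ 4]exprSr [leRHS]mulrA ler_wpM2r ?(ltW q0)//.
  by apply: le_trans e1 _; rewrite ler_wpM2l.
by rewrite ler_wpM2l// lerDr exprn_ge0// ltW.
Qed.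

Lemma DBinv_symb_le k : nc (DBinv_symb k) <= 8.
Proof.
apply: le_trans (DBinv_symb_bnd k); rewrite ler_peMl ?nc_ge0// exprn_ege1// lerDl ab_ge0//.
Qed.

(** The bilinear symbol of 2 mu(u) u + u_x^2 / 2 - 3 u_x u_xxx - 7/2 u_xx^2; the
    frequency j = 0 on the first factor selects the mean value. *)
Definition nonlin_symb j l : C := (if j == 0 then 2 else 0) + 2^-1 * (ifreq R j * ifreq R l)
  - 3 * (ifreq R j * ifreq R l ^+ 3) - 7 / 2 * (ifreq R j ^+ 2 * ifreq R l ^+ 2).

(** The symbol of - u u_x - d/dx B^-1 [...], with the derivative of the first
    term on the second factor. *)
Definition kern j l : C := - (ifreq R l + DBinv_symb (j + l) * nonlin_symb j l).

Definition K1 : R := 2 + (2 * pi) ^+ 2 + 3 * (2 * pi) ^+ 4 + 4 * (2 * pi) ^+ 4.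
Definition K0 : R := 2 * pi + 8 * K1.

Lemma K1_ge0 : 0 <= K1.
Proof. by rewrite /K1 !addr_ge0 ?mulr_ge0 ?exprn_ge0 ?pi_ge0. Qed.

Lemma K0_gt0 : 0 < K0.
Proof. by rewrite /K0 ltr_wpDr ?mulr_ge0 ?K1_ge0// mulr_gt0 ?pi_gt0. Qed.

Lemma nc_comb (z1 z2 z3 z4 : C) : nc (z1 + 2^-1 * z2 - 3 * z3 - 7 / 2 * z4) <=
  nc z1 + 2^-1 * nc z2 + 3 * nc z3 + 7 / 2 * nc z4.
Proof.
have n2 : nc (2^-1 : C) = 2^-1 by rewrite Normc.normcV (nc_nat R 2).
have n7 : nc (7 / 2 : C) = 7 / 2.
  by rewrite Normc.normcM n2 (nc_nat R 7).
apply: le_trans (le_normcD _ _) _; rewrite normcN [nc (7 / 2 * _)]Normc.normcM n7 lerD2r.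
apply: le_trans (le_normcD _ _) _; rewrite normcN [nc (3 * _)]Normc.normcM (nc_nat R 3) lerD2r.
by apply: le_trans (le_normcD _ _) _; rewrite [nc (2^-1 * _)]Normc.normcM n2.
Qed.

Lemma nonlin_symb_bnd j l : nc (nonlin_symb j l) <= K1 * ((1 + ab j) ^+ 3 * (1 + ab l) ^+ 3).
Proof.
set W := (1 + ab j) ^+ 3 * _.
have W1 : 1 <= W by rewrite mulr_ege1// exprn_ege1// lerDl ab_ge0.
have key p q : (p <= 3)%N -> (q <= 3)%N ->
    nc (ifreq R j ^+ p * ifreq R l ^+ q) <= (2 * pi) ^+ (p + q) * W.
  move=> p3 q3; rewrite Normc.normcM !ncX !nc_ifreqE.
  have : 0 <= 2 * pi :> R by rewrite mulr_ge0 ?pi_ge0.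
  move: (2 * pi) => P P0; rewrite !exprMn mulrACA -exprD ler_wpM2l ?exprn_ge0//.
  by rewrite ler_pM ?exprn_ge0 ?ab_ge0// pow_le3 ?ab_ge0.
have t1 : nc (if j == 0 then 2 else 0 : C) <= 2 * W.
  case: ifP => _; last by rewrite Normc.normc0; lra.
  by rewrite (nc_nat R 2); lra.
have t2 := key 1%N 1%N erefl erefl.
have t3 := key 1%N 3%N erefl erefl.
have t4 := key 2%N 2%N erefl erefl.
rewrite !expr1 in t2 t3; rewrite /nonlin_symb; apply: le_trans (nc_comb _ _ _ _) _.
have -> : K1 * W = 2 * W + (2 * pi) ^+ 2 * W + 3 * ((2 * pi) ^+ 4 * W) + 4 * ((2 * pi) ^+ 4 * W).
  by rewrite /K1; ring.
have g2 := nc_ge0 (ifreq R j * ifreq R l).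
have g4 := nc_ge0 (ifreq R j ^+ 2 * ifreq R l ^+ 2).
move: (nc _) (nc _) (nc _) (nc _) g2 g4 t1 t2 t3 t4 => n1 n2 n3 n4 g2 g4 t1 t2 t3 t4.
move: ((2 * pi) ^+ (1 + 1) * W) ((2 * pi) ^+ (1 + 3) * W) ((2 * pi) ^+ (2 + 2) * W) t2 t3 t4 => M0 M M1 t2 t3 t4.
lra.
Qed.

(** The nonlocal part loses nothing: its three derivatives on each factor go
    into the weights of j and l, and those of j + l into the gain of d/dx B^-1.
    The term u u_x loses the factor 1 + |l|. *)
Lemma kern_bnd rho j l : 0 <= rho ->
  weight rho (j + l) * nc (kern j l) <= K0 * (weight rho j * ((1 + ab l) * weight rho l)).
Proof.
move=> r0; set E := weight rho j * weight rho l.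
have E0 : 0 <= E by rewrite mulr_ge0 ?weight_ge0.
have al := ab_ge0 l.
have p0 := pi_ge0 R.
apply: (@le_trans _ _ (2 * pi * ab l * E + 8 * K1 * E)); last first.
  rewrite /K0 (_ : weight rho j * _ = (1 + ab l) * E); last by rewrite /E; ring.
  have := K1_ge0 => k1.
  have : 0 <= pi * E by rewrite mulr_ge0.
  have : 0 <= K1 * (ab l * E) by rewrite mulr_ge0// mulr_ge0.
  nra.
rewrite /kern normcN; apply: (@le_trans _ _ (weight rho (j + l) * (nc (ifreq R l) + nc (DBinv_symb (j + l) * nonlin_symb j l)))).
  by rewrite ler_wpM2l ?weight_ge0// le_normcD.
rewrite mulrDr; apply: lerD.
  by rewrite nc_ifreqE mulrC ler_wpM2l ?weight_submul// !mulr_ge0.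
rewrite Normc.normcM /weight.
set ejl := expR _.
have hm := DBinv_symb_bnd (j + l).
have hN := nonlin_symb_bnd j l.
have hexp : ejl <= expR (2 * pi * rho * ab j) * expR (2 * pi * rho * ab l).
  by rewrite -expRD -mulrDr ler_expR ler_wpM2l ?abD// !mulr_ge0.
rewrite (_ : (1 + ab (j + l)) ^+ 3 * ejl * (nc (DBinv_symb (j + l)) * nc (nonlin_symb j l)) =
  ((1 + ab (j + l)) ^+ 3 * nc (DBinv_symb (j + l))) * (nc (nonlin_symb j l) * ejl)); last by ring.
rewrite (_ : 8 * K1 * E = 8 * ((K1 * ((1 + ab j) ^+ 3 * (1 + ab l) ^+ 3)) *
  (expR (2 * pi * rho * ab j) * expR (2 * pi * rho * ab l)))); last first.
  by rewrite /E /weight; ring.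
apply: ler_pM => //.
- by rewrite mulr_ge0 ?exprn_ge0 ?addr_ge0 ?ab_ge0 ?nc_ge0.
- by rewrite mulr_ge0 ?nc_ge0 ?expR_ge0.
- by apply: ler_pM => //; rewrite ?nc_ge0 ?expR_ge0.
Qed.

Definition Gam a b k : C := csum (fun j => kern j (k - j) * a j * b (k - j)).

(** Stated for the double sum, because it also provides the summability needed
    to exchange sums. *)
Lemma Gam_es rho a b (A B : R) : 0 <= rho -> (nrm rho a <= A%:E)%E ->
  (nrm1 rho b <= B%:E)%E ->
  (es (fun k => es (fun j => (weight rho k * nc (kern j (k - j)%R * a j * b (k - j)%R))%:E)) <= (K0 * A * B)%:E)%E.
Proof.
move=> r0 hA hB.
pose p j := (weight rho j * nc (a j))%:E.
pose q l := ((1 + ab l) * weight rho l * nc (b l))%:E.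
have p0 l : (0 <= p l)%E by rewrite lee_fin mulr_ge0 ?weight_ge0 ?nc_ge0.
have q0 l : (0 <= q l)%E.
  by rewrite lee_fin !mulr_ge0 ?weight_ge0 ?nc_ge0// addr_ge0 ?ab_ge0.
have K00 := ltW K0_gt0.
apply: (@le_trans _ _ (es (fun k => K0%:E * es (fun j => p j * q (k - j)%R))))%E.
  apply: le_es => k; rewrite -esZ//; last by move=> j; rewrite mule_ge0.
  apply: le_es => j; rewrite -!EFinM lee_fin !Normc.normcM.
  have := @kern_bnd rho j (k - j) r0; rewrite subrKC => h.
  have n1 := nc_ge0 (a j); have n2 := nc_ge0 (b (k - j)).
  have := ler_wpM2r (mulr_ge0 n1 n2) h; rewrite !mulrA.
  congr (_ <= _); ring.
rewrite esZ//; last by move=> k; apply: es_ge0 => j; rewrite mule_ge0.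
rewrite es_prod//; last first.
  by rewrite ge0_fin_numE ?es_ge0//; apply: le_lt_trans hB _; rewrite ltry.
rewrite -mulrA EFinM lee_wpmul2l// EFinM; apply: lee_pmul => //; exact: es_ge0.
Qed.

Lemma Gam_bnd rho a b (A B : R) : 0 <= rho -> (nrm rho a <= A%:E)%E ->
  (nrm1 rho b <= B%:E)%E -> (nrm rho (Gam a b) <= (K0 * A * B)%:E)%E.
Proof.
move=> r0 hA hB; apply: le_trans (Gam_es r0 hA hB); apply: le_es => k.
rewrite (eq_es (g := fun j => (weight rho k)%:E * (nc (kern j (k - j)%R * a j * b (k - j)%R))%:E)%E)//.
rewrite esZ ?weight_ge0//; last by move=> j; rewrite lee_fin nc_ge0.
by rewrite EFinM lee_wpmul2l ?lee_fin ?weight_ge0//; exact: nc_csum.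
Qed.

Lemma Gam_summable rho a b (A B : R) k : 0 <= rho -> (nrm rho a <= A%:E)%E ->
  (nrm1 rho b <= B%:E)%E -> csummable (fun j => kern j (k - j) * a j * b (k - j)).
Proof.
move=> r0 hA hB.
have F0 k' : (0 <= es (fun j => (weight rho k' * nc (kern j (k' - j)%R * a j * b (k' - j)%R))%:E))%E.
  by apply: es_ge0 => j; rewrite lee_fin mulr_ge0 ?weight_ge0 ?nc_ge0.
apply: (csummable_le (g := fun j => weight rho k * nc (kern j (k - j) * a j * b (k - j)))).
  by move=> j; rewrite ler_peMl ?nc_ge0// weight_ge1.
apply: le_lt_trans (ltry (K0 * A * B)); apply: le_trans (Gam_es r0 hA hB).
exact: (term_le_es k F0).
Qed.

Lemma nc_le_l1 a k : csummable a -> nc (a k) <= l1 a.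
Proof.
move=> sa; rewrite -lee_fin -es_l1//.
by apply: (term_le_es (f := fun k => (nc (a k))%:E)) => i; rewrite lee_fin nc_ge0.
Qed.

Lemma csummable_conv_term a b k : csummable a -> csummable b ->
  csummable (fun j => a j * b (k - j)).
Proof.
move=> sa sb; apply: (csummable_bmul (c := l1 b)) => // [|j]; last exact: nc_le_l1.
exact: le_trans (nc_ge0 (b 0)) (nc_le_l1 0 sb).
Qed.

Definition nonlin_coef a k : C := 2 * a 0 * a k + 2^-1 * cconv (Dc_iter 1 a) (Dc_iter 1 a) k
  - 3 * cconv (Dc_iter 1 a) (Dc_iter 3 a) k - 7 / 2 * cconv (Dc_iter 2 a) (Dc_iter 2 a) k.

(** Splits the kernel into the convolutions that represent the products in the
    equation. *)
Lemma GamE a rho k : 0 <= rho -> (nrm rho a < +oo)%E ->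
  Gam a a k = - (cconv a (Dc_iter 1 a) k + DBinv_symb k * nonlin_coef a k).
Proof.
move=> r0 sa; have sD n : (n <= 3)%N -> csummable (Dc_iter n a) by move=> n3; exact: csummable_Dc_iter n3 sa.
pose T (i j : nat) := fun l => Dc_iter i a l * Dc_iter j a (k - l).
have sT (i j : nat) : (i <= 3)%N -> (j <= 3)%N -> csummable (T i j).
  by move=> i3 j3; apply: csummable_conv_term; exact: sD.
pose T0 l : C := if l == 0 then 2 * a 0 * a k else 0.
have sT0 : csummable T0 by exact: csummable_set1.
have s11 := csummableZ 2^-1 (sT 1%N 1%N erefl erefl).
have s13 := csummableZ 3 (sT 1%N 3%N erefl erefl).
have s22 := csummableZ (7 / 2) (sT 2%N 2%N erefl erefl).
have s01 := sT 0%N 1%N erefl erefl.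
have sA := csummableD sT0 s11.
have sB := csummableD sA (csummableN s13).
have sN := csummableD sB (csummableN s22).
have sM := csummableZ (DBinv_symb k) sN.
rewrite /Gam (eq_csum (g := fun l => - (T 0%N 1%N l + DBinv_symb k *
    (T0 l + 2^-1 * T 1%N 1%N l - 3 * T 1%N 3%N l - 7 / 2 * T 2%N 2%N l)))); last first.
  move=> l; rewrite /kern subrKC /nonlin_symb /T !Dc_iterE /T0.
  by case: eqP => [->|_]; rewrite ?subr0 ?expr0; ring.
rewrite csumN (csumD s01 sM) (csumZ _ sN) (csumB sB s22) (csumB sA s13) (csumD sT0 s11).
rewrite (csumZ _ (sT 1%N 1%N erefl erefl)) (csumZ _ (sT 1%N 3%N erefl erefl)).
rewrite (csumZ _ (sT 2%N 2%N erefl erefl)).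
by rewrite csum_set1.
Qed.

Lemma csummable_mul_bnd (m : int -> C) a (c : R) : 0 <= c -> (forall k, nc (m k) <= c) ->
  csummable a -> csummable (fun k => m k * a k).
Proof.
move=> c0 h sa; have := csummable_bmul sa c0 h.
by congr csummable; apply/funext => k; rewrite mulrC.
Qed.

Lemma rep_nonlin v a rho : 0 <= rho -> (nrm rho a < +oo)%E -> rep v a ->
  rep (nonlin v) (nonlin_coef a) /\ rep (Dx v) (Dc_iter 1 a).
Proof.
move=> r0 sa ra.
have sD n : (n <= 3)%N -> csummable (Dc_iter n a) by move=> n3; exact: csummable_Dc_iter n3 sa.
have r1 : rep (Dx v) (Dc_iter 1 a) by apply: Dx_rep => //; exact: (sD 1%N).
have r2 : rep (Dx (Dx v)) (Dc_iter 2 a) by apply: Dx_rep => //; exact: (sD 2%N).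
have r3 : rep (Dx (Dx (Dx v))) (Dc_iter 3 a) by apply: Dx_rep => //; exact: (sD 3%N).
have m0 : mean v = a 0 by rewrite -fourier0E (rep_fourier ra).
split => //.
have := repD (repD (repD (repZ (2 * a 0) ra) (repZ 2^-1 (repM r1 r1)))
  (repZ (-3) (repM r1 r3))) (repZ (- (7 / 2)) (repM r2 r2)).
have E (z1 z2 z3 z4 : C) : z1 + 2^-1 * z2 + -3 * z3 + - (7 / 2) * z4 =
    z1 + 2^-1 * z2 - 3 * z3 - 7 / 2 * z4 by rewrite !mulNr.
move=> h; apply: rep_eq h _ _ => [x|k]; rewrite E //.
by rewrite /nonlin m0 !expr2 mulrA.
Qed.

(** The equation is [Gam] on coefficients, for every representative of the
    function. *)
Lemma rep_equation v a rho : 0 <= rho -> (nrm rho a < +oo)%E -> rep v a ->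
  rep (fun x => v x * Dx v x + Dx (Binv (nonlin v)) x) (fun k => - Gam a a k).
Proof.
move=> r0 sa ra; have [rN r1] := rep_nonlin r0 sa ra.
have sN : csummable (nonlin_coef a) by case: rN.
have rB : rep (Binv (nonlin v)) (fun k => Binv_symb R k * nonlin_coef a k).
  apply: Binv_rep => //; apply: (csummable_mul_bnd (c := 1)) => // k; exact: Binv_symb_le1.
have rDB : rep (Dx (Binv (nonlin v))) (fun k => DBinv_symb k * nonlin_coef a k).
  have E : Dc (fun k => Binv_symb R k * nonlin_coef a k) = (fun k => DBinv_symb k * nonlin_coef a k).
    by apply/funext => k; rewrite /Dc /DBinv_symb mulrA.
  rewrite -E; apply: Dx_rep => //; rewrite E.
  by apply: (csummable_mul_bnd (c := 8)) => // k; exact: DBinv_symb_le.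
apply: rep_eq (repD (repM ra r1) rDB) _ _ => // k.
by rewrite (GamE _ r0 sa) opprK.
Qed.

End Kernel.

(** * The power series solution *)

Section PowerSeries.
Variable R : realType.
Implicit Types (j k l : int) (a b : int -> R[i]) (t h : R[i]).
Local Notation C := R[i].

(** A course-of-values recursion: [table a n m] is the m-th coefficient for m <=
    n. *)
Fixpoint table a n : nat -> int -> C :=
  if n is n'.+1 then fun m =>
    if (m <= n')%N then table a n' m
    else fun k => n'.+1%:R^-1 * \sum_(i < n'.+1) Gam (table a n' i) (table a n' (n' - i)%N) k
  else fun=> a.

Definition tcoef a n : int -> C := table a n n.

Lemma tableE a n m : (m <= n)%N -> table a n m = tcoef a m.
Proof.
elim: n => [|n IH]; first by rewrite leqn0 => /eqP ->.
rewrite leq_eqVlt => /orP[/eqP ->//|]; rewrite ltnS => mn /=.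
by rewrite mn IH.
Qed.

Lemma tcoef0 a : tcoef a 0 = a. Proof. by []. Qed.

(** The recursion of the Taylor coefficients of a' = Gam a a. *)
Lemma tcoefS a n k : n.+1%:R * tcoef a n.+1 k = \sum_(i < n.+1) Gam (tcoef a i) (tcoef a (n - i)) k.
Proof.
rewrite /tcoef /= ltnn mulrA mulfV ?mul1r ?pnatr_eq0//; apply: eq_bigr => i _.
by rewrite !tableE// ?leq_subr//; have := ltn_ord i; rewrite ltnS.
Qed.

Lemma sum_sqr_le2 n : \sum_(i < n) ((i.+1%:R : R) ^+ 2)^-1 <= 2.
Proof.
suff h : \sum_(i < n.+1) ((i.+1%:R : R) ^+ 2)^-1 <= 2 - (n.+1%:R)^-1.
  have : 0 <= (n.+1%:R : R)^-1 by [].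
  have : 0 <= ((n.+1%:R : R) ^+ 2)^-1 by rewrite invr_ge0 sqr_ge0.
  rewrite big_ord_recr/= in h => h1 h2; apply: le_trans (_ : 2 - (n.+1%:R : R)^-1 <= 2).
    by apply: le_trans h; rewrite lerDl.
  by rewrite lerBlDr lerDl.
elim: n => [|n IH].
  by rewrite big_ord_recl big_ord0 expr1n invr1 addr0; lra.
rewrite big_ord_recr/=; apply: le_trans (lerD IH (lexx _)) _.
have x0 : 0 < (n.+1%:R : R) by rewrite ltr0n.
have -> : (n.+2%:R : R) = n.+1%:R + 1 by rewrite natr1.
move: (n.+1%:R : R) x0 => x x0.
have x1 : 0 < x + 1 by lra.
rewrite -subr_ge0 (_ : _ - _ = (x * (x + 1) ^+ 2)^-1); first by rewrite invr_ge0 mulr_ge0 ?sqr_ge0 ?ltW.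
by field; rewrite !gt_eqF.
Qed.

(** The sequence 1 / (n + 1)^2 is stable under convolution up to a constant,
    because 1 / (p^2 q^2) <= 2 (1 / p^2 + 1 / q^2) / (p + q)^2. *)
Lemma sum_conv_sqr n :
  \sum_(i < n.+1) (((i.+1%:R : R) ^+ 2)^-1 * (((n - i).+1%:R : R) ^+ 2)^-1) <= 8 / n.+2%:R ^+ 2.
Proof.
pose N : R := n.+2%:R.
have N0 : 0 < N by rewrite ltr0n.
apply: (@le_trans _ _ (\sum_(i < n.+1) (2 / N ^+ 2 * (((i.+1%:R : R) ^+ 2)^-1 + (((n - i).+1%:R : R) ^+ 2)^-1)))).
  apply: ler_sum => i _; have := ltn_ord i; rewrite ltnS => iN.
  have -> : N = i.+1%:R + (n - i).+1%:R.
    by rewrite /N -natrD addSn addnS subnKC.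
  have p0 : 0 < (i.+1%:R : R) by rewrite ltr0n.
  have q0 : 0 < ((n - i).+1%:R : R) by rewrite ltr0n.
  move: (i.+1%:R : R) ((n - i).+1%:R : R) p0 q0 => p q p0 q0.
  have pq0 : 0 < p + q by lra.
  rewrite -subr_ge0 (_ : _ - _ = (p - q) ^+ 2 / (p ^+ 2 * q ^+ 2 * (p + q) ^+ 2)).
    by rewrite -!exprMn -expr_div_n sqr_ge0.
  by field; rewrite !gt_eqF.
rewrite -mulr_sumr big_split/= (_ : 8 / N ^+ 2 = 2 / N ^+ 2 * (2 + 2)); last by ring.
rewrite ler_wpM2l ?divr_ge0 ?sqr_ge0//; apply: lerD; first exact: sum_sqr_le2.
rewrite (reindex_inj rev_ord_inj)/= (eq_bigr (fun i : 'I_n.+1 => ((i.+1%:R : R) ^+ 2)^-1)).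
  exact: sum_sqr_le2.
by move=> i _; rewrite subSS subKn//; have := ltn_ord i; rewrite ltnS.
Qed.

Lemma nrmD rho a b : (nrm rho (fun k => a k + b k)%R <= nrm rho a + nrm rho b)%E.
Proof.
rewrite /nrm -esD; [|by move=> k; rewrite lee_fin mulr_ge0 ?weight_ge0 ?nc_ge0..].
by apply: le_es => k; rewrite -EFinD lee_fin -mulrDr ler_wpM2l ?weight_ge0// le_normcD.
Qed.

Lemma nrmZ rho (c : C) a : nrm rho (fun k => c * a k) = ((nc c)%:E * nrm rho a)%E.
Proof.
rewrite /nrm -esZ ?nc_ge0//; last by move=> k; rewrite lee_fin mulr_ge0 ?weight_ge0 ?nc_ge0.
by apply: eq_es => k; rewrite -EFinM Normc.normcM mulrCA.
Qed.

Lemma nrm0 rho : nrm rho (fun=> 0 : C) = 0%E.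
Proof.
by rewrite /nrm -[RHS](es0 R int); apply: eq_es => k; rewrite Normc.normc0 mulr0.
Qed.

Lemma nrm_sum rho n (F : nat -> int -> C) (c : nat -> R) :
  (forall i, (i < n)%N -> (nrm rho (F i) <= (c i)%:E)%E) ->
  (nrm rho (fun k => \sum_(i < n) F i k)%R <= (\sum_(i < n) c i)%:E)%E.
Proof.
elim: n => [|n IH] h.
  rewrite big_ord0 (_ : (fun k => _) = (fun=> 0 : C)) ?nrm0//.
  by apply/funext => k; rewrite big_ord0.
rewrite (_ : (fun k => _) = (fun k => \sum_(i < n) F i k + F n k)); last first.
  by apply/funext => k; rewrite big_ord_recr.
apply: le_trans (nrmD _ _ _) _; rewrite big_ord_recr/= EFinD leeD ?h//.
by apply: IH => i iN; apply: h; rewrite ltnS ltnW.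
Qed.

(** The inverse of the lifespan. *)
Definition growth (M : R) : R := 16 * expR 1 * K0 R * M.

Lemma growth_gt0 M : 0 < M -> 0 < growth M.
Proof. by move=> M0; rewrite !mulr_gt0 ?expR_gt0 ?K0_gt0. Qed.

Definition tcoef_majorant (M rho : R) n : R := M * growth M ^+ n / (n.+1%:R ^+ 2 * (1 - rho) ^+ n).

Lemma ratio_pow_le n m : (m <= n)%N -> ((n.+2%:R : R) / n.+1%:R) ^+ m <= expR 1.
Proof.
move=> mn; have x0 : 0 < (n.+1%:R : R) by rewrite ltr0n.
have -> : (n.+2%:R : R) / n.+1%:R = 1 + n.+1%:R^-1.
  by rewrite -natr1 mulrDl divff ?gt_eqF// mul1r.
apply: (@le_trans _ _ (expR (n.+1%:R^-1) ^+ m)).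
  by rewrite lerXn2r ?nnegrE ?expR_ge0 ?expR_ge1Dx// addr_ge0.
rewrite -expRM_natl ler_expR ler_pdivrMr// mul1r ler_nat.
by apply: leq_trans mn _.
Qed.

(** In the step to n + 1 the second factor is measured at the radius rho' = rho
    + (1 - rho) / (n + 2).  The derivative then costs (n + 2) / (1 - rho), which
    the division by n + 1 repays, and replacing 1 - rho' by 1 - rho in the
    denominators costs at most ((n + 2) / (n + 1))^n <= e. *)
Lemma tcoef_bnd a (M : R) : 0 < M -> (nrm 1 a <= M%:E)%E ->
  forall n rho, 0 <= rho -> rho < 1 -> (nrm rho (tcoef a n) <= (tcoef_majorant M rho n)%:E)%E.
Proof.
move=> M0 ha n; have Q0 := growth_gt0 M0; have K00 := K0_gt0 R.
elim/ltn_ind: n => -[_ rho r0 r1|n IH rho r0 r1].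
  rewrite tcoef0 /tcoef_majorant !expr0 expr1n !mulr1 divr1.
  by apply: le_trans ha; apply: nrm_mono; exact: ltW.
pose d := 1 - rho.
have d0 : 0 < d by rewrite subr_gt0.
pose x : R := n.+1%:R; pose y : R := n.+2%:R.
have x0 : 0 < x by rewrite ltr0n.
have yx : y = x + 1 by rewrite /y /x natr1.
have y0 : 0 < y by rewrite ltr0n.
pose rho' := rho + d / y.
have dy : d / y <= d / 2.
  rewrite ler_pM2l// lef_pV2 ?posrE// ler_nat//.
have dy0 : 0 < d / y by rewrite divr_gt0.
have r'1 : rho' < 1 by apply: (le_lt_trans (lerD (lexx rho) dy)); rewrite /d; lra.
have r'0 : 0 <= rho' by rewrite addr_ge0// ltW.
have gap : rho' - rho = d / y by rewrite /rho'; ring.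
have d' : 1 - rho' = d * (x / y).
  by rewrite /rho' /d yx; field; rewrite gt_eqF// -yx.
pose c i : R := K0 R * M ^+ 2 * growth M ^+ n * expR 1 * y / d ^+ n.+1 *
  ((i.+1%:R ^+ 2)^-1 * ((n - i).+1%:R ^+ 2)^-1).
have key i : (i < n.+1)%N -> (nrm rho (Gam (tcoef a i) (tcoef a (n - i))) <= (c i)%:E)%E.
  rewrite ltnS => iN.
  have h1 := IH i iN rho r0 r1.
  have h2 := IH (n - i)%N (leq_ltn_trans (leq_subr _ _) (ltnSn n)) rho' r'0 r'1.
  have h3 : (nrm1 rho (tcoef a (n - i)) <= ((rho' - rho)^-1 * tcoef_majorant M rho' (n - i))%:E)%E.
    apply: nrm1_gap h2; first by rewrite ltrDl.
    by rewrite lerD2l; apply: le_trans dy _; rewrite /d; lra.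
  apply: le_trans (Gam_bnd r0 h1 h3) _; rewrite lee_fin gap /tcoef_majorant -/d d'.
  have hr := ratio_pow_le (leq_subr i n).
  rewrite -/x -/y in hr.
  set p : R := i.+1%:R; set q : R := (n - i).+1%:R.
  have p0 : 0 < p by rewrite ltr0n.
  have q0 : 0 < q by rewrite ltr0n.
  have -> : K0 R * (M * growth M ^+ i / (p ^+ 2 * d ^+ i)) * ((d / y)^-1 *
      (M * growth M ^+ (n - i) / (q ^+ 2 * (d * (x / y)) ^+ (n - i)))) =
     (K0 R * M ^+ 2 * (growth M ^+ i * growth M ^+ (n - i)) * y / (d * (d ^+ i * d ^+ (n - i))) *
      ((p ^+ 2)^-1 * (q ^+ 2)^-1)) * (y / x) ^+ (n - i).
    rewrite !exprMn !exprVn; field.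
    by rewrite !gt_eqF ?exprn_gt0.
  rewrite -!exprD subnKC// -exprS.
  apply: (@le_trans _ _ ((K0 R * M ^+ 2 * growth M ^+ n * y / d ^+ n.+1 *
      ((p ^+ 2)^-1 * (q ^+ 2)^-1)) * expR 1)).
    rewrite ler_wpM2l//.
    by rewrite !mulr_ge0 ?invr_ge0 ?exprn_ge0 ?ltW.
  by rewrite le_eqVlt; apply/orP; left; apply/eqP; rewrite /c -/p -/q; ring.
have hs := nrm_sum key.
rewrite (_ : tcoef a n.+1 = (fun k => x%:C^-1 * \sum_(i < n.+1) Gam (tcoef a i) (tcoef a (n - i)) k)); last first.
  apply/funext => k; rewrite -tcoefS mulrA (_ : x%:C = n.+1%:R) ?mulVf ?mul1r ?pnatr_eq0//.
  by rewrite /x rmorph_nat.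
rewrite nrmZ Normc.normcV nc_real ger0_norm ?(ltW x0)//.
apply: le_trans (lee_wpmul2l _ hs) _; first by rewrite lee_fin invr_ge0 ltW.
rewrite -EFinM lee_fin /c -mulr_sumr.
have := sum_conv_sqr n; rewrite -/y => hconv.
set B := K0 R * M ^+ 2 * growth M ^+ n * expR 1 * y / d ^+ n.+1.
have B0 : 0 <= B by rewrite !mulr_ge0 ?invr_ge0 ?exprn_ge0 ?expR_ge0 ?ltW.
apply: (@le_trans _ _ (x^-1 * (B * (8 / y ^+ 2)))).
  by rewrite ler_wpM2l ?invr_ge0 ?(ltW x0)// ler_wpM2l.
have -> : x^-1 * (B * (8 / y ^+ 2)) = (y / x) * (8 * expR 1 * K0 R * M * (M * growth M ^+ n / (y ^+ 2 * d ^+ n.+1))).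
  by rewrite /B; field; rewrite !gt_eqF ?exprn_gt0.
have -> : tcoef_majorant M rho n.+1 = 2 * (8 * expR 1 * K0 R * M * (M * growth M ^+ n / (y ^+ 2 * d ^+ n.+1))).
  rewrite /tcoef_majorant -/y -/d exprS {1}/growth; ring.
rewrite ler_wpM2r//.
  by rewrite !mulr_ge0 ?invr_ge0 ?mulr_ge0 ?exprn_ge0 ?expR_ge0 ?ltW.
rewrite ler_pdivrMr// yx; have : 1 <= x by rewrite /x ler1n.
by lra.
Qed.

Lemma es_geometric (q : R) : 0 <= q < 1 ->
  (es (fun n : nat => (q ^+ n)%:E) <= ((1 - q)^-1)%:E)%E.
Proof.
case/andP=> q0 q1; rewrite /es -nneseries_esumT; last first.
  by move=> n; rewrite lee_fin exprn_ge0.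
apply: lime_le.
  by apply: is_cvg_nneseries => n _ _; rewrite lee_fin exprn_ge0.
near=> n; rewrite sumEFin lee_fin big_mkord.
have q1' : 1 - q != 0 by rewrite subr_eq0 eq_sym lt_eqF.
rewrite -[leRHS]mul1r ler_pdivlMr ?subr_gt0// mulrC -opprB mulNr -subrX1 opprB.
by rewrite gerBl exprn_ge0.
Unshelve. all: by end_near. Qed.

Definition ser (A : nat -> int -> C) (c : nat -> C) k : C := csum (fun n => c n * A n k).

Lemma ser_es (A : nat -> int -> C) (c : nat -> C) (w : nat -> R) (kap Ms rho : R) :
  0 <= kap -> (es (fun n => (w n)%:E * nrm rho (A n)) <= Ms%:E)%E ->
  (forall n, nc (c n) <= kap * w n) -> (forall n, 0 <= w n) ->
  (es (fun k => es (fun n => (weight rho k * nc (c n * A n k))%:E)) <= (kap * Ms)%:E)%E.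
Proof.
move=> k0 hM hc w0.
rewrite es_fubini; last by move=> i j; rewrite lee_fin mulr_ge0 ?weight_ge0 ?nc_ge0.
apply: (@le_trans _ _ (es (fun n => kap%:E * ((w n)%:E * nrm rho (A n))))%E); last first.
  rewrite esZ// ?EFinM ?lee_wpmul2l// => n.
  by rewrite mule_ge0 ?lee_fin// nrm_ge0.
apply: le_es => n.
rewrite (eq_es (g := fun k => ((nc (c n))%:E * (weight rho k * nc (A n k))%:E)%E)); last first.
  by move=> k; rewrite -EFinM Normc.normcM mulrCA.
rewrite esZ ?nc_ge0//; last by move=> k; rewrite lee_fin mulr_ge0 ?weight_ge0 ?nc_ge0.
by rewrite muleA -EFinM lee_wpmul2r ?nrm_ge0// lee_fin.
Qed.

Lemma ser_nrm (A : nat -> int -> C) (c : nat -> C) (w : nat -> R) (kap Ms rho : R) :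
  0 <= kap -> (es (fun n => (w n)%:E * nrm rho (A n)) <= Ms%:E)%E ->
  (forall n, nc (c n) <= kap * w n) -> (forall n, 0 <= w n) ->
  (nrm rho (ser A c) <= (kap * Ms)%:E)%E.
Proof.
move=> k0 hM hc w0; apply: le_trans (ser_es k0 hM hc w0); apply: le_es => k.
rewrite (eq_es (g := fun n => ((weight rho k)%:E * (nc (c n * A n k))%:E)%E))//.
rewrite esZ ?weight_ge0//; last by move=> n; rewrite lee_fin nc_ge0.
by rewrite EFinM lee_wpmul2l ?lee_fin ?weight_ge0//; exact: nc_csum.
Qed.

Lemma ser_summable (A : nat -> int -> C) (c : nat -> C) (w : nat -> R) (kap Ms rho : R) k :
  0 <= kap -> (es (fun n => (w n)%:E * nrm rho (A n)) <= Ms%:E)%E ->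
  (forall n, nc (c n) <= kap * w n) -> (forall n, 0 <= w n) -> 0 <= rho ->
  csummable (fun n => c n * A n k).
Proof.
move=> k0 hM hc w0 r0.
apply: (csummable_le (g := fun n => weight rho k * nc (c n * A n k))).
  by move=> n; rewrite ler_peMl ?nc_ge0// weight_ge1.
apply: le_lt_trans (ltry (kap * Ms)); apply: le_trans (ser_es k0 hM hc w0).
apply: (term_le_es (f := fun k => es (fun n => (weight rho k * nc (c n * A n k))%:E)) k) => i.
by apply: es_ge0 => j; rewrite lee_fin mulr_ge0 ?weight_ge0 ?nc_ge0.
Qed.

Lemma es_succ_le (g : nat -> \bar R) : (forall n, 0 <= g n)%E ->
  (es (fun n => g n.+1) <= es g)%E.
Proof.
move=> g0; rewrite /es -(@esum_image R nat nat setT succn g).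
  rewrite esum_mkcond; apply: le_esum => n _; case: ifP => _; rewrite ?g0//.
by move=> x y _ _ [].
Qed.

(** The shift of an index set is not a bijection of it, so the tail is written
    as the row m = 1 of a double family and summed by antidiagonals. *)
Lemma csum_shift (f : nat -> C) : csummable f -> csum f = f 0%N + csum (fun n => f n.+1).
Proof.
move=> sf.
have sf0 : csummable (fun n => if n == 0%N then f 0%N else 0) by exact: csummable_set1.
have sf1 : csummable (fun n => if n == 0%N then 0 else f n).
  apply: le_lt_trans sf; apply: le_es => n; case: ifP => // _.
  by rewrite lee_fin Normc.normc0 nc_ge0.
rewrite (eq_csum (g := fun n => (if n == 0%N then f 0%N else 0) + (if n == 0%N then 0 else f n))); last first.
  by move=> n; case: eqP => [->|_]; rewrite ?addr0 ?add0r.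
(* the remaining sum skips the index 0 *)
rewrite csumD// csum_set1; congr (_ + _).
(* reindexing through the antidiagonals of the row m = 1 *)
pose F (m p : nat) : C := if m == 1%N then f p.+1 else 0.
transitivity (csum (fun n => \sum_(m < n.+1) F m (n - m)%N)).
  apply: eq_csum => -[|n]; first by rewrite big_ord_recl big_ord0 addr0.
  rewrite (bigD1 (inord 1))//= inordK// subn1/= big1 ?addr0// => i i1.
  rewrite /F; case: eqP => // iE; move: i1; rewrite -val_eqE/= iE inordK//.
rewrite -csum_diag.
  rewrite (eq_csum (g := fun m => if m == 1%N then csum (fun n => f n.+1) else 0)); last first.
    by move=> m; rewrite /F; case: eqP => // _; rewrite csum0.
  by rewrite csum_set1.
rewrite (eq_es (g := fun m => if m == 1%N then es (fun n => (nc (f n.+1))%:E) else 0%E)); last first.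
  by move=> m; rewrite /F; case: eqP => // _; rewrite Normc.normc0 es0.
rewrite es_set1; last by apply: es_ge0 => n; rewrite lee_fin nc_ge0.
by apply: le_lt_trans sf; apply: (es_succ_le (g := fun n => (nc (f n))%:E)) => n; rewrite lee_fin nc_ge0.
Qed.

(** The Cauchy product of power series under the bilinear map [Gam]; the
    slightly larger radius makes the triple sum over m, p and j absolutely
    convergent. *)
Lemma Gam_ser (A : nat -> int -> C) (t : C) (w al : nat -> R) (Ms rho rho' : R) k :
  0 <= rho -> rho < rho' -> rho' <= rho + 1 ->
  (forall n, (nrm rho' (A n) <= (al n)%:E)%E) ->
  (es (fun n => (w n * al n)%R%:E) <= Ms%:E)%E ->
  (forall n, nc (t ^+ n) <= w n) ->
  Gam (ser A (GRing.exp t)) (ser A (GRing.exp t)) k =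
  csum (fun n => t ^+ n * \sum_(i < n.+1) Gam (A i) (A (n - i)%N) k).
Proof.
move=> r0 rr r1 hal hMs ht.
have w0 n : 0 <= w n by apply: le_trans (ht n); exact: nc_ge0.
have al0 n : 0 <= al n by rewrite -lee_fin; apply: le_trans (hal n); exact: nrm_ge0.
have hal0 n : (nrm rho (A n) <= (al n)%:E)%E.
  by apply: le_trans (hal n); exact: nrm_mono (ltW rr).
have hM0 : (es (fun n => (w n)%:E * nrm rho (A n)) <= Ms%:E)%E.
  by apply: le_trans hMs; apply: le_es => n; rewrite EFinM lee_wpmul2l ?lee_fin.
have ht1 n : nc (t ^+ n) <= 1 * w n by rewrite mul1r.
have sU j : csummable (fun n => t ^+ n * A n j) by exact: ser_summable ler01 hM0 ht1 w0 r0.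
pose F (m p : nat) (j : int) := t ^+ (m + p) * (kern R j (k - j) * A m j * A p (k - j)).
have F0 m p j : (0 <= (nc (F m p j))%:E)%E by rewrite lee_fin nc_ge0.
pose D := K0 R * (rho' - rho)^-1.
have D0 : 0 <= D by rewrite mulr_ge0 ?(ltW (K0_gt0 R))// invr_ge0 subr_ge0 ltW.
have hGs m p : (es (fun j => (nc (kern R j (k - j)%R * A m j * A p (k - j)%R))%:E) <= (D * (al m * al p))%:E)%E.
  have h := Gam_es r0 (hal0 m) (nrm1_gap rr r1 (hal p)).
  rewrite (_ : D * _ = K0 R * al m * ((rho' - rho)^-1 * al p)); last by rewrite /D; ring.
  apply: le_trans h.
  apply: (@le_trans _ _ (es (fun j => (weight rho k * nc (kern R j (k - j)%R * A m j * A p (k - j)%R))%:E))).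
    by apply: le_es => j; rewrite lee_fin ler_peMl ?nc_ge0// weight_ge1.
  apply: (term_le_es (f := fun k => es (fun j => (weight rho k * nc (kern R j (k - j)%R * A m j * A p (k - j)%R))%:E)) k) => i.
  by apply: es_ge0 => j; rewrite lee_fin mulr_ge0 ?weight_ge0 ?nc_ge0.
have hG m p : (es (fun j => (nc (F m p j))%:E) <= (D * ((w m * al m) * (w p * al p)))%:E)%E.
  rewrite /F es_ncZ (_ : D * _ = (w m * w p) * (D * (al m * al p))); last by ring.
  rewrite EFinM; apply: lee_pmul => //; first by rewrite lee_fin nc_ge0.
    by apply: es_ge0 => j; rewrite lee_fin nc_ge0.
  by rewrite lee_fin exprD Normc.normcM ler_pM ?nc_ge0.
have hMs0 : (0 <= es (fun n => (w n * al n)%R%:E))%E.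
  by apply: es_ge0 => n; rewrite lee_fin mulr_ge0.
have hmp : (es (fun m => es (fun p => es (fun j => (nc (F m p j))%:E))) < +oo)%E.
  apply: (@le_lt_trans _ _ (es (fun m => es (fun p => (D * ((w m * al m) * (w p * al p)))%:E)))).
    by apply: le_es => m; apply: le_es => p.
  apply: (@le_lt_trans _ _ (es (fun m => (Ms * D)%:E * (w m * al m)%R%:E))%E).
    apply: le_es => m.
    rewrite (eq_es (g := fun p => ((D * (w m * al m))%:E * (w p * al p)%R%:E)%E)); last first.
      by move=> p; rewrite -EFinM; congr EFin; ring.
    rewrite esZ; [|by apply: mulr_ge0 => //; exact: mulr_ge0|by move=> p; rewrite lee_fin; exact: mulr_ge0].
    rewrite (_ : ((Ms * D)%:E * _ = (D * (w m * al m))%:E * Ms%:E)%E); last first.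
      by rewrite -!EFinM; congr EFin; ring.
    by apply: lee_wpmul2l => //; rewrite lee_fin; apply: mulr_ge0 => //; exact: mulr_ge0.
  have Ms0 : 0 <= Ms by rewrite -lee_fin; exact: le_trans hMs0 hMs.
  rewrite esZ; [|exact: mulr_ge0|by move=> p; rewrite lee_fin; exact: mulr_ge0].
  apply: lte_mul_pinfty => //; first by rewrite lee_fin; exact: mulr_ge0.
  by apply: le_lt_trans hMs _; rewrite ltry.
have hm m : (es (fun p => es (fun j => (nc (F m p j))%:E)) < +oo)%E.
  apply: le_lt_trans hmp; apply: (term_le_es (f := fun m => es (fun p => es (fun j => (nc (F m p j))%:E))) m) => i.
  by apply: es_ge0 => p; exact: es_ge0.
rewrite /Gam (eq_csum (g := fun j => csum (fun m => csum (fun p => F m p j)))); last first.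
  move=> j; rewrite /ser -(csumZ (kern R j (k - j)) (sU j)) -csumZr; last exact: csummableZ.
  apply: eq_csum => m; rewrite -csumZ//; apply: eq_csum => p.
  by rewrite /F exprD; ring.
rewrite csum_fubini; last first.
  rewrite es_fubini; last by move=> *; rewrite lee_fin nc_ge0.
  apply: le_lt_trans hmp; apply: le_es => m.
  rewrite es_fubini//; apply: le_es => j; exact: nc_csum.
rewrite (eq_csum (g := fun m => csum (fun p => csum (fun j => F m p j)))); last first.
  by move=> m; rewrite csum_fubini//; rewrite es_fubini.
rewrite csum_diag; last first.
  by apply: le_lt_trans hmp; apply: le_es => m; apply: le_es => p; exact: nc_csum.
apply: eq_csum => n; rewrite mulr_sumr; apply: eq_bigr => i _.
have iN : (i <= n)%N by have := ltn_ord i; rewrite ltnS.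
rewrite -csumZ; first by apply: eq_csum => j; rewrite /F subnKC.
by apply: le_lt_trans (hGs _ _) _; rewrite ltry.
Qed.

Definition Usol a t : int -> C := ser (tcoef a) (GRing.exp t).
Definition dUsol a t : int -> C := ser (tcoef a) (fun n => n%:R * t ^+ n.-1).

Lemma Usol0 a : Usol a 0 = a.
Proof.
apply/funext => k; rewrite /Usol /ser.
rewrite (eq_csum (g := fun n => if n == 0%N then a k else 0)) ?csum_set1//.
by move=> n; rewrite expr0n; case: eqP => [->|_]; rewrite ?mul1r ?mul0r.
Qed.

(** The second order Taylor remainder of t^n, multiplied by r^2 to avoid
    negative powers of r. *)
Lemma diff_quot_bnd (t h : C) (r : R) n : 0 < r -> h != 0 -> nc t + nc h <= r ->
  r ^+ 2 * nc (((t + h) ^+ n - t ^+ n) / h - n%:R * t ^+ n.-1) <= nc h * (n%:R ^+ 2 * r ^+ n).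
Proof.
move=> r0 h0 hr; have nh := nc_ge0 h; have nt := nc_ge0 t.
have th : nc (t + h) <= r by apply: le_trans hr; exact: le_normcD.
have tr : nc t <= r by lra.
elim: n => [|n IH].
  by rewrite !expr0 subrr !mul0r subr0 Normc.normc0 mulr0 expr0n/= mul0r mulr0.
have -> : ((t + h) ^+ n.+1 - t ^+ n.+1) / h - n.+1%:R * t ^+ n.+1.-1 =
   (t + h) * (((t + h) ^+ n - t ^+ n) / h - n%:R * t ^+ n.-1) + h * (n%:R * t ^+ n.-1).
  rewrite -natr1 /= !exprS; case: n {IH} => [|n] /=.
    by rewrite !expr0 !mul0r; field.
  by rewrite !exprS; field.
have h1 : nc (n%:R * t ^+ n.-1) * r ^+ 2 <= n%:R * r ^+ n.+1.
  case: n {IH} => [|n].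
    by rewrite !mul0r Normc.normc0 mul0r.
  rewrite -pred_Sn.
  rewrite Normc.normcM nc_nat ncX -mulrA ler_wpM2l//.
  rewrite (_ : r ^+ n.+2 = r ^+ n * r ^+ 2); last by rewrite -exprD addn2.
  by rewrite ler_wpM2r ?sqr_ge0// lerXn2r// nnegrE ltW.
have h2 : nc ((t + h) * (((t + h) ^+ n - t ^+ n) / h - n%:R * t ^+ n.-1)) * r ^+ 2 <=
    r * (nc h * (n%:R ^+ 2 * r ^+ n)).
  rewrite Normc.normcM -mulrA [_ * r ^+ 2]mulrC.
  by apply: ler_pM => //; rewrite ?nc_ge0// mulr_ge0 ?sqr_ge0 ?nc_ge0.
rewrite mulrC; apply: (@le_trans _ _ (r * (nc h * (n%:R ^+ 2 * r ^+ n)) + nc h * (n%:R * r ^+ n.+1))).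
  apply: (@le_trans _ _ ((nc ((t + h) * (((t + h) ^+ n - t ^+ n) / h - n%:R * t ^+ n.-1)) +
     nc (h * (n%:R * t ^+ n.-1))) * r ^+ 2)).
    by rewrite ler_wpM2r ?sqr_ge0// le_normcD.
  rewrite mulrDl lerD// Normc.normcM -mulrA ler_wpM2l//.
have -> : r * (nc h * (n%:R ^+ 2 * r ^+ n)) + nc h * (n%:R * r ^+ n.+1) =
   nc h * ((n%:R ^+ 2 + n%:R) * r ^+ n.+1) by rewrite [r ^+ n.+1]exprS; ring.
rewrite ler_wpM2l// ler_wpM2r ?exprn_ge0 ?(ltW r0)// -natr1.
have : 0 <= n%:R :> R by [].
nra.
Qed.

Section Solution.
Variables (a : int -> C) (M r rho rho' : R).
Hypotheses (M0 : 0 < M) (ha : (nrm 1 a <= M%:E)%E) (r0 : 0 < r)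
  (rho0 : 0 <= rho) (rr : rho < rho') (rho1 : rho' < 1) (hr : growth M * r < 1 - rho').

Let w n : R := n.+1%:R ^+ 2 * r ^+ n.
Let q : R := growth M * r / (1 - rho').
Let Ms : R := M / (1 - q).

Let w0 n : 0 <= w n. Proof. by rewrite mulr_ge0 ?sqr_ge0 ?exprn_ge0 ?ltW. Qed.

Let q01 : 0 <= q < 1.
Proof.
apply/andP; split; last by rewrite ltr_pdivrMr ?mul1r ?subr_gt0.
apply: divr_ge0; last by rewrite subr_ge0 ltW.
by apply: mulr_ge0; apply: ltW => //; exact: growth_gt0.
Qed.
Let rho'0 : 0 <= rho'. Proof. exact/ltW/le_lt_trans/rr. Qed.

Let hal n : (nrm rho' (tcoef a n) <= (tcoef_majorant M rho' n)%:E)%E.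
Proof. exact: tcoef_bnd. Qed.

Let walE n : w n * tcoef_majorant M rho' n = M * q ^+ n.
Proof.
have d0 : 1 - rho' != 0 by rewrite subr_eq0 eq_sym lt_eqF.
rewrite /w /tcoef_majorant /q !exprMn exprVn; field.
by rewrite expf_neq0//= addrC natr1 pnatr_eq0.
Qed.

Let hMs : (es (fun n => (w n * tcoef_majorant M rho' n)%R%:E) <= Ms%:E)%E.
Proof.
rewrite (eq_es (g := fun n => (M%:E * (q ^+ n)%:E)%E)); last first.
  by move=> n; rewrite walE EFinM.
rewrite esZ ?(ltW M0)//; last first.
  by move=> n; rewrite lee_fin exprn_ge0//; case/andP: q01.
by rewrite /Ms EFinM lee_wpmul2l ?lee_fin ?(ltW M0)// es_geometric.
Qed.

Let hM : (es (fun n => (w n)%:E * nrm rho (tcoef a n)) <= Ms%:E)%E.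
Proof.
apply: le_trans hMs; apply: le_es => n; rewrite (EFinM (w n)) lee_wpmul2l ?lee_fin//.
by apply: le_trans (hal n); exact: nrm_mono (ltW rr).
Qed.

Let w_ge n : r ^+ n <= w n.
Proof.
by rewrite /w ler_peMl ?exprn_ge0 ?(ltW r0)// exprn_ege1// ler1n.
Qed.

Let ht t n : nc t <= r -> nc (t ^+ n) <= w n.
Proof.
move=> tr; apply: le_trans (w_ge n); rewrite ncX lerXn2r// nnegrE ?nc_ge0//.
exact: ltW.
Qed.

Let hdt t n : nc t <= r -> nc (n%:R * t ^+ n.-1) <= r^-1 * w n.
Proof.
move=> tr; rewrite Normc.normcM nc_nat ncX.
case: n => [|n] /=; first by rewrite mul0r mulr_ge0 ?invr_ge0 ?(ltW r0).
have -> : r^-1 * w n.+1 = n.+2%:R ^+ 2 * r ^+ n.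
  by rewrite /w [r ^+ n.+1]exprS; field; rewrite gt_eqF.
apply: ler_pM; rewrite ?exprn_ge0 ?nc_ge0//.
  by rewrite -natrX ler_nat (leq_trans (leqnSn _))// -{1}[n.+2]expn1 leq_pexp2l.
by rewrite lerXn2r// nnegrE ?nc_ge0// ltW.
Qed.

Lemma Usol_nrm t : nc t <= r -> (nrm rho (Usol a t) <= Ms%:E)%E.
Proof.
move=> tr; rewrite -[Ms]mul1r; apply: (ser_nrm (w := w)) => // n.
by rewrite mul1r; exact: ht.
Qed.

Lemma dUsol_nrm t : nc t <= r -> (nrm rho (dUsol a t) <= (r^-1 * Ms)%:E)%E.
Proof.
move=> tr; apply: (ser_nrm (w := w)) => // [|n]; first by rewrite invr_ge0 ltW.
exact: hdt.
Qed.

(** The recursion of the Taylor coefficients, summed with [Gam_ser]. *)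
Lemma dUsolE t k : nc t <= r -> dUsol a t k = Gam (Usol a t) (Usol a t) k.
Proof.
move=> tr; have ir : 0 <= r^-1 by rewrite invr_ge0 ltW.
rewrite /dUsol /ser csum_shift; last first.
  by apply: (ser_summable (w := w) k ir hM) => // n; exact: hdt.
rewrite !mul0r add0r /Usol (@Gam_ser _ _ w (tcoef_majorant M rho') Ms rho rho')//.
- apply: eq_csum => n /=; rewrite -tcoefS; ring.
- by move: rho1 rr rho0; lra.
- by move=> n; exact: ht.
Qed.

Lemma Usol_deriv t h : h != 0 -> nc t + nc h <= r ->
  (nrm rho (fun k => (Usol a (t + h) k - Usol a t k) / h - dUsol a t k)%R <=
    (nc h / r ^+ 2 * Ms)%:E)%E.
Proof.
move=> h0 thr; have nh := nc_ge0 h; have nt := nc_ge0 t.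
have th : nc (t + h) <= r by apply: le_trans thr; exact: le_normcD.
have tr : nc t <= r by move: thr; lra.
have ir : 0 <= r^-1 by rewrite invr_ge0 ltW.
have s1 k : csummable (fun n => (t + h) ^+ n * tcoef a n k).
  by apply: (ser_summable (w := w) k ler01 hM) => // n; rewrite mul1r; exact: ht.
have s2 k : csummable (fun n => t ^+ n * tcoef a n k).
  by apply: (ser_summable (w := w) k ler01 hM) => // n; rewrite mul1r; exact: ht.
have s3 k : csummable (fun n => n%:R * t ^+ n.-1 * tcoef a n k).
  by apply: (ser_summable (w := w) k ir hM) => // n; exact: hdt.
rewrite (_ : (fun k => _) = ser (tcoef a)
    (fun n => ((t + h) ^+ n - t ^+ n) / h - n%:R * t ^+ n.-1)); last first.
  apply/funext => k; rewrite /Usol /dUsol /ser -csumB// mulrC.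
  have s12 := csummableD (s1 k) (csummableN (s2 k)).
  rewrite -csumZ// -csumB//; last exact: csummableZ.
  by apply: eq_csum => n; ring.
apply: (ser_nrm (w := w)) => // [|n]; first by rewrite divr_ge0 ?sqr_ge0.
have := diff_quot_bnd n r0 h0 thr.
rewrite -ler_pdivlMl ?exprn_gt0// => hd; apply: le_trans hd _.
rewrite mulrA [_^-1 * _]mulrC ler_wpM2l ?divr_ge0 ?sqr_ge0//.
by rewrite /w ler_wpM2r ?exprn_ge0 ?(ltW r0)// lerXn2r ?nnegrE// ler_nat.
Qed.

End Solution.

End PowerSeries.

(** * Uniqueness for families of coefficients *)

Section PSeries.
Variable R : realType.
Implicit Types (k : int).

Lemma es_le_partial (f : nat -> R) (c : R) : (forall n, 0 <= f n) ->
  (forall N, \sum_(n < N) f n <= c) -> (es (fun n => (f n)%:E) <= c%:E)%E.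
Proof.
move=> f0 h; rewrite /es -nneseries_esumT; last by move=> n; rewrite lee_fin.
apply: lime_le; first by apply: is_cvg_nneseries => n _ _; rewrite lee_fin.
by near=> n; rewrite sumEFin lee_fin big_mkord.
Unshelve. all: by end_near. Qed.

Definition decay (p x : R) : R := expR (- p * ln (1 + x)).

Lemma decay_ge0 p x : 0 <= decay p x. Proof. exact: expR_ge0. Qed.

(** The discrete integral comparison of sum (n + 1)^(-q-1), in the form q
    b^(-q-1) <= a^(-q) - b^(-q) for b = a + 1. *)
Lemma pseries_partial (q : R) N : 0 < q ->
  \sum_(n < N.+1) decay (q + 1) n%:R <= 1 + q^-1 * (1 - expR (- q * ln N.+1%:R)).
Proof.
move=> q0; elim: N => [|N IH].
  by rewrite big_ord1 /decay addr0 ln1 !mulr0 expR0 subrr mulr0 addr0.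
rewrite big_ord_recr/=; apply: le_trans (lerD IH (lexx _)) _.
rewrite /decay nat1r; set a : R := N.+1%:R; set b : R := N.+2%:R.
have a0 : 0 < a by rewrite ltr0n.
have b0 : 0 < b by rewrite ltr0n.
have ba : b = a + 1 by rewrite /a /b natr1.
(* ln (a / b) <= a / b - 1 = - 1 / b *)
have hd : b^-1 <= ln b - ln a.
  have : ln (a / b) <= a / b - 1.
    have := @ln_sublinear R (a / b); rewrite divr_gt0// => /(_ isT) h.
    have := @le_ln1Dx R (a / b - 1); rewrite subrKC; apply.
    by rewrite ltrBrDl addrN divr_gt0.
  rewrite ln_div ?posrE// => h.
  have : a / b - 1 = - b^-1.
    by have -> : a = b - 1 by [rewrite ba addrK]; rewrite mulrBl divff ?gt_eqF// mul1r addrAC subrr add0r.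
  by move=> E; move: h; rewrite E lerNr opprB.
have e1 : expR (- (q + 1) * ln b) = expR (- q * ln b) * b^-1.
  by rewrite opprD mulrDl mulN1r expRD [X in _ * X]expRN lnK// posrE.
have e2 : expR (- q * ln a) = expR (- q * ln b) * expR (q * (ln b - ln a)).
  by rewrite -expRD; congr expR; ring.
have e3 : 1 + q * (ln b - ln a) <= expR (q * (ln b - ln a)) by exact: expR_ge1Dx.
have e4 : q * b^-1 <= q * (ln b - ln a) by rewrite ler_pM2l.
rewrite e1 e2; have E0 := expR_gt0 (- q * ln b).
move: (expR (- q * ln b)) (expR (q * (ln b - ln a))) E0 e3 => E F E0 e3.
have : E * (q * b^-1) <= E * F - E.
  by rewrite -[X in _ - X]mulr1 -mulrBr ler_pM2l// lerBrDl; apply: le_trans e3; rewrite lerD2l.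
rewrite -(ler_pM2l (_ : 0 < q^-1)) ?invr_gt0// => h.
have : q^-1 * (E * (q * b^-1)) = E / b by field; rewrite !gt_eqF.
move=> h2; move: h; rewrite h2 !mulrBr.
by move: (E / b) (q^-1 * (E * F)) (q^-1 * E) => x y w h; lra.
Qed.

Lemma pseries_nat (q : R) : 0 < q ->
  (es (fun n : nat => (decay (q + 1) n%:R)%:E) <= (1 + q^-1)%:E)%E.
Proof.
move=> q0; apply: es_le_partial => [n|N]; first exact: decay_ge0.
apply: (@le_trans _ _ (\sum_(n < N.+1) decay (q + 1) n%:R)).
  by rewrite big_ord_recr/= lerDl decay_ge0.
apply: le_trans (pseries_partial N q0) _; rewrite lerD2l ler_piMr ?invr_ge0 ?ltW//.
by rewrite ltrBlDr ltrDl expR_gt0.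
Qed.

Lemma pseries_int (q : R) : 0 < q ->
  (es (fun k => (decay (q + 1) (ab R k))%:E) < +oo)%E.
Proof.
move=> q0.
pose F (k : int) (n : nat) : \bar R := if n == `|k|%N then (decay (q + 1) n%:R)%:E else 0%E.
have F0 k n : (0 <= F k n)%E by rewrite /F; case: ifP; rewrite ?lee_fin ?decay_ge0.
rewrite (eq_es (g := fun k => es (F k))); last first.
  move=> k; rewrite /F (eq_es (g := fun n : nat => if n == `|k|%N then (decay (q + 1) `|k|%N%:R)%:E else 0%E)).
    by rewrite es_set1 ?lee_fin ?decay_ge0// /ab -intr_norm -abszE.
  by move=> n; case: eqP => [->|].
rewrite es_fubini//.
apply: (@le_lt_trans _ _ (es (fun n : nat => (2 : R)%:E * (decay (q + 1) n%:R)%:E)%E)); last first.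
  rewrite esZ//; last by move=> n; rewrite lee_fin decay_ge0.
  by apply: lte_mul_pinfty => //; apply: le_lt_trans (pseries_nat q0) _; rewrite ltry.
apply: le_es => n; pose x := (decay (q + 1) n%:R)%:E.
have x0 : (0 <= x)%E by rewrite lee_fin decay_ge0.
apply: (@le_trans _ _ (es (fun k : int => (if k == n%:Z then x else 0%E) + (if k == (- n%:Z)%R then x else 0%E))%E)).
  apply: le_es => k; rewrite /F -/x; case: eqP => [nk|_]; last by rewrite adde_ge0//; case: ifP.
  case: (k =P n%:Z) => [_|k1]; first by rewrite leeDl//; case: ifP.
  by rewrite ifT ?add0e//; apply/eqP; lia.
rewrite esD; [|by move=> k; case: ifP..].
by rewrite !es_set1// -EFinD -EFinM lee_fin; lra.
Qed.

End PSeries.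

Section OdeComparison.
Variable R : realType.

(** The difference of the two sides is nondecreasing by the mean value theorem.
    *)
Lemma exp_comparison (f df : R -> R) (a b m B : R) : a <= b -> 0 < m ->
  (forall x, a <= x <= b -> is_derive x 1 f (df x)) -> f a = 0 ->
  (forall x, a <= x <= b -> df x <= B * expR (m * (x - a))) -> 0 <= B ->
  f b <= B / m * expR (m * (b - a)).
Proof.
move=> ab m0 hd fa hB B0.
have [<-|/eqP nab] := a =P b; first by rewrite fa !mulr_ge0 ?invr_ge0 ?expR_ge0// ltW.
have {}ab : a < b by rewrite lt_neqAle nab.
pose g x := B / m * expR (m * (x - a)) - f x.
have dg x : a <= x <= b -> is_derive x 1 g (B * expR (m * (x - a)) - df x).
  move=> /hd hx; rewrite /g.
  have h1 : is_derive x 1 (fun x => m * (x - a)) m.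
    by apply: is_derive_eq; rewrite /GRing.scale/=; ring.
  have h2 := is_derive_expR (m * (x - a)).
  have h3 := @is_derive1_comp R expR (fun x => m * (x - a)) x _ _ h2 h1.
  apply: is_derive_eq; rewrite /GRing.scale/=; field.
  by rewrite gt_eqF.
have [||c cab gE] := @MVT R g (fun x => B * expR (m * (x - a)) - df x) a b ab.
- by move=> x; rewrite in_itv/= => /andP[h1 h2]; apply: dg; rewrite !ltW.
- apply: derivable_within_continuous => x; rewrite in_itv/= => hx.
  by have := dg x hx; case.
have gab : 0 <= g b - g a.
  rewrite gE mulr_ge0 ?subr_ge0 ?(ltW ab)// hB//.
  by move: cab; rewrite in_itv/= => /andP[h1 h2]; rewrite !ltW.
have : 0 <= g a by rewrite /g fa subr0 !mulr_ge0 ?invr_ge0 ?expR_ge0// ltW.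
by move: gab; rewrite {1}/g; lra.
Qed.

(** The curve is projected on the direction of its value at the end point. *)
Lemma exp_comparisonC (z dz : R -> R[i]) (a b m B : R) : a <= b -> 0 < m -> 0 <= B ->
  (forall c x, a <= x <= b -> is_derive x 1 (fun x => complex.Re (c * z x)) (complex.Re (c * dz x))) ->
  z a = 0 -> (forall x, a <= x <= b -> nc (dz x) <= B * expR (m * (x - a))) ->
  nc (z b) <= B / m * expR (m * (b - a)).
Proof.
move=> ab m0 B0 hd za hB.
have [c nc1 cz] := nc_rotate (z b).
have -> : nc (z b) = complex.Re (c * z b) by rewrite cz.
apply: (@exp_comparison (fun x => complex.Re (c * z x)) (fun x => complex.Re (c * dz x))) => //.
- by rewrite za; case: (c) => ? ?; rewrite cReM /= !mulr0 subr0.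
- move=> x hx; apply: le_trans (hB x hx); apply: le_trans (ler_norm _) _.
  by apply: le_trans (Re_le_nc _) _; rewrite Normc.normcM nc1 mul1r.
Qed.

End OdeComparison.

Section LocalUniqueness.
Variable R : realType.
Implicit Types (j k l : int) (a b : int -> R[i]) (t c : R[i]).
Local Notation C := R[i].

Lemma weight_gap3 (rho e : R) : 0 < e -> e <= 1 -> exists2 D : R, 0 <= D &
  forall k, (1 + ab R k) ^+ 3 * weight rho k <= D * weight (rho + 3 * e) k.
Proof.
move=> e0 e1; exists (e^-1 ^+ 3); first by rewrite exprn_ge0// invr_ge0 ltW.
move=> k.
have g r : (1 + ab R k) * weight r k <= e^-1 * weight (r + e) k.
  have := @weight_gap R r (r + e) k; rewrite ltrDl [X in X - r]addrC addrK; apply => //.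
  by rewrite lerD2l.
have a1 : 0 <= 1 + ab R k by rewrite addr_ge0 ?ab_ge0.
have e' : 0 <= e^-1 by rewrite invr_ge0 ltW.
rewrite (_ : rho + 3 * e = rho + e + e + e); last by ring.
have -> : (1 + ab R k) ^+ 3 * weight rho k = (1 + ab R k) * ((1 + ab R k) * ((1 + ab R k) * weight rho k)) by ring.
have -> : e^-1 ^+ 3 * weight (rho + e + e + e) k = e^-1 * (e^-1 * (e^-1 * weight (rho + e + e + e) k)) by ring.
apply: (@le_trans _ _ ((1 + ab R k) * ((1 + ab R k) * (e^-1 * weight (rho + e) k)))).
  by rewrite !ler_wpM2l.
rewrite [X in _ * X <= _]mulrCA [leLHS]mulrCA ler_wpM2l//.
apply: (@le_trans _ _ ((1 + ab R k) * (e^-1 * weight (rho + e + e) k))).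
  by rewrite ler_wpM2l.
by rewrite mulrCA ler_wpM2l.
Qed.

Lemma es_decay2 : (es (fun k => ((1 + ab R k) ^- 2)%:E) < +oo)%E.
Proof.
have := @pseries_int R 1 ltr01; congr (_ < +oo)%E; apply: eq_es => k; congr EFin.
have a1 : 0 < 1 + ab R k by rewrite ltr_pwDl ?ab_ge0.
rewrite /decay (_ : - (1 + 1) * ln (1 + ab R k) = - (ln (1 + ab R k) + ln (1 + ab R k))); last by ring.
by rewrite expRN expRD lnK ?posrE// expr2.
Qed.

(** By [omE] this is the weight at rho times e^(- m tau (1 + |k|)), whose decay
    gains a derivative when it is integrated in time; in the form of the
    definition, [kern_bnd] applies at each time. *)
Definition om (rho m tau : R) k : R := expR (- (m * tau)) * weight (rho - m * tau / (2 * pi)) k.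

Lemma omE rho m tau k : om rho m tau k = weight rho k * expR (- (m * tau * (1 + ab R k))).
Proof.
rewrite /om /weight mulrCA -[RHS]mulrA; congr (_ * _); rewrite -!expRD; congr expR.
have : 2 * pi != 0 :> R by rewrite gt_eqF// mulr_gt0 ?pi_gt0.
by move: (2 * pi) => P P0; field.
Qed.

Section Step.
Variables (V1 V2 : R -> int -> C) (t : C) (delta s0 e M : R).
Hypotheses (d0 : 0 < delta) (d1 : delta <= 1) (e0 : 0 < e) (M0 : 0 <= M).
Hypothesis bnd1 : forall r, s0 <= r <= s0 + e -> (nrm delta (V1 r) <= M%:E)%E.
Hypothesis bnd2 : forall r, s0 <= r <= s0 + e -> (nrm delta (V2 r) <= M%:E)%E.
Hypothesis der1 : forall c k r, s0 <= r <= s0 + e ->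
  is_derive r 1 (fun r => complex.Re (c * V1 r k)) (complex.Re (c * (t * Gam (V1 r) (V1 r) k))).
Hypothesis der2 : forall c k r, s0 <= r <= s0 + e ->
  is_derive r 1 (fun r => complex.Re (c * V2 r k)) (complex.Re (c * (t * Gam (V2 r) (V2 r) k))).
Hypothesis init : V1 s0 = V2 s0.

Let rho := delta / 2.
Let z r k := V1 r k - V2 r k.

(** A polarisation which puts the difference on each factor in turn. *)
Lemma Gam_diff r k : s0 <= r <= s0 + e ->
  Gam (V1 r) (V1 r) k - Gam (V2 r) (V2 r) k =
  csum (fun j => kern R j (k - j) * (z r j * V1 r (k - j) + V2 r j * z r (k - j))).
Proof.
move=> hr; have rho0 : 0 <= rho by rewrite divr_ge0// ltW.
have rd : rho < delta by rewrite /rho; move: d0; lra.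
have rd1 : delta <= rho + 1 by move: rho0 d1; lra.
have m (V : R -> int -> C) : (nrm delta (V r) <= M%:E)%E ->
    csummable (fun j => kern R j (k - j) * V r j * V r (k - j)).
  move=> h; apply: (Gam_summable k rho0 _ (nrm1_gap rd rd1 h)).
  by apply: le_trans h; exact: nrm_mono (ltW rd).
rewrite /Gam -csumB; [|exact: m (bnd1 hr)|exact: m (bnd2 hr)].
by apply: eq_csum => j; rewrite /z; ring.
Qed.

(** A function Y with om |z_k| <= Y_k on the time interval can be replaced by a
    constant times (m (1 + |k|))^-1 times convolutions of Y and of (1 + |k|) Y_k
    with a summable bound of the two solutions.  The sum of (1 + |k|) Y_k is
    halved at each step if m is large, so z vanishes. *)
Theorem local_unique : exists2 eta, 0 < eta &
  forall r, s0 <= r <= s0 + eta -> r <= s0 + e -> V1 r = V2 r.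
Proof.
have rho0 : 0 < rho by rewrite divr_gt0.
have e6 : 0 < delta / 6 by rewrite divr_gt0.
have [|D D0 hD] := @weight_gap3 rho (delta / 6) e6; first by move: d1 e6; lra.
have rhoD : rho + 3 * (delta / 6) = delta by rewrite /rho; field.
rewrite rhoD in hD.
have ab1 k : 0 < 1 + ab R k by rewrite ltr_pwDl ?ab_ge0.
(* three powers of 1 + |k| come from the gap between delta / 2 and delta: one is
   kept for the lost derivative, two make b summable *)
pose b k := M * D * (1 + ab R k) ^- 2.
have b0 k : 0 <= b k by rewrite !mulr_ge0// invr_ge0 sqr_ge0.
have hb V k : (nrm delta V <= M%:E)%E -> (1 + ab R k) * (weight rho k * nc (V k)) <= b k.
  move=> hV; have hw : weight delta k * nc (V k) <= M.
    by rewrite -lee_fin; apply: le_trans hV; exact: nrm_term.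
  rewrite /b ler_pdivlMr ?exprn_gt0//.
  rewrite (_ : _ * _ * _ = ((1 + ab R k) ^+ 3 * weight rho k) * nc (V k)); last by ring.
  apply: (@le_trans _ _ (D * weight delta k * nc (V k))); first by rewrite ler_wpM2r ?nc_ge0.
  by rewrite -mulrA mulrC ler_wpM2r.
have sb : (es (fun k => (b k)%:E) < +oo)%E.
  rewrite (eq_es (g := fun k => ((M * D)%:E * ((1 + ab R k) ^- 2)%:E)%E))//.
  rewrite esZ ?mulr_ge0//; last by move=> k; rewrite lee_fin invr_ge0 sqr_ge0.
  by apply: lte_mul_pinfty es_decay2 => //; rewrite lee_fin mulr_ge0.
clearbody b.
have sbE := es_fineK (f := fun k => (b k)%:E) b0 sb.
set Sb := fine _ in sbE.
have Sb0 : 0 <= Sb by rewrite fine_ge0// es_ge0.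
have tau0 := nc_ge0 t; have K00 := ltW (K0_gt0 R).
pose KK := nc t * K0 R.
have KK0 : 0 <= KK by rewrite mulr_ge0.
pose m := 4 * KK * Sb + 1.
have m0 : 0 < m by rewrite ltr_wpDl// !mulr_ge0.
have pi20 : 0 < 2 * pi :> R by rewrite mulr_gt0// pi_gt0.
(* up to this time the radius in [om] stays nonnegative *)
pose eta := 2 * pi * rho / m.
exists eta; first by rewrite divr_gt0// mulr_gt0.
pose A0 := 2 * Sb.
have rtau r : s0 <= r <= s0 + eta -> 0 <= rho - m * (r - s0) / (2 * pi) <= rho.
  move=> /andP[h1 h2]; apply/andP; split.
    rewrite subr_ge0 ler_pdivrMr// mulrC -ler_pdivlMr//.
    by rewrite (_ : rho * (2 * pi) / m = eta); [lra|rewrite /eta; ring].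
  by rewrite gerBl divr_ge0 ?(ltW pi20)// mulr_ge0 ?(ltW m0)// subr_ge0.
suff key n : exists Y : int -> R, [/\ forall k, 0 <= Y k,
    (es (fun k => ((1 + ab R k) * Y k)%:E) <= (A0 * 2^-1 ^+ n)%:E)%E &
    forall r k, s0 <= r <= s0 + eta -> r <= s0 + e -> om rho m (r - s0) k * nc (z r k) <= Y k].
  move=> r hr re; apply/funext => k.
  have o0 : 0 < om rho m (r - s0) k by rewrite mulr_gt0 ?expR_gt0 ?weight_gt0.
  have hz n : om rho m (r - s0) k * nc (z r k) <= A0 * 2^-1 ^+ n.
    have [Y [Y0 hY hYz]] := key n; apply: le_trans (hYz r k hr re) _.
    rewrite -lee_fin; apply: le_trans hY.
    apply: le_trans (term_le_es (f := fun k => ((1 + ab R k) * Y k)%:E) k _).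
      by rewrite lee_fin ler_peMl// lerDl ab_ge0.
    by move=> i; rewrite lee_fin mulr_ge0// ltW.
  have c0 : (A0 * 2^-1 ^+ n) @[n --> \oo] --> (0 : R).
    rewrite -[X in _ --> X](mulr0 A0); apply: cvgM; first exact: cvg_cst.
    by apply: cvg_expr; rewrite ger0_norm; lra.
  have : om rho m (r - s0) k * nc (z r k) <= 0.
    rewrite -(cvg_lim _ c0)//; apply: limr_ge; first by apply/cvg_ex; exists 0.
    by apply: nearW => n; exact: hz.
  rewrite pmulr_rle0// => nz0; apply/eqP; rewrite -subr_eq0; apply/eqP/nc_eq0/eqP.
  by rewrite eq_le nc_ge0 andbT.
have hom r k : s0 <= r <= s0 + eta -> om rho m (r - s0) k <= weight rho k.
  move=> hr; have /andP[h1 h2] := rtau r hr.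
  rewrite omE ler_piMr ?weight_ge0// -[leRHS]expR0 ler_expR oppr_le0.
  rewrite !mulr_ge0 ?(ltW m0) ?(ltW (ab1 k))//.
  by rewrite subr_ge0; case/andP: hr.
elim: n => [|n [Y [Y0 hY hYz]]].
  exists (fun k => 2 * b k / (1 + ab R k)); split.
  - by move=> k; apply: divr_ge0; [apply: mulr_ge0|exact: ltW].
  - rewrite expr0 mulr1 (eq_es (g := fun k => ((2 : R)%:E * (b k)%:E)%E)); last first.
      by move=> k; rewrite -EFinM; congr EFin; field; rewrite gt_eqF.
    by rewrite esZ// sbE -EFinM.
  - move=> r k hr re; have hr' : s0 <= r <= s0 + e by rewrite re andbT; case/andP: hr.
    apply: (@le_trans _ _ (weight rho k * nc (z r k))).
      by rewrite ler_wpM2r ?nc_ge0 ?hom.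
    rewrite ler_pdivlMr// mulrC.
    have h1 := hb _ k (bnd1 hr'); have h2 := hb _ k (bnd2 hr').
    apply: (@le_trans _ _ ((1 + ab R k) * (weight rho k * (nc (V1 r k) + nc (V2 r k))))).
      rewrite ler_wpM2l ?(ltW (ab1 k))// ler_wpM2l ?weight_ge0//.
      by rewrite /z; apply: le_trans (le_normcD _ _) _; rewrite normcN.
    by rewrite mulrDr mulrDr; lra.
set A := A0 * 2^-1 ^+ n in hY *.
pose Y1 k := (1 + ab R k) * Y k.
have Y10 k : 0 <= Y1 k by rewrite mulr_ge0// ltW.
have YY1 k : Y k <= Y1 k by rewrite ler_peMl// lerDl ab_ge0.
pose G k := es (fun j => (Y j * b (k - j) + b j * Y1 (k - j))%R%:E).
have G0 k : (0 <= G k)%E by apply: es_ge0 => j; rewrite lee_fin addr_ge0// mulr_ge0.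
have A_ge0 : 0 <= A.
  by rewrite -lee_fin; apply: le_trans hY; apply: es_ge0 => k; rewrite lee_fin; exact: Y10.
have hG : (es G <= (2 * Sb * A)%:E)%E.
  rewrite /G (eq_es (g := fun k => es (fun j => (Y j)%:E * (b (k - j)%R)%:E) +
     es (fun j => (b j)%:E * (Y1 (k - j)%R)%:E)))%E; last first.
    move=> k; rewrite -esD; first by apply: eq_es => j; rewrite EFinD !EFinM.
      by move=> j; rewrite mule_ge0// lee_fin.
    by move=> j; rewrite mule_ge0// lee_fin.
  rewrite esD; first last.
  - by move=> k; apply: es_ge0 => j; rewrite mule_ge0// lee_fin.
  - by move=> k; apply: es_ge0 => j; rewrite mule_ge0// lee_fin.
  have fY1 : es (fun k => (Y1 k)%:E) \is a fin_num.
    by rewrite ge0_fin_numE ?es_ge0//; apply: le_lt_trans hY _; rewrite ltry.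
  rewrite (es_prod (p := fun k => (Y k)%:E) (q := fun k => (b k)%:E))//; last by rewrite sbE.
  rewrite (es_prod (p := fun k => (b k)%:E) (q := fun k => (Y1 k)%:E))//.
  have h1 : (es (fun k => (Y k)%:E) <= A%:E)%E.
    by apply: le_trans hY; apply: le_es => k; rewrite lee_fin YY1.
  rewrite sbE (_ : 2 * Sb * A = A * Sb + Sb * A); last by ring.
  rewrite EFinD !EFinM leeD//; first by rewrite lee_wpmul2r// lee_fin.
  by rewrite lee_wpmul2l// lee_fin.
have Gfin k : G k = (fine (G k))%:E.
  by apply: es_fin_term => //; apply: le_lt_trans hG _; rewrite ltry.
have fG0 k : 0 <= fine (G k) by rewrite fine_ge0.
exists (fun k => KK * fine (G k) / (m * (1 + ab R k))); split.
- by move=> k; rewrite divr_ge0 ?mulr_ge0 ?(ltW m0)// ltW.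
- rewrite (eq_es (g := fun k => ((KK / m)%:E * G k)%E)); last first.
    move=> k; rewrite [in RHS]Gfin -EFinM; congr EFin; field.
    by rewrite !gt_eqF.
  rewrite esZ ?divr_ge0 ?(ltW m0)//.
  apply: le_trans (lee_wpmul2l _ hG) _; first by rewrite lee_fin divr_ge0 ?(ltW m0).
  rewrite -EFinM lee_fin (_ : A0 * 2^-1 ^+ n.+1 = 2^-1 * A); last by rewrite exprS mulrCA.
  rewrite (_ : KK / m * (2 * Sb * A) = (4 * KK * Sb / m) * (2^-1 * A)); last by field; rewrite gt_eqF.
  have h : 4 * KK * Sb / m <= 1 by rewrite ler_pdivrMr// mul1r /m lerDl.
  apply: (@le_trans _ _ (1 * (2^-1 * A))); last by rewrite mul1r.
  by rewrite ler_wpM2r// mulr_ge0.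
- move=> r k /andP[sr re'] re.
  have w0 := weight_gt0 rho k; have a0 := ab1 k.
  rewrite omE mulrAC ler_pdivlMr ?mulr_gt0//.
  have mk0 : 0 < m * (1 + ab R k) by rewrite mulr_gt0.
  have hz : nc (z r k) <= (KK * fine (G k) / weight rho k) / (m * (1 + ab R k)) *
      expR (m * (1 + ab R k) * (r - s0)).
    apply: (@exp_comparisonC _ (fun x => z x k)
      (fun x => t * (Gam (V1 x) (V1 x) k - Gam (V2 x) (V2 x) k))) => //.
    + by rewrite divr_ge0 ?mulr_ge0// ltW.
    + move=> c x /andP[sx xr].
      have hx : s0 <= x <= s0 + e by rewrite sx (le_trans xr re).
      have q1 := der1 c k hx; have q2 := der2 c k hx.
      rewrite (_ : (fun x => complex.Re (c * z x k)) =
         (fun x => complex.Re (c * V1 x k) - complex.Re (c * V2 x k))); last first.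
        by apply/funext => y; rewrite -cReN -cReD /z mulrBr.
      by apply: is_derive_eq; rewrite -cReN -cReD !mulrBr.
    + by rewrite /z init subrr.
    + move=> x /andP[sx xr].
      have hx : s0 <= x <= s0 + e by rewrite sx (le_trans xr re).
      have hx' : s0 <= x <= s0 + eta by rewrite sx (le_trans xr re').
      have /andP[p0 p1] := rtau x hx'.
      set rt := rho - m * (x - s0) / (2 * pi) in p0 p1.
      set E := expR (- (m * (x - s0))).
      have E0 : 0 <= E by exact: expR_ge0.
      have omx j : om rho m (x - s0) j = E * weight rt j by [].
      have ox0 : 0 < om rho m (x - s0) k by rewrite mulr_gt0 ?expR_gt0 ?weight_gt0.
      have hVb V j : (nrm delta V <= M%:E)%E -> (1 + ab R j) * (weight rt j * nc (V j)) <= b j.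
        move=> hV; apply: le_trans (hb V j hV).
        by rewrite ler_wpM2l ?(ltW (ab1 j))// ler_wpM2r ?nc_ge0// weight_mono.
      have main : om rho m (x - s0) k * nc (Gam (V1 x) (V1 x) k - Gam (V2 x) (V2 x) k) <= K0 R * fine (G k).
        rewrite Gam_diff// -lee_fin EFinM.
        apply: (@le_trans _ _ ((om rho m (x - s0) k)%:E * es (fun j =>
          (nc (kern R j (k - j) * (z x j * V1 x (k - j) + V2 x j * z x (k - j))))%:E))%E).
          by rewrite lee_wpmul2l ?lee_fin ?(ltW ox0)// nc_csum.
        rewrite -esZ ?(ltW ox0)//; last by move=> j; rewrite lee_fin nc_ge0.
        rewrite [leRHS]EFinM -Gfin -esZ//; last by move=> j; rewrite lee_fin addr_ge0// mulr_ge0.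
        apply: le_es => j; rewrite -!EFinM lee_fin.
        set l := k - j.
        have hk := @kern_bnd R rt j l p0; rewrite {1}/l subrKC in hk.
        have hzj := hYz x j hx' (le_trans xr re).
        have hzl := hYz x l hx' (le_trans xr re).
        have h1 := hVb _ l (bnd1 hx); have h2 := hVb _ j (bnd2 hx).
        rewrite omx in hzj; rewrite omx in hzl; rewrite omx.
        have z1 := nc_ge0 (z x j); have z2 := nc_ge0 (z x l).
        have v1 := nc_ge0 (V1 x l); have v2 := nc_ge0 (V2 x j).
        have wj := weight_ge0 rt j; have wl := weight_ge0 rt l.
        have al := ltW (ab1 l); have aj := ab_ge0 R j.
        rewrite Normc.normcM.
        apply: (@le_trans _ _ (E * (weight rt k * nc (kern R j l)) * (nc (z x j) * nc (V1 x l) + nc (V2 x j) * nc (z x l)))).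
          rewrite [leLHS](_ : _ = E * (weight rt k * nc (kern R j l)) * nc (z x j * V1 x l + V2 x j * z x l)); last by ring.
          apply: ler_wpM2l; first by apply: mulr_ge0 => //; apply: mulr_ge0; rewrite ?weight_ge0 ?nc_ge0.
          by apply: le_trans (le_normcD _ _) _; rewrite !Normc.normcM.
        apply: (@le_trans _ _ (E * (K0 R * (weight rt j * ((1 + ab R l) * weight rt l))) * (nc (z x j) * nc (V1 x l) + nc (V2 x j) * nc (z x l)))).
          by rewrite ler_wpM2r ?addr_ge0 ?mulr_ge0// ler_wpM2l.
        rewrite (_ : E * (K0 R * (weight rt j * ((1 + ab R l) * weight rt l))) * (nc (z x j) * nc (V1 x l) + nc (V2 x j) * nc (z x l)) =
          K0 R * ((E * weight rt j * nc (z x j)) * ((1 + ab R l) * (weight rt l * nc (V1 x l))) +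
            (weight rt j * nc (V2 x j)) * ((1 + ab R l) * (E * weight rt l * nc (z x l))))); last by ring.
        rewrite ler_wpM2l// lerD//.
          apply: ler_pM => //.
            by apply: mulr_ge0 => //; apply: mulr_ge0.
          by apply: mulr_ge0 => //; apply: mulr_ge0.
        apply: ler_pM.
        + by apply: mulr_ge0.
        + by apply: mulr_ge0 => //; apply: mulr_ge0 => //; apply: mulr_ge0.
        + apply: le_trans h2; rewrite ler_peMl//; first by apply: mulr_ge0.
          by rewrite lerDl.
        + by rewrite /Y1 ler_wpM2l.
      rewrite Normc.normcM.
      rewrite (_ : KK * fine (G k) / weight rho k * expR (m * (1 + ab R k) * (x - s0)) =
         nc t * ((K0 R * fine (G k)) / om rho m (x - s0) k)); last first.
        rewrite omE expRN /KK [m * _ * _]mulrAC; field.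
        by rewrite !gt_eqF ?expR_gt0.
      by rewrite ler_wpM2l// ler_pdivlMr// mulrC.
  apply: (@le_trans _ _ (weight rho k * expR (- (m * (r - s0) * (1 + ab R k))) *
     (KK * fine (G k) / weight rho k / (m * (1 + ab R k)) * expR (m * (1 + ab R k) * (r - s0))) *
     (m * (1 + ab R k)))).
    rewrite (ler_pM2r mk0) [leLHS]mulrAC; apply: ler_wpM2l => //.
    by apply: mulr_ge0; rewrite ?expR_ge0 ?(ltW w0).
  rewrite (_ : m * (1 + ab R k) * (r - s0) = m * (r - s0) * (1 + ab R k)); last by ring.
  rewrite expRN le_eqVlt; apply/orP; left; apply/eqP; field.
  by rewrite !gt_eqF ?expR_gt0.
Qed.

End Step.
End LocalUniqueness.

(** Real induction: the supremum of the radii r such that P holds on [0, r] is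
    1. *)
Lemma interval_induction (R : realType) (P : R -> Prop) :
  P 0 ->
  (forall s0, 0 <= s0 < 1 -> (forall x, 0 <= x <= s0 -> P x) ->
     exists2 eta, 0 < eta & forall r, s0 <= r <= s0 + eta -> r <= 1 -> P r) ->
  (forall s0, 0 < s0 <= 1 -> (forall x, 0 <= x < s0 -> P x) -> P s0) ->
  forall r, 0 <= r <= 1 -> P r.
Proof.
move=> P0 Pstep Plim.
pose S := [set r : R | 0 <= r <= 1 /\ forall x, 0 <= x <= r -> P x].
have S0 : S 0.
  split=> [|x hx]; first by rewrite lexx ler01.
  by rewrite (_ : x = 0)//; apply: le_anti; rewrite andbC.
have Sub : has_sup S by split; [exists 0|exists 1 => r [/andP[]]].
have s0 : 0 <= sup S by apply: ub_le_sup => //; case: Sub.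
have s1 : sup S <= 1 by apply: ge_sup; [exists 0|move=> r [/andP[]]].
have below x : 0 <= x < sup S -> P x.
  move=> /andP[x0 xs]; have e0 : 0 < sup S - x by rewrite subr_gt0.
  have [r [_ hr] rx] := sup_adherent e0 Sub; apply: hr; rewrite x0 ltW//.
  by move: rx; rewrite opprB addrC subrK.
have at_s : P (sup S).
  have [->//|sn0] := eqVneq (sup S) 0.
  by apply: Plim => //; rewrite lt_neqAle eq_sym sn0 s0.
have upto x : 0 <= x <= sup S -> P x.
  move=> /andP[x0]; rewrite le_eqVlt => /orP[/eqP->//|xs].
  by apply: below; rewrite x0.
have [s_lt1|s_ge1] := ltP (sup S) 1; last first.
  by move=> r /andP[r0 r1]; apply: upto; rewrite r0 (le_trans r1).
have [|eta eta0 heta] := Pstep (sup S) _ upto; first by rewrite s0.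
pose r1 := Num.min (sup S + eta) 1.
have r1s : sup S < r1 by rewrite lt_min s_lt1 ltrDl eta0.
suff : S r1 by move/(ub_le_sup (proj2 Sub)); rewrite leNgt r1s.
split; first by rewrite (le_trans s0 (ltW r1s)) ge_min lexx orbT.
move=> x /andP[x0 xr]; have [xs|/ltW sx] := leP x (sup S); first by apply: upto; rewrite x0.
by move: xr; rewrite le_min => /andP[xr x1]; apply: heta => //; rewrite sx.
Qed.

Section GlobalUniqueness.
Variable R : realType.
Variables (V1 V2 : R -> int -> R[i]) (t : R[i]) (delta : R).
Hypotheses (d0 : 0 < delta) (d1 : delta <= 1).
Hypothesis bnd1 : forall s0, 0 <= s0 < 1 -> exists2 e, 0 < e & exists M,
  forall r, s0 <= r <= s0 + e -> r <= 1 -> (nrm delta (V1 r) <= M%:E)%E.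
Hypothesis bnd2 : forall s0, 0 <= s0 < 1 -> exists2 e, 0 < e & exists M,
  forall r, s0 <= r <= s0 + e -> r <= 1 -> (nrm delta (V2 r) <= M%:E)%E.
Hypothesis der1 : forall (c : R[i]) (k : int) (r : R), 0 <= r <= 1 ->
  is_derive r 1 (fun r => complex.Re (c * V1 r k)) (complex.Re (c * (t * Gam (V1 r) (V1 r) k))).
Hypothesis der2 : forall (c : R[i]) (k : int) (r : R), 0 <= r <= 1 ->
  is_derive r 1 (fun r => complex.Re (c * V2 r k)) (complex.Re (c * (t * Gam (V2 r) (V2 r) k))).
Hypothesis init : V1 0 = V2 0.

Theorem global_unique r : 0 <= r <= 1 -> V1 r = V2 r.
Proof.
move: r; apply: interval_induction => //.
- move=> s0 /andP[s00 s01] heq.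
  have hs0 : 0 <= s0 < 1 by rewrite s00.
  have [e1 e10 [M1 hM1]] := bnd1 hs0; have [e2 e20 [M2 hM2]] := bnd2 hs0.
  pose e := Num.min (Num.min e1 e2) (1 - s0).
  have e0 : 0 < e by rewrite !lt_min e10 e20 subr_gt0.
  have ein r : s0 <= r <= s0 + e -> [/\ s0 <= r <= s0 + e1, s0 <= r <= s0 + e2, r <= 1 & 0 <= r <= 1].
    move=> /andP[h1 h2].
    have ee1 : e <= e1 by rewrite !ge_min lexx.
    have ee2 : e <= e2 by rewrite !ge_min lexx orbT.
    have e3 : e <= 1 - s0 by rewrite !ge_min lexx !orbT.
    by rewrite h1/=; move: e h2 ee1 ee2 e3 {e0} => e h2 ee1 ee2 e3; split; lra.
  pose M := Num.max 0 (Num.max M1 M2).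
  have M0 : 0 <= M by rewrite le_max lexx.
  have [|||||eta eta0 heta] := @local_unique R V1 V2 t delta s0 e M d0 d1 M0.
  + move=> r /ein[h1 _ h2 _]; apply: le_trans (hM1 r h1 h2) _.
    by rewrite lee_fin !le_max lexx orbT.
  + move=> r /ein[_ h1 h2 _]; apply: le_trans (hM2 r h1 h2) _.
    by rewrite lee_fin !le_max lexx !orbT.
  + by move=> c k r /ein[_ _ _ h]; exact: der1.
  + by move=> c k r /ein[_ _ _ h]; exact: der2.
  + by apply: heq; rewrite s00 lexx.
  exists (Num.min eta e); first by rewrite lt_min eta0.
  move=> r /andP[h1 h2] _; apply: heta.
  + by rewrite h1 (le_trans h2)// lerD2l ge_min lexx.
  + by rewrite (le_trans h2)// lerD2l ge_min lexx orbT.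
- move=> s0 /andP[s00 s01] heq; apply/funext => k.
  have hs0 : 0 <= s0 <= 1 by rewrite ltW.
  have rez c : complex.Re (c * V1 s0 k) = complex.Re (c * V2 s0 k).
    have cont f df : is_derive s0 1 f df -> f x @[x --> s0^'-] --> (f s0 : R).
      move=> [h _]; apply: cvg_at_left_filter.
      by apply: differentiable_continuous; exact/derivable1_diffP.
    have c1 := cont _ _ (der1 c k hs0); have c2 := cont _ _ (der2 c k hs0).
    apply: cvg_unique c1 _ => //=; apply: cvg_trans c2; apply: near_eq_cvg.
    near=> x; rewrite heq//; apply/andP; split; last by [].
    by near: x; apply: nbhs_left_ge.
  apply/eqP; rewrite eq_complex; apply/andP; split; apply/eqP.
    by have := rez 1; rewrite !mul1r.
  have := rez 'i%C; case: (V1 s0 k) => a b; case: (V2 s0 k) => a' b' /=.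
  by rewrite !mul0r !mul1r !sub0r => /oppr_inj.
Unshelve. all: by end_near.
Qed.

End GlobalUniqueness.

(** * Comparison of the norms *)

Section NormComparison.
Variable R : realType.
Implicit Types (k : int) (a : int -> R[i]).

Definition gterm (delta sg : R) a k : R :=
  japanese R k `^ (2 * sg) * expR (4 * pi * delta * `|k%:~R|) * nc (a k) ^+ 2.

(** The norm of G^(delta,sg) as a function of the coefficients only. *)
Definition gnrm (delta sg : R) a : \bar R :=
  (es (fun k => (gterm delta sg a k)%:E) `^ (2^-1))%E.

Lemma GnormE delta sg f : Gnorm delta sg f = gnrm delta sg (fourier f).
Proof. by []. Qed.

Definition gwt (delta sg : R) k : R :=
  expR (sg * ln (japanese R k) + 2 * pi * delta * ab R k).

Lemma japanese_ge1 k : 1 <= japanese R k.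
Proof. by rewrite /japanese -[leLHS]sqrtr1 ler_wsqrtr// lerDl sqr_ge0. Qed.

Lemma japanese_bnd k : japanese R k <= 1 + ab R k <= 2 * japanese R k.
Proof.
have a0 := ab_ge0 R k; have j1 := japanese_ge1 k.
have jE : japanese R k ^+ 2 = 1 + ab R k ^+ 2.
  by rewrite /japanese sqr_sqrtr ?addr_ge0 ?sqr_ge0// /ab real_normK// num_real.
by apply/andP; split; nra.
Qed.

Lemma gtermE delta sg a k : gterm delta sg a k = (gwt delta sg k * nc (a k)) ^+ 2.
Proof.
have j1 := japanese_ge1 k.
rewrite /gterm /powR gt_eqF ?(lt_le_trans ltr01)// exprMn; congr (_ * _).
rewrite -expRD /gwt expr2 -expRD; congr expR; rewrite /ab; ring.
Qed.

Lemma gwt_gt0 delta sg k : 0 < gwt delta sg k. Proof. exact: expR_gt0. Qed.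

Lemma gterm_ge0 delta sg a k : 0 <= gterm delta sg a k.
Proof. by rewrite gtermE sqr_ge0. Qed.

Lemma gnrm_le delta sg a (G : R) : 0 <= G ->
  (gnrm delta sg a <= G%:E)%E = (es (fun k => (gterm delta sg a k)%:E) <= (G ^+ 2)%:E)%E.
Proof.
move=> G0; rewrite /gnrm.
have : (0 <= es (fun k => (gterm delta sg a k)%:E))%E.
  by apply: es_ge0 => k; rewrite lee_fin gterm_ge0.
case: (es _) => [q q0| |//].
- rewrite poweR_EFin !lee_fin powR12_sqrt// -{1}(ger0_norm G0) -sqrtr_sqr.
  by rewrite ler_sqrt// sqr_ge0.
- by move=> _; rewrite poweRyr ?invr_eq0// !leye_eq.
Qed.

(** ln y <= y / lam - 1 + ln lam, with lam = sg / eta, turns the power sg of the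
    frequency into an exponential of rate eta = 2 pi (rho - delta). *)
Lemma gwt_le_wt (rho delta sg : R) : 0 < sg -> delta < rho ->
  exists2 C : R, 0 < C & forall k, gwt delta sg k <= C * weight rho k.
Proof.
move=> sg0 dr; pose eta := 2 * pi * (rho - delta).
have eta0 : 0 < eta by rewrite !mulr_gt0 ?pi_gt0 ?subr_gt0.
exists (expR (eta - sg + sg * ln (sg / eta))); first exact: expR_gt0.
move=> k; have a0 := ab_ge0 R k; have /andP[j1 _] := japanese_bnd k.
have j0 := japanese_ge1 k.
have lam0 : 0 < sg / eta by rewrite divr_gt0.
have hln : sg * ln (1 + ab R k) <= eta - sg + sg * ln (sg / eta) + eta * ab R k.
  have h : ln ((1 + ab R k) / (sg / eta)) <= (1 + ab R k) / (sg / eta) - 1.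
    rewrite -[X in ln X](subrK 1) addrC le_ln1Dx// ltrBDr addNr divr_gt0//.
    by rewrite ltr_pwDl.
  have := ler_wpM2l (ltW sg0) h; rewrite ln_div ?posrE ?ltr_pwDl//.
  rewrite (_ : sg * ((1 + ab R k) / (sg / eta) - 1) = eta * (1 + ab R k) - sg).
    by lra.
  by field; rewrite !gt_eqF.
rewrite /gwt /weight mulrCA; apply: (@le_trans _ _ (expR (eta - sg + sg * ln (sg / eta)) * expR (2 * pi * rho * ab R k))).
  rewrite -expRD ler_expR.
  have : sg * ln (japanese R k) <= sg * ln (1 + ab R k).
    rewrite ler_wpM2l ?(ltW sg0)// ler_ln ?posrE//; last by rewrite ltr_pwDl.
    exact: lt_le_trans j0.
  by move: hln; rewrite /eta; lra.
by rewrite ler_peMl ?mulr_ge0 ?expR_ge0// exprn_ege1// lerDl.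
Qed.

(** The l^2 norm is at most the l^1 norm: one of the two factors in each square
    is bounded by its sum. *)
Lemma gnrm_bnd (rho delta sg : R) : 0 < sg -> delta < rho ->
  exists2 C : R, 0 < C & forall a (N : R), (nrm rho a <= N%:E)%E -> (gnrm delta sg a <= (C * N)%:E)%E.
Proof.
move=> sg0 dr; have [C C0 hC] := gwt_le_wt sg0 dr; exists C => // a N hN.
have N0 : 0 <= N by rewrite -lee_fin (le_trans (nrm_ge0 _ _) hN).
have C0' := ltW C0.
rewrite gnrm_le ?mulr_ge0//.
apply: (@le_trans _ _ (((C * N) * C)%:E * nrm rho a)%E); last first.
  apply: le_trans (lee_wpmul2l _ hN) _; first by rewrite lee_fin !mulr_ge0.
  by rewrite -EFinM lee_fin le_eqVlt; apply/orP; left; apply/eqP; ring.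
rewrite /nrm -esZ; first last.
- by move=> k; rewrite lee_fin mulr_ge0 ?weight_ge0 ?nc_ge0.
- by rewrite !mulr_ge0.
apply: le_es => k; rewrite -EFinM lee_fin gtermE expr2 -[leRHS]mulrA.
have h1 : gwt delta sg k * nc (a k) <= C * (weight rho k * nc (a k)).
  by rewrite mulrA ler_wpM2r ?nc_ge0.
have h2 : weight rho k * nc (a k) <= N by rewrite -lee_fin; apply: le_trans hN; exact: nrm_term.
have g0 : 0 <= gwt delta sg k * nc (a k) by apply: mulr_ge0; rewrite ?nc_ge0// ltW// gwt_gt0.
by apply: ler_pM => //; apply: le_trans h1 _; rewrite ler_wpM2l.
Qed.

(** The Cauchy-Schwarz inequality in the form x y <= (G x^2 + y^2 / G) / 2,
    where G bounds the norm of a and x = (1 + |k|)^(-s). *)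
Lemma nrm_bnd (s : R) : 2^-1 < s ->
  exists2 K : R, 0 < K & forall delta a (G : R), 0 < G ->
    (gnrm delta (s + 3) a <= G%:E)%E -> (nrm delta a <= (K * G)%:E)%E.
Proof.
move=> hs; have q0 : 0 < 2 * s - 1 by move: hs; lra.
have dec_ge0 k : (0 <= (decay (2 * s - 1 + 1) (ab R k))%:E)%E by rewrite lee_fin expR_ge0.
have hP := es_fineK dec_ge0 (pseries_int q0).
set P := fine _ in hP; have P0 : 0 <= P by rewrite fine_ge0// es_ge0.
pose c := expR ((s + 3) * ln 2) : R; have c0 : 0 < c by exact: expR_gt0.
exists (c / 2 * (P + 1)); first by rewrite !mulr_gt0 ?invr_gt0 ?ltr_wpDl.
move=> delta a G G0; rewrite gnrm_le ?(ltW G0)// => hG.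
have wtE k : weight delta k <= c * (expR (- s * ln (1 + ab R k)) * gwt delta (s + 3) k).
  have a0 := ab_ge0 R k; have /andP[_ j2] := japanese_bnd k.
  have j0 : 0 < japanese R k := lt_le_trans ltr01 (japanese_ge1 k).
  have a1 : 0 < 1 + ab R k by rewrite ltr_pwDl.
  have h : ln (1 + ab R k) <= ln 2 + ln (japanese R k).
    by rewrite -lnM ?posrE// ler_ln// posrE mulr_gt0.
  rewrite /weight /gwt /c -!expRD -[X in X ^+ 3]lnK ?posrE// -expRM_natl -expRD ler_expR.
  have := ler_wpM2l _ h => /(_ (s + 3)); move: q0; lra.
(* the two terms of the inequality between the arithmetic and the geometric mean
   *)
pose u k := ((c * (G / 2))%:E * (decay (2 * s - 1 + 1) (ab R k))%:E)%E.
pose v k := ((c / (2 * G))%:E * (gterm delta (s + 3) a k)%:E)%E.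
have cG1 : 0 <= c * (G / 2) by rewrite mulr_ge0 ?divr_ge0 ?ltW.
have cG2 : 0 <= c / (2 * G) by rewrite divr_ge0 ?mulr_ge0 ?ltW.
apply: (@le_trans _ _ (es (fun k => u k + v k)%E)).
  apply: le_es => k; rewrite /u /v -!EFinM -EFinD lee_fin gtermE.
  have n0 := nc_ge0 (a k).
  apply: le_trans (ler_wpM2r n0 (wtE k)) _.
  rewrite (_ : decay _ _ = expR (- s * ln (1 + ab R k)) ^+ 2); last first.
    by rewrite /decay expr2 -expRD; congr expR; ring.
  set x := expR _; set y := gwt _ _ _ * _.
  have : 0 <= (G * x - y) ^+ 2 by exact: sqr_ge0.
  move=> xy0; rewrite -subr_ge0 (_ : _ - _ = c / (2 * G) * (G * x - y) ^+ 2); first exact: mulr_ge0.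
  by rewrite /y; field; rewrite gt_eqF.
rewrite esD; first last.
- by move=> k; rewrite mule_ge0// lee_fin gterm_ge0.
- by move=> k; rewrite mule_ge0// lee_fin.
rewrite !esZ//; last by move=> k; rewrite lee_fin gterm_ge0.
rewrite hP; apply: le_trans (leeD2l _ (lee_wpmul2l _ hG)) _; first by rewrite lee_fin.
rewrite -!EFinM -EFinD lee_fin le_eqVlt; apply/orP; left; apply/eqP; field.
by rewrite gt_eqF.
Qed.

End NormComparison.

(** * Complex derivatives of families of coefficients *)

Section Limits.
Variable R : realType.
Local Notation C := (R[i] : numFieldType).

Lemma cvge0P (T : Type) (F : set_system T) {FF : Filter F} (f : T -> \bar R) :
  (forall x, 0 <= f x)%E ->
  (f @ F --> (0 : \bar R)%E) <-> (forall e : R, 0 < e -> \forall x \near F, (f x <= e%:E)%E).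
Proof.
move=> f0; split=> [hf e e0|hf A].
  apply: (hf [set x | (x <= e%:E)%E]).
  have : \forall r \near (0 : R), r <= e by apply: filterS (lt_nbhsl e0) => y /ltW.
  by apply: filterS => r; rewrite /= lee_fin.
move=> hA; have /nbhs_ballP[e /= e0 he] : nbhs (0 : R) (fun r => A r%:E) := hA.
have e2 : 0 < e / 2 by rewrite divr_gt0.
apply: filterS (hf _ e2) => x hx; have := f0 x; move: hx.
case E : (f x) => [r| |] //; rewrite !lee_fin => h1 h2.
suff : A r%:E by rewrite /= E.
apply: he; rewrite /ball/= sub0r normrN ger0_norm//.
by apply: le_lt_trans h1 _; rewrite ltr_pdivrMr// ltr_pMr// ltr1n.
Qed.

Lemma dnbhs0C (P : R[i] -> Prop) : (\forall h \near (0 : C)^', P h) <->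
  exists2 eta : R, 0 < eta & forall h, h != 0 -> nc h < eta -> P h.
Proof.
split=> [/nbhs_ballP[e /= e0 he]|[eta eta0 he]].
  have er : e = (complex.Re e)%:C by move: e0; case: (e) => a b; rewrite ltcE /= => /andP[/eqP-> _].
  exists (complex.Re e); first by move: e0; rewrite er ltcR.
  move=> h h0 hlt; apply: he => //.
  by rewrite /ball/= sub0r normrN normr_nc er ltcR.
apply/nbhs_ballP; exists (eta%:C); first by rewrite /= ltcR.
by move=> h; rewrite /ball/= sub0r normrN normr_nc ltcR => h1 h2; apply: he.
Qed.

Lemma is_derive_eps (f : R -> R) (r df : R) :
  (forall e : R, 0 < e -> exists2 eta : R, 0 < eta & forall h, h != 0 -> `|h| < eta ->
     `|(f (r + h) - f r) / h - df| <= e) -> is_derive r 1 f df.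
Proof.
move=> hf; have c : (h^-1 *: (f (h *: 1 + r) - f r)) @[h --> (0 : R)^'] --> df.
  apply/cvgrPdist_le => e e0; have [eta eta0 heta] := hf e e0.
  near=> h; rewrite distrC /GRing.scale/= mulr1 [h + r]addrC mulrC; apply: heta.
    by near: h; exact: nbhs_dnbhs_neq.
  by near: h; exact: dnbhs0_lt.
by apply: DeriveDef; [apply/cvg_ex; exists df|exact: cvg_lim c].
Unshelve. all: by end_near.
Qed.

End Limits.

Section CoefficientDerivative.
Variable R : realType.
Implicit Types (k : int) (U : R[i] -> int -> R[i]) (w : int -> R[i]) (t h : R[i]).

(** The complex derivative at t for the norm [nrm delta]. *)
Definition cder (delta : R) U t w := forall e : R, 0 < e ->
  exists2 eta : R, 0 < eta & forall h, h != 0 -> nc h < eta ->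
    (nrm delta (fun k => ((U (t + h) k - U t k) / h - w k)%R) <= e%:E)%E.

Lemma nc_le_nrm (delta : R) w k (e : R) : 0 <= delta -> (nrm delta w <= e%:E)%E -> nc (w k) <= e.
Proof.
move=> d0 he; rewrite -lee_fin; apply: le_trans he; apply: le_trans (nrm_term _ _ k).
by rewrite lee_fin ler_peMl ?nc_ge0// weight_ge1.
Qed.

Lemma cder_unique delta U t w w' : 0 <= delta -> cder delta U t w -> cder delta U t w' -> w = w'.
Proof.
move=> d0 h1 h2; apply/funext => k; apply/eqP; rewrite -subr_eq0; apply/eqP/nc_eq0/eqP.
rewrite eq_le nc_ge0 andbT; apply/ler_addgt0Pr => e e0; rewrite add0r.
have e2 : 0 < e / 2 by rewrite divr_gt0.
have [eta1 p1 q1] := h1 _ e2; have [eta2 p2 q2] := h2 _ e2.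
pose x := Num.min eta1 eta2 / 2.
have x0 : 0 < x by rewrite divr_gt0// lt_min p1 p2.
have xm : x < Num.min eta1 eta2 by rewrite /x ltr_pdivrMr// ltr_pMr ?ltr1n// lt_min p1 p2.
have nx : nc x%:C = x by rewrite nc_real ger0_norm// ltW.
have xn0 : x%:C != 0 by rewrite (inj_eq (@complexI _)) gt_eqF.
move: xm; rewrite lt_min => /andP[xm1 xm2].
have := nc_le_nrm k d0 (q1 _ xn0 _); rewrite nx => /(_ xm1) a1.
have := nc_le_nrm k d0 (q2 _ xn0 _); rewrite nx => /(_ xm2) a2.
set D := _ / _ in a1 a2.
rewrite (_ : w k - w' k = - (D - w k) + (D - w' k)); last by ring.
apply: le_trans (le_normcD _ _) _; rewrite normcN.
by rewrite (_ : e = e / 2 + e / 2) ?lerD//; field.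
Qed.

Lemma cder_segment delta U t0 w (r : R) c k : 0 <= delta -> cder delta U (r%:C * t0) w ->
  is_derive r 1 (fun x : R => complex.Re (c * U (x%:C * t0) k)) (complex.Re (c * (t0 * w k))).
Proof.
move=> d0 hU; have [->|t00] := eqVneq t0 0.
  rewrite mul0r mulr0 (_ : (fun x : R => _) = cst (complex.Re (c * U 0 k))).
    exact: is_derive_cst.
  by apply/funext => x; rewrite mulr0.
have nt0 : 0 < nc t0 by rewrite lt_neqAle nc_ge0 andbT eq_sym; apply: contra_neq t00; exact: nc_eq0.
apply: is_derive_eps => e e0.
pose B := nc c * nc t0 + 1; have B0 : 0 < B by rewrite ltr_wpDl// mulr_ge0 ?nc_ge0.
have [|eta eta0 heta] := hU (e / B); first by rewrite divr_gt0.
exists (eta / nc t0); first by rewrite divr_gt0.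
move=> h h0 hlt.
have ht0 : h%:C * t0 != 0 by rewrite mulf_neq0// (inj_eq (@complexI _)).
have := nc_le_nrm k d0 (heta _ ht0 _); rewrite Normc.normcM nc_real -ltr_pdivlMr//.
move=> /(_ hlt); rewrite -mulrDl -rmorphD /= => hk.
rewrite (_ : _ / h - _ = complex.Re (c * t0 * ((U ((r + h)%:C * t0) k - U (r%:C * t0) k) / (h%:C * t0) - w k))).
  apply: le_trans (Re_le_nc _) _; rewrite !Normc.normcM.
  apply: le_trans (ler_wpM2l _ hk) _; first by rewrite mulr_ge0 ?nc_ge0.
  by rewrite mulrCA -[leRHS]mulr1 ler_pM2l// ler_pdivrMr// mul1r lerDl.
have -> : c * t0 * ((U ((r + h)%:C * t0) k - U (r%:C * t0) k) / (h%:C * t0) - w k) =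
   (h^-1)%:C * (c * U ((r + h)%:C * t0) k - c * U (r%:C * t0) k) - c * (t0 * w k).
  rewrite fmorphV; field.
  by rewrite t00 (inj_eq (@complexI _)) h0.
rewrite cReD cReN; congr (_ - _); rewrite mulrC -cReN -cReD.
by case: (_ - _) => a b; rewrite cReM /= mul0r subr0.
Qed.

(** Differentiability gives the local boundedness that [global_unique] asks for.
    *)
Lemma cder_bounded delta U t w : (nrm delta (U t) < +oo)%E -> (nrm delta w < +oo)%E ->
  cder delta U t w -> exists2 eta : R, 0 < eta & exists M : R, forall h, nc h < eta ->
    (nrm delta (U (t + h)%R) <= M%:E)%E.
Proof.
move=> hU hw hd.
have fU : nrm delta (U t) \is a fin_num by rewrite ge0_fin_numE ?nrm_ge0.
have fw : nrm delta w \is a fin_num by rewrite ge0_fin_numE ?nrm_ge0.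
have [eta eta0 heta] := hd 1 ltr01; exists eta => //.
exists (eta * (1 + fine (nrm delta w)) + fine (nrm delta (U t))) => h hlt.
have p1 : 0 <= fine (nrm delta w) by rewrite fine_ge0 ?nrm_ge0.
have [->|h0] := eqVneq h 0.
  by rewrite addr0 -[X in (X <= _)%E]fineK// lee_fin lerDr mulr_ge0 ?addr_ge0 ?(ltW eta0).
rewrite (_ : U (t + h) = fun k => h * (((U (t + h) k - U t k) / h - w k) + w k) + U t k).
  apply: le_trans (nrmD _ _ _) _; rewrite EFinD fineK// leeD2r// nrmZ EFinM.
  apply: lee_pmul.
  - by rewrite lee_fin nc_ge0.
  - exact: nrm_ge0.
  - by rewrite lee_fin ltW.
  - by apply: le_trans (nrmD _ _ _) _; rewrite EFinD fineK// leeD2r// heta.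
by apply/funext => k; field.
Qed.

Theorem cder_uniqueness delta rad (U1 U2 : R[i] -> int -> R[i]) : 0 < delta -> delta <= 1 ->
  (forall t, nc t < rad -> (nrm delta (U1 t) < +oo)%E /\ (nrm delta (Gam (U1 t) (U1 t)) < +oo)%E /\ cder delta U1 t (Gam (U1 t) (U1 t))) ->
  (forall t, nc t < rad -> (nrm delta (U2 t) < +oo)%E /\ (nrm delta (Gam (U2 t) (U2 t)) < +oo)%E /\ cder delta U2 t (Gam (U2 t) (U2 t))) ->
  U1 0 = U2 0 -> forall t, nc t < rad -> U1 t = U2 t.
Proof.
move=> d0 d1 h1 h2 h0 t ht.
have seg (r : R) : 0 <= r <= 1 -> nc (r%:C * t) < rad.
  move=> /andP[r0 r1]; apply: le_lt_trans ht.
  by rewrite Normc.normcM nc_real ger0_norm// ler_piMl ?nc_ge0.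
have bnd U : (forall t, nc t < rad -> (nrm delta (U t) < +oo)%E /\ (nrm delta (Gam (U t) (U t)) < +oo)%E /\ cder delta U t (Gam (U t) (U t))) ->
    forall s0 : R, 0 <= s0 < 1 -> exists2 e, 0 < e & exists M : R,
    forall r, s0 <= r <= s0 + e -> r <= 1 -> (nrm delta (U (r%:C * t)%R) <= M%:E)%E.
  move=> hU s0 /andP[s00 s01]; have [|a1 [a2 a3]] := hU (s0%:C * t).
    by apply: seg; rewrite s00 ltW.
  have [eta eta0 [M hM]] := cder_bounded a1 a2 a3.
  have n1 : 0 < nc t + 1 by rewrite ltr_wpDl ?nc_ge0.
  exists (eta / (nc t + 1) / 2); first by rewrite !divr_gt0.
  exists M => r /andP[r1 r2] _; rewrite (_ : r%:C * t = s0%:C * t + (r - s0)%:C * t); last first.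
    by rewrite -mulrDl -rmorphD subrKC.
  apply: hM; rewrite Normc.normcM nc_real ger0_norm ?subr_ge0//.
  apply: (@le_lt_trans _ _ (eta / (nc t + 1) / 2 * (nc t + 1))).
    apply: ler_pM; rewrite ?subr_ge0 ?nc_ge0 ?lerDl// lerBlDl//.
  by rewrite mulrAC divfK ?gt_eqF// ltr_pdivrMr// ltr_pMr// ltr1n.
have := @global_unique R (fun r => U1 (r%:C * t)) (fun r => U2 (r%:C * t)) t delta d0 d1
  (bnd _ h1) (bnd _ h2) _ _ _ 1.
rewrite lexx ler01 rmorph1 mul1r; apply => //.
- move=> c k r hr; have [_ [_ hd]] := h1 _ (seg r hr).
  exact: cder_segment (ltW d0) hd.
- move=> c k r hr; have [_ [_ hd]] := h2 _ (seg r hr).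
  exact: cder_segment (ltW d0) hd.
- by rewrite mul0r.
Qed.

End CoefficientDerivative.

(** * Solutions of the Cauchy problem *)

Section SolutionCoefficients.
Variables (R : realType) (s : R).
Hypothesis hs : 2^-1 < s.
Implicit Types (delta : R) (f w : R -> R[i]) (t h : R[i]) (u : R[i] -> R -> R[i]).

Let s30 : 0 < s + 3.
Proof. by move: hs; lra. Qed.

Lemma gnrm_ge0 delta sg (a : int -> R[i]) : (0 <= gnrm delta sg a)%E.
Proof. exact: poweR_ge0. Qed.

Lemma Gspace_nrm delta f : Gspace delta (s + 3) f -> (nrm delta (fourier f) < +oo)%E.
Proof.
move=> [_]; rewrite GnormE => hG; have [K K0 hK] := nrm_bnd hs.
have fG : gnrm delta (s + 3) (fourier f) \is a fin_num by rewrite ge0_fin_numE ?gnrm_ge0.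
have G0 : 0 < fine (gnrm delta (s + 3) (fourier f)) + 1.
  by rewrite ltr_wpDl// fine_ge0 ?gnrm_ge0.
apply: le_lt_trans (hK delta (fourier f) _ G0 _) (ltry _).
by rewrite EFinD fineK// leeDl// lee_fin.
Qed.

Lemma Gspace_rep delta f : 0 <= delta -> Gspace delta (s + 3) f -> rep f (fourier f).
Proof.
move=> d0 hf; apply: rep_L2; first by case: hf.
exact: nrm_csummable d0 (Gspace_nrm hf).
Qed.

Lemma Gspace_Fser delta rho (a : int -> R[i]) : 0 <= rho -> delta < rho -> (nrm rho a < +oo)%E ->
  Gspace delta (s + 3) (Fser a).
Proof.
move=> rho0 dr ha; have sa := nrm_csummable rho0 ha; split; first exact: Fser_L2.
have [C C0 hC] := gnrm_bnd s30 dr.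
have fa : nrm rho a \is a fin_num by rewrite ge0_fin_numE ?nrm_ge0.
rewrite GnormE (rep_fourier (rep_Fser sa)).
by apply: le_lt_trans (hC a (fine (nrm rho a)) _) (ltry _); rewrite fineK.
Qed.

Lemma fourier_diffquot u t h w k : circ_L2 (u (t + h)) -> circ_L2 (u t) -> circ_L2 w ->
  fourier (fun x => (u (t + h) x - u t x) / h - w x) k =
  (fourier (u (t + h)) k - fourier (u t) k) / h - fourier w k.
Proof.
move=> h1 h2 h3; have hD := circ_L2B h1 h2.
rewrite (_ : (fun x => _) = (fun x => h^-1 * (u (t + h) x - u t x) - w x)); last first.
  by apply/funext => x; rewrite mulrC.
rewrite fourierB; last exact: circ_L2_int.
  rewrite fourierZ; last exact: circ_L2_int.
  by rewrite (fourierB k (circ_L2_int h1) (circ_L2_int h2)) [X in X - _]mulrC.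
by apply: cintZ; exact: circ_L2_int.
Qed.

Lemma is_DtP delta u t w : is_Dt delta (s + 3) u t w <-> Gspace delta (s + 3) w /\
  forall e : R, 0 < e -> exists2 eta : R, 0 < eta & forall h, h != 0 -> nc h < eta ->
    (Gnorm delta (s + 3) (fun x => (u (t + h)%R x - u t x) / h - w x)%R <= e%:E)%E.
Proof.
rewrite /is_Dt; split=> -[h1 h2]; split=> //.
  move: h2 => /cvge0P h2 e e0; apply/dnbhs0C; apply: h2 => // h.
  exact: poweR_ge0.
apply/cvge0P => [h|e e0]; first exact: poweR_ge0.
by apply/dnbhs0C; exact: h2.
Qed.

Lemma disk_open (rad : R) t : disk rad t -> exists2 eta : R, 0 < eta & forall h, nc h < eta -> disk rad (t + h).
Proof.
rewrite /disk/= => ht; exists (rad - nc t); first by rewrite subr_gt0.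
move=> h; rewrite ltrBrDl => hlt; apply: le_lt_trans hlt; exact: le_normcD.
Qed.

(** By [nrm_bnd], a derivative for the norm of G^(delta,s+3) is one for the norm
    [nrm delta] of the coefficients. *)
Lemma is_Dt_cder delta rad u t w : 0 <= delta -> holomorphic_on delta (s + 3) (disk rad) u ->
  disk rad t -> is_Dt delta (s + 3) u t w -> cder delta (fun t => fourier (u t)) t (fourier w).
Proof.
move=> d0 hu ht /is_DtP[hw hd] e e0.
have [K K0 hK] := nrm_bnd hs; have eK : 0 < e / K by rewrite divr_gt0.
have [eta1 p1 q1] := disk_open ht; have [eta2 p2 q2] := hd _ eK.
exists (Num.min eta1 eta2); first by rewrite lt_min p1.
move=> h h0; rewrite lt_min => /andP[h1 h2].
have := hK delta (fourier (fun x => (u (t + h) x - u t x) / h - w x)) _ eK (q2 h h0 h2).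
rewrite mulrC divfK ?gt_eqF//; congr (nrm _ _ <= _)%E; apply/funext => k.
by rewrite fourier_diffquot//; [case: (hu _ (q1 h h1)) => -[]|case: (hu _ ht) => -[]|case: hw].
Qed.

Lemma holomorphic_Dt delta (D : set R[i]) u t : holomorphic_on delta (s + 3) D u -> D t ->
  is_Dt delta (s + 3) u t (Dt delta (s + 3) u t).
Proof. by move=> hu /hu[_ [w hw]]; exact: (xgetPex (fun=> 0) (ex_intro _ w hw)). Qed.

(** The coefficients of the time derivative and of the remaining terms of the
    equation cancel, and the latter are known by [rep_equation]. *)
Lemma solution_coef delta rad (u0 : R -> R) u t : 0 <= delta ->
  holomorphic_solution delta (s + 3) (disk rad) u0 u -> disk rad t ->
  let U := fun t => fourier (u t) in
  [/\ (nrm delta (U t) < +oo)%E, (nrm delta (Gam (U t) (U t)) < +oo)%E &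
      cder delta U t (Gam (U t) (U t))].
Proof.
move=> d0 [hu [_ heq]] ht U; have [hut _] := hu t ht.
have hD := holomorphic_Dt hu ht; have hDG : Gspace delta (s + 3) (Dt delta (s + 3) u t) by case: hD.
have hU := Gspace_nrm hut.
have r1 := Gspace_rep d0 hDG; have r2 := rep_equation d0 hU (Gspace_rep d0 hut).
have r12 := repD r1 r2.
have E : fourier (Dt delta (s + 3) u t) = Gam (U t) (U t).
  apply/funext => k; apply/eqP; rewrite -subr_eq0; apply/eqP.
  rewrite -[LHS](congr1 (fun g => g k) (rep_fourier r12)).
  have r0 : rep (fun=> 0 : R[i]) (fun=> 0).
    by apply: rep_eq (repZ 0 r1) _ _ => ?; rewrite mul0r.
  rewrite -[RHS](congr1 (fun g => g k) (rep_fourier r0)).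
  apply: fourier_ae; [by case: r12|by case: r0|].
  rewrite (_ : (fun x => _) = (fun x => Dt delta (s + 3) u t x + u t x * Dx (u t) x + Dx (Binv (nonlin (u t))) x)).
    exact: heq.
  by apply/funext => x; rewrite addrA.
split=> //; first by rewrite -E; exact: Gspace_nrm.
by rewrite -E; exact: is_Dt_cder hu ht hD.
Qed.

Lemma solution_unique delta rad (u0 : R -> R) u v : 0 < delta -> delta <= 1 -> 
  holomorphic_solution delta (s + 3) (disk rad) u0 u ->
  holomorphic_solution delta (s + 3) (disk rad) u0 v ->
  forall t, disk rad t -> circ_eq (v t) (u t).
Proof.
move=> d0 d1 hu hv t ht; have d0' := ltW d0.
have D0 : disk rad (0 : R[i]).
  by apply: (le_lt_trans _ ht); rewrite Normc.normc0 nc_ge0.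
have eqU : fourier (u t) = fourier (v t).
  apply: (@cder_uniqueness R delta rad (fun t => fourier (u t)) (fun t => fourier (v t))) => //.
  - by move=> t' /(solution_coef d0' hu)[].
  - by move=> t' /(solution_coef d0' hv)[].
  - have ru := Gspace_rep d0' (proj1 (proj1 hu 0 D0)).
    have rv := Gspace_rep d0' (proj1 (proj1 hv 0 D0)).
    apply/funext => k; apply: fourier_ae; [by case: ru|by case: rv|].
    by apply: circ_eq_trans (proj1 (proj2 hu)) _; apply: circ_eq_sym; case: (proj2 hv).
have ru := Gspace_rep d0' (proj1 (proj1 hu t ht)).
have rv := Gspace_rep d0' (proj1 (proj1 hv t ht)).
case: ru => _ eu _; case: rv => _ ev _; apply: circ_eq_trans ev _.
by apply: circ_eq_sym; rewrite -eqU.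
Qed.

Section Existence.
Variables (M delta : R) (a : int -> R[i]).
Hypotheses (M0 : 0 < M) (ha : (nrm 1 a <= M%:E)%E) (d0 : 0 < delta) (d1 : delta < 1).

Let T := (growth M)^-1.
Let u t := Fser (Usol a t).

(** The gap 1 - delta - Q |t| is shared between three purposes: a radius rho
    above delta, where the norm of G^(delta,s+3) is controlled, a radius rho'
    above rho, where the derivative in [Gam] is paid, and a disk of radius r
    around 0 that contains a neighbourhood of t. *)
Lemma existence_params t : disk (T * (1 - delta)) t -> exists r rho rho' : R,
  [/\ nc t < r, delta < rho, rho < rho', rho' < 1 & growth M * r < 1 - rho'].
Proof.
rewrite /disk/= => ht; have Q0 : 0 < growth M := growth_gt0 M0; have n0 := nc_ge0 t.
have : growth M * nc t < 1 - delta by rewrite mulrC -ltr_pdivlMr// mulrC.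
set q := growth M * nc t => hq; have q0 : 0 <= q by rewrite mulr_ge0// ltW.
(* delta + q + 4 x = 1: two x for the radii, one for r, one for the strict
   inequality *)
pose x := (1 - delta - q) / 4; have x0 : 0 < x by rewrite divr_gt0// subr_gt0.
exists (nc t + x / growth M), (delta + x), (delta + 2 * x); split.
- by rewrite ltrDl divr_gt0.
- by rewrite ltrDl.
- by rewrite ltrD2l; move: x0; lra.
- by rewrite /x; lra.
- rewrite mulrDr mulrCA divff ?gt_eqF// mulr1 -/q.
  by move: x0; rewrite /x; lra.
Qed.

Lemma Usol_is_Dt t : disk (T * (1 - delta)) t ->
  Gspace delta (s + 3) (u t) /\ is_Dt delta (s + 3) u t (Fser (dUsol a t)).
Proof.
move=> /existence_params[r [rho [rho' [tr dr rr r1 hr]]]].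
have r0 : 0 < r := le_lt_trans (nc_ge0 t) tr.
have rho0 : 0 <= rho by rewrite ltW// (lt_trans d0).
have nU t' : nc t' <= r -> (nrm rho (Usol a t') < +oo)%E.
  by move=> ht'; apply: le_lt_trans (Usol_nrm M0 ha r0 rho0 rr r1 hr ht') (ltry _).
have nW : (nrm rho (dUsol a t) < +oo)%E.
  by apply: le_lt_trans (dUsol_nrm M0 ha r0 rho0 rr r1 hr (ltW tr)) (ltry _).
have gU t' : nc t' <= r -> Gspace delta (s + 3) (u t').
  by move=> ht'; exact: Gspace_Fser rho0 dr (nU t' ht').
have gW := Gspace_Fser rho0 dr nW.
split; first exact: gU (ltW tr).
apply/is_DtP; split=> // e e0.
have [C C0 hC] := gnrm_bnd s30 dr.
set Ms := M / (1 - growth M * r / (1 - rho')).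
have Ms0 : 0 <= Ms.
  have := Usol_nrm M0 ha r0 rho0 rr r1 hr (ltW tr).
  by move=> /(le_trans (nrm_ge0 _ _)); rewrite lee_fin.
pose B := C * (Ms / r ^+ 2) + 1.
have B0 : 0 < B by rewrite ltr_wpDl// mulr_ge0 ?(ltW C0)// divr_ge0// sqr_ge0.
exists (Num.min (r - nc t) (e / B)); first by rewrite lt_min subr_gt0 tr divr_gt0.
move=> h h0; rewrite lt_min => /andP[h1 h2].
have thr : nc t + nc h <= r by rewrite -lerBrDl ltW.
have th : nc (t + h) <= r by apply: le_trans (le_normcD _ _) thr.
have hd := hC _ _ (Usol_deriv M0 ha r0 rho0 rr r1 hr h0 thr).
rewrite GnormE (_ : fourier _ = fun k => (Usol a (t + h) k - Usol a t k) / h - dUsol a t k).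
  apply: le_trans hd _; rewrite lee_fin -/Ms.
  apply: (@le_trans _ _ (nc h * B)); last by rewrite -ler_pdivlMr// ltW.
  rewrite (_ : C * _ = nc h * (C * (Ms / r ^+ 2))); last by ring.
  by rewrite ler_wpM2l ?nc_ge0// lerDl.
apply/funext => k; have tr' := ltW tr.
rewrite fourier_diffquot; [|exact: (proj1 (gU _ th))|exact: (proj1 (gU _ tr'))|exact: (proj1 gW)].
have FU t' (ht' : nc t' <= r) : fourier (u t') k = Usol a t' k.
  exact: fourier_Fser k (nrm_csummable rho0 (nU t' ht')).
have FW := fourier_Fser k (nrm_csummable rho0 nW).
by congr ((_ - _) / _ - _); [exact: FU|exact: FU|exact: FW].
Qed.

Lemma Usol_solution (u0 : R -> R) : circ_eq (Fser a) (cplx u0) ->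
  holomorphic_solution delta (s + 3) (disk (T * (1 - delta))) u0 u.
Proof.
move=> hu0; have d0' := ltW d0.
have hol : holomorphic_on delta (s + 3) (disk (T * (1 - delta))) u.
  by move=> t /Usol_is_Dt[h1 h2]; split=> //; exists (Fser (dUsol a t)).
split=> //; split=> [|t ht]; first by rewrite /u Usol0.
have [gU hd] := Usol_is_Dt ht.
have hD := holomorphic_Dt hol ht; have gD : Gspace delta (s + 3) (Dt delta (s + 3) u t) by case: hD.
have [r [rho [rho' [tr dr rr r1 hr]]]] := existence_params ht.
have r0 : 0 < r := le_lt_trans (nc_ge0 t) tr.
have rho0 : 0 <= rho by rewrite ltW// (lt_trans d0).
have nU : (nrm rho (Usol a t) < +oo)%E.
  by apply: le_lt_trans (Usol_nrm M0 ha r0 rho0 rr r1 hr (ltW tr)) (ltry _).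
have nW : (nrm rho (dUsol a t) < +oo)%E.
  by apply: le_lt_trans (dUsol_nrm M0 ha r0 rho0 rr r1 hr (ltW tr)) (ltry _).
have E : fourier (Dt delta (s + 3) u t) = dUsol a t.
  rewrite (cder_unique d0' (is_Dt_cder d0' hol ht hD) (is_Dt_cder d0' hol ht hd)).
  exact: rep_fourier (rep_Fser (nrm_csummable rho0 nW)).
have rD := Gspace_rep d0' gD; rewrite E in rD.
have rN := rep_equation rho0 nU (rep_Fser (nrm_csummable rho0 nU)).
have r0' : rep (fun=> 0 : R[i]) (fun=> 0).
  by apply: rep_eq (repZ 0 rD) _ _ => ?; rewrite mul0r.
have [_ e1 _] := repD rD rN; have [_ e2 _] := r0'.
rewrite (_ : (fun x => _) = (fun x => Dt delta (s + 3) u t x + (u t x * Dx (u t) x + Dx (Binv (nonlin (u t))) x))).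
  apply: circ_eq_trans e1 _; apply: circ_eq_sym; move: e2; congr (circ_eq _ (Fser _)).
  by apply/funext => k; rewrite (dUsolE M0 ha r0 rho0 rr r1 hr k (ltW tr)) subrr.
by apply/funext => x; rewrite [RHS]addrA.
Qed.

End Existence.
End SolutionCoefficients.

Theorem theorem17 (R : realType) (s : R) (hs : 2^-1 < s) :
  exists c : R, 0 < c /\
  forall u0 : R -> R, Gspace 1 (s + 3) (cplx u0) ->
  exists T : R,
    [/\ 0 < T,
        forall delta : R, 0 < delta -> delta < 1 ->
          exists u : R[i] -> R -> R[i],
            holomorphic_solution delta (s + 3) (disk (T * (1 - delta))) u0 u /\
            forall v : R[i] -> R -> R[i],
              holomorphic_solution delta (s + 3) (disk (T * (1 - delta))) u0 v ->
              forall t, disk (T * (1 - delta)) t -> circ_eq (v t) (u t)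
      & ~ circ_eq (cplx u0) (fun=> 0) ->
        T = c / fine (Gnorm 1 (s + 3) (cplx u0))].
Proof.
have [K K0p hK] := nrm_bnd hs.
have c0 : 0 < 16 * expR 1 * K0 R * K by rewrite !mulr_gt0 ?expR_gt0 ?K0_gt0.
exists (16 * expR 1 * K0 R * K)^-1; split; first by rewrite invr_gt0.
move=> u0 hu0; set a := fourier (cplx u0).
have fG : gnrm 1 (s + 3) a \is a fin_num.
  by rewrite ge0_fin_numE ?gnrm_ge0//; case: hu0.
have [G [G0 hG GE]] : exists G : R, [/\ 0 < G, (gnrm 1 (s + 3) a <= G%:E)%E &
    ~ circ_eq (cplx u0) (fun=> 0) -> G = fine (gnrm 1 (s + 3) a)].
  have g0 : 0 <= fine (gnrm 1 (s + 3) a) by rewrite fine_ge0 ?gnrm_ge0.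
  have [gp|gn] := ltP 0 (fine (gnrm 1 (s + 3) a)).
    by exists (fine (gnrm 1 (s + 3) a)); rewrite fineK.
  exists 1; split=> //; first by rewrite -[X in (X <= _)%E]fineK// lee_fin (le_trans gn).
  case; apply: fourier_inj (proj1 hu0) _ => k.
  have : (gnrm 1 (s + 3) a <= 0%:E)%E by rewrite -[X in (X <= _)%E]fineK// lee_fin.
  rewrite gnrm_le// expr0n/= => h.
  have : ((gterm 1 (s + 3) a k)%:E <= 0%:E)%E.
    apply: le_trans h; apply: (term_le_es (f := fun k => (gterm 1 (s + 3) a k)%:E) k) => i.
    by rewrite lee_fin gterm_ge0.
  rewrite lee_fin gtermE => h2; apply/nc_eq0/eqP.
  have : (gwt 1 (s + 3) k * nc (a k)) ^+ 2 == 0 by rewrite eq_le h2 sqr_ge0.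
  by rewrite expf_eq0/= mulf_eq0 gt_eqF ?gwt_gt0.
have M0 : 0 < K * G by rewrite mulr_gt0.
have ha := hK _ _ _ G0 hG.
exists (growth (K * G))^-1; split.
- by rewrite invr_gt0 growth_gt0.
- move=> delta d0 d1.
  have sol : holomorphic_solution delta (s + 3) (disk ((growth (K * G))^-1 * (1 - delta))) u0
      (fun t => Fser (Usol a t)).
    apply: Usol_solution => //; apply: circ_eq_sym.
    by case: (Gspace_rep hs ler01 hu0).
  exists (fun t => Fser (Usol a t)); split=> // v hv.
  exact: (solution_unique hs d0 (ltW d1) sol hv).
- by move=> hn; rewrite GnormE -/a -(GE hn) /growth -invfM mulrA.
Qed.
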